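(* Let $g>1$ be an integer and let $K$ be an algebraically closed field. Suppose that one of the following conditions holds: (a) $\mathrm{char}(K)=0$; (b) $q=2g+1$ is a prime, and $p:=\mathrm{char}(K)$ is an odd prime that is a primitive root modulo $q$. Let $(\mathcal{C},\mathcal{O})$ be a marked genus $g$ odd degree hyperelliptic curve over $K$. Suppose that $\#(\mathcal{C}_{2g+1}^{*}(K))>4$. Then: (i) If $\mathrm{char}(K)=0$, then $\mathcal{C}$ is defined over a number field. (ii) If $\mathrm{char}(K)=p>0$, then $\mathcal{C}$ is defined over a finite field.
   Context: Let $K$ be an algebraically closed field of characteristic $\neq 2$. A marked genus $g$ odd degree hyperelliptic curve over $K$ is a pair $(\mathcal{C},\mathcal{O})$, where $\mathcal{C}$ is a smooth irreducible projective hyperelliptic curve of genus $g>1$ over $K$ and $\mathcal{O}\in\mathcal{C}(K)$ is one of its $2g+2$ Weierstrass points (the fixed points of the hyperelliptic involution). Every such pair is isomorphic to $(\mathcal{C}_f,\infty)$, where $f(x)\in K[x]$ is a polynomial of degree $2g+1$ without repeated roots, $\mathcal{C}_f$ is the smooth projective model of the affine curve $y^2=f(x)$, and $\infty$ is its unique point at infinity. Let $J$ be the jacobian of $\mathcal{C}$. The curve $\mathcal{C}$ is embedded in $J$ by sending $P\in\mathcal{C}(K)$ to the linear equivalence class of the divisor $(P)-(\mathcal{O})$; in this way $\mathcal{C}(K)$ is regarded as a subset of the group $J(K)$. For a positive integer $d$, $\mathcal{C}_{d}^{*}(K)$ denotes the set of points of $\mathcal{C}(K)$ that have order exactly $d$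 in the group $J(K)$. ''$\mathcal{C}$ is defined over a subfield $F\subset K$'' means that there is a curve over $F$ whose base change to $K$ is isomorphic to $\mathcal{C}$ over $K$; ''defined over a number field (resp. finite field)'' means that this holds for some subfield $F\subset K$ that is a finite extension of $\mathbb{Q}$ (resp. a finite field). *)

(* Defs.v *)
(* Classical reasoning (choice on arbitrary types, Prop-valued sets) comes from
   MathComp-Analysis, divisors are elements of {freeg _ / int}. *)
From HB Require Import structures.
From mathcomp Require Import all_boot all_order all_algebra all_field.
From mathcomp Require Import generic_quotient ring_quotient fraction.
From mathcomp Require Import boolp classical_sets functions cardinality.
From mathcomp.multinomials Require Import freeg.

Set Implicit Arguments.
Unset Strict Implicit.
Unset Printing Implicit Defensive.

Import GRing.Theory.

Local Open Scope ring_scope.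

(* Field extensions are given by morphisms j : k -> L, since extensions of
   infinite degree are needed. *)

Definition lin_indep (k L : fieldType) (j : {rmorphism k -> L})
    (n : nat) (b : 'I_n -> L) : Prop :=
  forall c : 'I_n -> k, \sum_i j (c i) * b i = 0 -> forall i, c i = 0.

Definition is_basis (k L : fieldType) (j : {rmorphism k -> L})
    (V : set L) (n : nat) (b : 'I_n -> L) : Prop :=
  [/\ forall i, V (b i), lin_indep j b &
      forall z, V z -> exists c : 'I_n -> k, z = \sum_i j (c i) * b i].

(* [L : k] = n *)
Definition has_ext_degree (k L : fieldType) (j : {rmorphism k -> L})
    (n : nat) : Prop :=
  exists b : 'I_n -> L, is_basis j setT b.

(* With this condition e is a k-embedding of k(t) into L, i.e. (for L the
   function field of a curve) a nonconstant morphism from the curve to the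
   projective line; its degree is the n such that has_ext_degree e n. *)
Definition const_compat (k L : fieldType) (j : {rmorphism k -> L})
    (e : {rmorphism {fraction {poly k}} -> L}) : Prop :=
  forall c : k, e (FracField.tofrac c%:P) = j c.

(* Curves are encoded by the classical equivalence between smooth (over a
   perfect field: regular) projective irreducible curves over k and function
   fields in one variable over k: the curve attached to L / k is the "abstract
   nonsingular curve" whose closed points are the discrete valuations of L
   trivial on k. Morphisms of curves are k-embeddings of function fields. *)
Record curve (k : fieldType) := Curve {
  funfield : fieldType;
  constf : {rmorphism k -> funfield};
  curveP : exists (e : {rmorphism {fraction {poly k}} -> funfield}) (n : nat),
    const_compat constf e /\ has_ext_degree e n
}.

(* A normalized discrete valuation, trivial on constants. The value at 0, which
   should be +oo, is fixed to the dummy value 0, so that a point is determined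
   by its order function. *)
Record curve_point (k : fieldType) (C : curve k) := CurvePoint {
  ord : funfield C -> int;
  ord0 : ord 0 = 0;
  ordM : forall a b, a != 0 -> b != 0 -> ord (a * b) = ord a + ord b;
  ordD : forall a b, a != 0 -> b != 0 -> a + b != 0 ->
    Num.min (ord a) (ord b) <= ord (a + b);
  ord_const : forall c : k, c != 0 -> ord (constf C c) = 0;
  ord_surj : exists2 t, t != 0 & ord t = 1
}.

HB.instance Definition _ (k : fieldType) (C : curve k) :=
  gen_eqMixin (curve_point C).
HB.instance Definition _ (k : fieldType) (C : curve k) :=
  gen_choiceMixin (curve_point C).

(* From here on the base field is algebraically closed: every point is rational
   (curve_point C is C(K)), so that deg, the sum of the coefficients, is the
   degree of a divisor. *)
Notation divisor C := {freeg (curve_point C) / int}.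

Definition deg0 (K : closedFieldType) (C : curve K) : {pred divisor C} :=
  fun D => deg D == 0.

Lemma deg0_zmod_closed (K : closedFieldType) (C : curve K) :
  zmod_closed (@deg0 K C).
Proof.
split; first by rewrite unfold_in raddf0.
by move=> D E; rewrite !unfold_in raddfB /= => /eqP-> /eqP->; rewrite subrr.
Qed.
HB.instance Definition _ (K : closedFieldType) (C : curve K) :=
  GRing.isZmodClosed.Build (divisor C) (@deg0 K C) (deg0_zmod_closed C).

Record div0 (K : closedFieldType) (C : curve K) := Div0 {
  div_of_div0 :> divisor C;
  div0P : div_of_div0 \in @deg0 K C
}.
HB.instance Definition _ (K : closedFieldType) (C : curve K) :=
  [isSub for @div_of_div0 K C].
HB.instance Definition _ (K : closedFieldType) (C : curve K) :=
  [Choice of div0 C by <:].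
HB.instance Definition _ (K : closedFieldType) (C : curve K) :=
  [SubChoice_isSubZmodule of div0 C by <:].

Definition principal (K : closedFieldType) (C : curve K) : {pred div0 C} :=
  fun D => `[< exists2 h : funfield C, h != 0 &
                 forall P : curve_point C, coeff P (val D) = ord P h >].

Lemma principal_zmod_closed (K : closedFieldType) (C : curve K) :
  zmod_closed (@principal K C).
Proof.
split.
  apply/asboolP; exists 1; first exact: oner_neq0.
  by move=> P; rewrite raddf0 /= -(rmorph1 (constf C)) ord_const ?oner_neq0.
move=> D E /asboolP[h hn0 hD] /asboolP[l ln0 lE]; apply/asboolP.
exists (h / l); first by rewrite mulf_neq0 ?invr_neq0.
have lVn0 : l^-1 != 0 by rewrite invr_eq0.
move=> P; rewrite raddfB /= hD lE (ordM P hn0 lVn0); congr +%R.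
apply/esym/eqP; rewrite -addr_eq0 addrC -(ordM P ln0 lVn0) divff //.
by rewrite -(rmorph1 (constf C)) ord_const ?oner_neq0.
Qed.
HB.instance Definition _ (K : closedFieldType) (C : curve K) :=
  GRing.isZmodClosed.Build (div0 C) (@principal K C) (principal_zmod_closed C).

(* The group J(K) of the jacobian, as degree zero divisors modulo linear
   equivalence. *)
Definition jacobian (K : closedFieldType) (C : curve K) : zmodType :=
  Quotient.quot (@principal K C).

Lemma deg0_pointB (K : closedFieldType) (C : curve K)
    (P O : curve_point C) :
  (<< P >> - << O >> : divisor C) \in @deg0 K C.
Proof. by rewrite unfold_in raddfB /= !degU subrr. Qed.

(* P |-> class of (P) - (O) *)
Definition to_jacobian (K : closedFieldType) (C : curve K)
    (O P : curve_point C) : jacobian C :=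
  \pi_(jacobian C)%qT (Div0 (deg0_pointB P O)).

Definition has_order (A : zmodType) (a : A) (d : nat) : Prop :=
  [/\ (0 < d)%N, a *+ d = 0 & forall m : nat, (0 < m < d)%N -> a *+ m != 0].

Definition torsion_points (K : closedFieldType) (C : curve K)
    (O : curve_point C) (d : nat) : set (curve_point C) :=
  [set P | has_order (to_jacobian O P) d]%classic.

Definition rr_space (K : closedFieldType) (C : curve K) (D : divisor C) :
    set (funfield C) :=
  [set z | z != 0 ->
     forall P : curve_point C, 0 <= ord P z + coeff P D]%classic.

(* l(D) = n *)
Definition rr_dim (K : closedFieldType) (C : curve K) (D : divisor C)
    (n : nat) : Prop :=
  exists b : 'I_n -> funfield C, is_basis (constf C) (rr_space D) b.

(* g is the maximum of deg D - l(D) + 1 over all divisors D (the definition of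
   the genus of a function field used in Riemann's theorem). *)
Definition has_genus (K : closedFieldType) (C : curve K) (g : nat) : Prop :=
  (forall (D : divisor C) (n : nat),
     rr_dim D n -> deg D - n%:Z + 1 <= g%:Z) /\
  (exists (D : divisor C) (n : nat), rr_dim D n /\ deg D - n%:Z + 1 = g%:Z).

(* s is the nontrivial automorphism over the projective line of a degree 2
   morphism from C to the line. For genus > 1 and characteristic != 2 it exists
   iff C is hyperelliptic, and is then unique. *)
Definition is_hyperelliptic_involution (K : closedFieldType) (C : curve K)
    (s : {rmorphism funfield C -> funfield C}) : Prop :=
  exists e : {rmorphism {fraction {poly K}} -> funfield C},
    [/\ const_compat (constf C) e, has_ext_degree e 2,
        forall r, s (e r) = e r & exists z, s z != z].

(* ord O \o s is the order function of the image of O under s (or its inverse,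
   which is s again). *)
Definition marked_odd_hyperelliptic (g : nat) (K : closedFieldType)
    (C : curve K) (O : curve_point C) : Prop :=
  has_genus C g /\
  exists s : {rmorphism funfield C -> funfield C},
    is_hyperelliptic_involution s /\ forall z, ord O (s z) = ord O z.

(* C is, up to isomorphism, the base change of C0 along i : F -> K, i.e. the
   function field of C is isomorphic over K to the fraction field of
   funfield C0 (x)_F K: injectivity of funfield C0 (x)_F K -> funfield C is
   linear disjointness. When F is perfect this is base change of smooth
   projective curves; C0 is geometrically irreducible as C is irreducible. *)
Definition is_base_change (F K : fieldType) (i : {rmorphism F -> K})
    (C0 : curve F) (C : curve K) : Prop :=
  exists v : {rmorphism funfield C0 -> funfield C},
    [/\ forall a : F, v (constf C0 a) = constf C (i a),
        forall (n : nat) (b : 'I_n -> funfield C0),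
          lin_indep (constf C0) b -> lin_indep (constf C) (fun l => v (b l)) &
        forall z : funfield C,
          exists (n : nat) (a b : 'I_n -> funfield C0) (c d : 'I_n -> K),
            let den := \sum_l constf C (d l) * v (b l) in
            den != 0 /\ z = (\sum_l constf C (c l) * v (a l)) / den].

Definition defined_over (F K : fieldType) (i : {rmorphism F -> K})
    (C : curve K) : Prop :=
  exists C0 : curve F, is_base_change i C0 C.

Definition defined_over_number_field (K : fieldType) (C : curve K) : Prop :=
  exists (F : fieldExtType rat) (i : {rmorphism F -> K}), defined_over i C.

Definition defined_over_finite_field (K : fieldType) (C : curve K) : Prop :=
  exists (F : finFieldType) (i : {rmorphism F -> K}), defined_over i C.

(* Meaningful for q prime only: 'F_q is then Z/q. *)
Definition primitive_root_mod (p q : nat) : Prop :=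
  (q.-1).-primitive_root (p%:R : 'F_q).

(* Main.v *)
Require Import Defs.
From HB Require Import structures.
From mathcomp Require Import all_boot all_order all_algebra all_solvable all_field.
From mathcomp Require Import fraction.
From mathcomp Require Import boolp classical_sets functions cardinality.
From mathcomp Require Import ring zify.
From mathcomp.multinomials Require Import freeg.

Set Implicit Arguments.
Unset Strict Implicit.
Unset Printing Implicit Defensive.

Import Order.TTheory GRing.Theory Num.Theory.

Local Open Scope ring_scope.

(* Let O be the point at infinity of y^2 = f(x) and n = 2g + 1. A point of order n
   with abscissa a is the only zero of a function c y + v(x) with deg v <= g, whose
   norm shows that f = (x - a)^n + v^2 after rescaling. More than four such points
   have at least three distinct abscissae, which may be taken to be 0, 1, a after an
   affine change of x.

   Then v1 - v2 = t u_1 and v1 + v2 = t' u_2 with t t' = - n, where u_1 u_2 is, up to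
   a constant, x^n - (x - 1)^n, so that f is determined up to finitely many choices
   by t. If t were transcendental over the prime field, some valuation ring of K
   containing the prime field would have t in its maximal ideal. As a is either in
   the valuation ring or, exchanging 1 and a by rescaling, the inverse of an element
   of the maximal ideal, the relations with v3 exclude this. The first case needs the
   complex conjugation zeta -> zeta^-1 of the n-th roots of unity; in characteristic
   p it is a power of the Frobenius map since p is a primitive root modulo n.

   Hence, after an affine change of x, the coefficients of f generate a finite
   extension F of the prime field, and F(x, y) is a curve over F whose base change is
   the given one. *)

(** Two relations f = (x - a)^n + v^2 still leave t free. The third one makes f rigid, but it brings
    in its own unknown a, possibly transcendental as well. No elimination between t and a is carried
    out: the roots of u_1 and u_2, and of their analogues for the pairs (0, a) and (1, a), are
    affine images of the solutions of z^n = (z - 1)^n. These are algebraic over the prime field, so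
    distinct ones stay distinct modulo the maximal ideal, and the factorizations can be compared
    root by root there.

    More than four points are required because a point and its image under the involution share
    their abscissa, so four points may have only two abscissae.

    The hypotheses on the curve concern a function field, its discrete valuations and Riemann's
    definition of the genus. Hence the points over each abscissa, their residue fields, the oddness
    of deg f and the value (deg f - 1) / 2 of the genus all have to be derived from the equation y^2
    = f(x); only then does n match deg f. *)

Definition is_valring (L : fieldType) (V : subringClosed L) : Prop :=
  forall z : L, (z \in V) || (z^-1 \in V).

(** The maximal ideal of a valuation ring: z^-1 outside V already forces z into V. Zero is listed
    apart, since 0^-1 = 0 lies in V. *)
Definition maxid (L : fieldType) (V : subringClosed L) (z : L) : bool :=
  (z == 0) || (z^-1 \notin V).

(** * Valuation rings *)

Section ValuationRing.
Variables (L : fieldType) (V : subringClosed L).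
Hypothesis totV : is_valring V.
Implicit Types z w : L.

Lemma maxid0 : maxid V 0. Proof. by rewrite /maxid eqxx. Qed.

Lemma maxid_in z : maxid V z -> z \in V.
Proof. by case/orP=> [/eqP->|]; [apply: rpred0 | have := totV z; case: (z \in V) => //= ->]. Qed.

Lemma maxid1 : ~~ maxid V 1.
Proof. by rewrite /maxid oner_eq0 invr1 rpred1. Qed.

Lemma maxidMr z w : z \in V -> maxid V w -> maxid V (z * w).
Proof.
rewrite /maxid => Vz; have [-> | w0 /=] := eqVneq w 0; first by rewrite mulr0 eqxx.
have [-> | z0] := eqVneq z 0; first by rewrite mul0r eqxx.
rewrite mulf_eq0 (negPf w0) (negPf z0) /=; apply: contra => Vzw.
by rewrite -(mulVKf z0 w^-1) -invfM rpredM.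
Qed.

Lemma maxidN z : maxid V (- z) = maxid V z.
Proof. by rewrite /maxid oppr_eq0 invrN rpredN. Qed.

Lemma maxidVn z : z != 0 -> maxid V z^-1 = (z \notin V).
Proof. by move=> z0; rewrite /maxid invr_eq0 (negPf z0) invrK. Qed.

Lemma maxidD z w : maxid V z -> maxid V w -> maxid V (z + w).
Proof.
move=> mz mw; have [z0|z0] := eqVneq z 0; first by rewrite z0 add0r.
have [w0|w0] := eqVneq w 0; first by rewrite w0 addr0.
have /orP[Vzw|] := totV (z / w).
  have -> : z + w = (z / w + 1) * w by rewrite mulrDl mulfVK // mul1r.
  by apply: maxidMr mw; rewrite rpredD ?rpred1.
rewrite invf_div => Vwz; have -> : z + w = (w / z + 1) * z by rewrite mulrDl mulfVK // mul1r addrC.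
by apply: maxidMr mz; rewrite rpredD ?rpred1.
Qed.

Lemma maxidB z w : maxid V z -> maxid V w -> maxid V (z - w).
Proof. by move=> mz mw; rewrite maxidD ?maxidN. Qed.

Lemma maxidM z w : z \in V -> w \in V -> maxid V (z * w) = maxid V z || maxid V w.
Proof.
move=> Vz Vw; apply/idP/orP => [|[]mz]; last first.
- exact: maxidMr.
- by rewrite mulrC; apply: maxidMr.
rewrite /maxid mulf_eq0; case: eqP => [|_]; first by left.
case: eqP => [|_ /= h]; first by right.
by apply/orP; rewrite -negb_and; apply: contra h => /andP[? ?]; rewrite invfM rpredM.
Qed.

Lemma maxid_prod (I : Type) (r : seq I) (F : I -> L) :
  (forall i, F i \in V) -> maxid V (\prod_(i <- r) F i) = has (fun i => maxid V (F i)) r.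
Proof.
move=> VF; elim: r => [|i r IH]; first by rewrite big_nil (negPf maxid1).
by rewrite big_cons maxidM ?IH ?rpred_prod.
Qed.

(** Integral closedness for the equation z^2 - s z + p = 0: if z were outside V, z^-1 would be in
    the maximal ideal, and division by z^2 would put 1 there too. *)
Lemma valring_quad z s p : s \in V -> p \in V -> z * (s - z) = p -> z \in V.
Proof.
move=> Vs Vp e; have /orP[//|Vz] := totV z; apply/negPn/negP => nVz.
have z0 : z != 0 by apply: contraNneq nVz => ->; apply: rpred0.
have mz : maxid V z^-1 by rewrite maxidVn.
have : maxid V 1; last by rewrite (negPf maxid1).
have -> : 1 = (s - p * z^-1) * z^-1 by rewrite -e; field.
by apply: maxidMr mz; rewrite rpredB ?rpredM.
Qed.

End ValuationRing.

(** * Existence of valuation rings *)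

Section Chevalley.
Variables (L : fieldType).

Lemma char_poly_subring (B : subringClosed L) n (M : 'M[L]_n) :
  (forall i j, M i j \in B) -> char_poly M \is a polyOver B.
Proof.
move=> BM; rewrite /char_poly rpred_sum // => s _; rewrite rpredMsign rpred_prod // => i _.
by rewrite !mxE rpredB ?polyOverC // rpredMn // polyOverX.
Qed.

(* Determinant trick: the span N of the first m + k powers of x satisfies N = tN. *)
Lemma inv_in_adjoin_both (B : subringClosed L) (t x : L) (p q : {poly L}) :
    t \in B -> t != 0 -> x != 0 -> p \is a polyOver B -> q \is a polyOver B ->
  p.[x] = t^-1 -> q.[x^-1] = t^-1 -> t^-1 \in B.
Proof.
move=> Bt t0 x0 Bp Bq px qx.
pose m := size p; pose k := size q; pose N := (m + k).-1.
have m_gt0 : (0 < m)%N.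
  rewrite lt0n size_poly_eq0; apply: contra_eqN px => /eqP->.
  by rewrite horner0 eq_sym invr_eq0.
have k_gt0 : (0 < k)%N.
  rewrite lt0n size_poly_eq0; apply: contra_eqN qx => /eqP->.
  by rewrite horner0 eq_sym invr_eq0.
have N_gt0 : (0 < N)%N by rewrite /N -(prednK m_gt0) -(prednK k_gt0) addnS.
(* Column j writes t^-1 x^j in the powers x^0, ..., x^(N-1): through p, which raises exponents by
   less than m, if j < k, and through q, which lowers them by less than k, otherwise. *)
pose A : 'M[L]_N := \matrix_(i, j)
  if (j < k)%N then (if (j <= i)%N then p`_(i - j) else 0)
  else (if (i <= j)%N then q`_(j - i) else 0).
have BA i j : A i j \in B.
  rewrite mxE; case: ifP => _; case: ifP => _; rewrite ?rpred0 //; exact/polyOverP.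
pose v : 'rV[L]_N := \row_i x ^+ i.
have vA : v *m A = t^-1 *: v.
  apply/rowP => j; rewrite !mxE.
  have [jk|kj] := ltnP j k.
    rewrite -px horner_coef mulr_suml.
    transitivity (\sum_(j <= i < N) x ^+ i * p`_(i - j)).
      rewrite big_geq_mkord [RHS]big_mkcond /=; apply: eq_bigr => i _; rewrite !mxE jk.
      by case: ifP => _; rewrite ?mulr0.
    rewrite -[X in \sum_(X <= _ < _) _]add0n big_addn big_mkord.
    have mNj : (m <= N - j)%N.
      rewrite leq_subRL ?(ltnW (ltn_ord j)) // /N -ltnS prednK ?addn_gt0 ?m_gt0 //.
      by rewrite addnC ltn_add2l.
    rewrite (big_ord_widen _ (fun i => p`_i * x ^+ i * x ^+ j) mNj).
    rewrite [RHS]big_mkcond /=; apply: eq_bigr => i _.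
    rewrite addnK exprD; case: ltnP => mi; first by rewrite mulrC mulrA.
    by rewrite nth_default // mulr0.
  rewrite -qx horner_coef mulr_suml.
  transitivity (\sum_(i < N | (i <= j)%N) x ^+ i * q`_(j - i)).
    rewrite [RHS]big_mkcond /=; apply: eq_bigr => i _; rewrite !mxE ltnNge kj /=.
    by case: ifP => _; rewrite ?mulr0.
  rewrite -(big_ord_widen N (fun i => x ^+ i * q`_(j - i)) (ltn_ord j)).
  rewrite (reindex_inj rev_ord_inj) /=.
  rewrite (big_ord_widen j.+1 (fun i => q`_i * x^-1 ^+ i * x ^+ j)); last by rewrite (leq_trans kj).
  rewrite [RHS]big_mkcond /=; apply: eq_bigr => i _.
  have ij : (i <= j)%N by rewrite -ltnS.
  rewrite subSS subKn //; case: ltnP => ki; last by rewrite nth_default // mulr0.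
  rewrite -mulrA mulrC; congr (_ * _).
  by rewrite -[X in _ = _ * x ^+ X](subnK ij) addnC exprD mulrA exprVn mulVf ?mul1r // expf_neq0.
have v0 : v != 0.
  apply: contraTneq isT => /rowP/(_ (Ordinal N_gt0)); rewrite !mxE expr0 => /eqP.
  by rewrite oner_eq0.
have : root (char_poly A) t^-1 by rewrite -eigenvalue_root_char; apply/eigenvalueP; exists v.
have Bc := char_poly_subring BA; move/polyOverP: (Bc) => {}Bc.
rewrite rootE horner_coef size_char_poly big_ord_recr /=.
have := char_poly_monic A; rewrite monicE lead_coefE size_char_poly /= => /eqP->.
rewrite mul1r addrC addr_eq0 => /eqP e.
(* The monic equation of degree N for t^-1 over B, multiplied by t^(N-1), exhibits t^-1 as a
   polynomial in t over B. *)
have -> : t^-1 = t^-1 ^+ N * t ^+ N.-1.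
  by rewrite exprVn -{1}(prednK N_gt0) exprS invfM mulfVK // expf_neq0.
rewrite e mulNr mulr_suml rpredN rpred_sum // => i _.
have iN : (i <= N.-1)%N by rewrite -ltnS prednK.
rewrite -mulrA rpredM // -(subnK iN) exprD mulrCA exprVn mulVf ?expf_neq0 // mulr1.
by rewrite rpredX.
Qed.

(** Subrings as plain sets, the form that Zorn's lemma handles; [subringClosed_of_set] converts them
    back. *)
Definition is_subring (A : set L) : Prop :=
  [/\ A 1, forall x y, A x -> A y -> A (x - y) & forall x y, A x -> A y -> A (x * y)].

Lemma subringClosed_of_set (A : set L) :
  is_subring A -> exists B : subringClosed L, forall z, (z \in B) = `[< A z >].
Proof.
case=> A1 AB AM; pose P : {pred L} := fun z => `[< A z >].
have sP : subring_closed P.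
  split=> [|x y /asboolP ? /asboolP ?|x y /asboolP ? /asboolP ?]; apply/asboolP => //.
    exact: AB.
  exact: AM.
pose B : subringClosed L := HB.pack P (GRing.isSubringClosed.Build L P sP).
by exists B.
Qed.

Definition adjoin (B : subringClosed L) (x : L) : set L :=
  [set z | exists2 p, p \is a polyOver B & z = p.[x]]%classic.

Lemma adjoin_subring (B : subringClosed L) (x : L) : is_subring (adjoin B x).
Proof.
split; first by exists 1; rewrite ?rpred1 ?hornerC.
  by move=> _ _ [p Bp ->] [q Bq ->]; exists (p - q); rewrite ?hornerD ?hornerN // rpredB.
by move=> _ _ [p Bp ->] [q Bq ->]; exists (p * q); rewrite ?rpredM ?hornerM.
Qed.

Lemma sub_adjoin (B : subringClosed L) (x z : L) : z \in B -> adjoin B x z.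
Proof. by move=> Bz; exists z%:P; rewrite ?polyOverC ?hornerC. Qed.

Lemma adjoin_gen (B : subringClosed L) (x : L) : adjoin B x x.
Proof. by exists 'X; rewrite ?polyOverX ?hornerX. Qed.

(** A subring containing A and maximal among those without t^-1 is a valuation ring: if z and z^-1
    were both outside, adjoining either one would produce t^-1, which [inv_in_adjoin_both] excludes.
    Containing t but not t^-1, it has t in its maximal ideal. *)
Lemma chevalley (A : set L) (t : L) :
    is_subring A -> A t -> ~ A t^-1 ->
  exists V : subringClosed L,
    [/\ is_valring V, forall z, A z -> z \in V & maxid V t].
Proof.
move=> sA At nAt.
(* The set X is joined with A so that the empty union, which arises from the empty chain, satisfies
   [P] too. *)
pose P := [set X | is_subring (A `|` X) /\ ~ (A `|` X) t^-1]%classic.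
have [F FP Ftot|X [[sX nXt] maxX]] := @Zorn_bigcup L P.
  have up z w : (A `|` \bigcup_(X in F) X)%classic z -> (A `|` \bigcup_(X in F) X)%classic w ->
      exists S : set L, [/\ (S `<=` A `|` \bigcup_(X in F) X)%classic, is_subring S, S z & S w].
    case=> [Az|[X FX Xz]] [Aw|[Y FY Yw]].
    - by exists A; split=> // u; left.
    - exists (A `|` Y)%classic; split; [|by case: (FP _ FY)|by left|by right].
      by move=> u [|Yu]; [left | right; exists Y].
    - exists (A `|` X)%classic; split; [|by case: (FP _ FX)|by right|by left].
      by move=> u [|Yu]; [left | right; exists X].
    - have [XY|YX] := Ftot _ _ FX FY.
        exists (A `|` Y)%classic; split; [|by case: (FP _ FY)|by right; apply: XY|by right].
        by move=> u [|Yu]; [left | right; exists Y].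
      exists (A `|` X)%classic; split; [|by case: (FP _ FX)|by right|by right; apply: YX].
      by move=> u [|Yu]; [left | right; exists X].
  split.
    split; first by left; case: sA.
      by move=> z w /up H /H[S [SA [_ SB _] Sz Sw]]; apply/SA/SB.
    by move=> z w /up H /H[S [SA [_ _ SM] Sz Sw]]; apply/SA/SM.
  by case=> // -[X FX Xt]; case: (FP _ FX) => _; apply; right.
have [B BE] := subringClosed_of_set sX.
have nBt : t^-1 \notin B by rewrite BE; apply/asboolP.
have Bt : t \in B by rewrite BE; apply/asboolP; left.
have AB z : A z -> z \in B by move=> Az; rewrite BE; apply/asboolP; left.
have t0 : t != 0 by apply: contraNneq nBt => ->; rewrite invr0 rpred0.
have ext z : z \notin B -> adjoin B z t^-1.
  move=> nBz; apply: contrapT => nt.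
  have AE : (A `|` adjoin B z = adjoin B z)%classic.
    by apply/seteqP; split=> [u [/AB|//]|u ?]; [apply: sub_adjoin | right].
  apply: (maxX (adjoin B z)); last by split; rewrite AE //; apply: adjoin_subring.
  split=> [u Xu|sub]; first by apply: sub_adjoin; rewrite BE; apply/asboolP; right.
  by case/negP: nBz; rewrite BE; apply/asboolP; right; apply/sub/adjoin_gen.
exists B; split=> //; last by rewrite /maxid nBt orbT.
move=> z; apply/negPn/negP; rewrite negb_or => /andP[/[dup] nBz /ext[p Bp pt]].
move=> /ext[q Bq qt]; have z0 : z != 0 by apply: contraNneq nBz => ->; apply: rpred0.
by case/negP: nBt; apply: (inv_in_adjoin_both Bt t0 z0 Bp Bq).
Qed.

End Chevalley.

(** * Prime fields and roots of unity *)

Section PrimeField.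
Variable K : fieldType.

Lemma intr_pchar0_neq0 (m : int) : [pchar K] =i pred0 -> m != 0 -> m%:~R != 0 :> K.
Proof.
move=> /pcharf0P K0; case: m => n n0; first by rewrite -pmulrn K0.
by rewrite NegzE mulrNz oppr_eq0 -pmulrn K0.
Qed.

(** Denominators are invertible in characteristic 0, so [ratr] into K is additive and
    multiplicative. *)
Lemma rat_rmorphism : [pchar K] =i pred0 -> exists _ : {rmorphism rat -> K}, True.
Proof.
move=> K0; have injZtoQ: @injective rat int intr by apply: intr_inj.
have nz_den x: (denq x)%:~R != 0 :> K by rewrite intr_pchar0_neq0 ?denq_eq0.
have fB : zmod_morphism (@ratr K).
  move=> x y; apply: (canLR (mulfK (nz_den _))); apply: (mulIf (nz_den x)).
  rewrite mulrAC mulrBl divfK ?nz_den // mulrAC -!rmorphM.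
  apply: (mulIf (nz_den y)); rewrite mulrAC mulrBl divfK ?nz_den //.
  rewrite -!(rmorphM, rmorphB); congr _%:~R; apply: injZtoQ.
  rewrite !(rmorphM, rmorphB) /= [_ - _]lock /= -lock !numqE.
  by rewrite (mulrAC y) -!mulrBl -mulrA mulrAC !mulrA.
have fM : monoid_morphism (@ratr K).
  split=> [|x y]; first by rewrite /ratr divr1.
  rewrite /ratr mulrC mulrAC; apply: canLR (mulKf (nz_den _)) _; rewrite !mulrA.
  do 2!apply: canRL (mulfK (nz_den _)) _; rewrite -!rmorphM; congr _%:~R.
  apply: injZtoQ; rewrite !rmorphM [x * y]lock /= !numqE -lock.
  by rewrite -!mulrA mulrA mulrCA -!mulrA (mulrCA y).
pose f : {rmorphism rat -> K} := HB.pack (@ratr K)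
  (GRing.isZmodMorphism.Build rat K _ fB) (GRing.isMonoidMorphism.Build rat K _ fM).
by exists f.
Qed.

Lemma Fp_rmorphism p : p \in [pchar K] -> exists _ : {rmorphism 'F_p -> K}, True.
Proof.
move=> pK.
exact: (ex_intro (fun=> True) (in_alg (pPrimeCharType pK) : {rmorphism 'F_p -> pPrimeCharType pK}) I).
Qed.

End PrimeField.

Lemma unity_roots_seq (K : closedFieldType) n : n%:R != 0 :> K ->
  exists rs : seq K, [/\ uniq rs, size rs = n & all n.-unity_root rs].
Proof.
move=> n0; have n_gt0 : (0 < n)%N by case: n n0 => //; rewrite eqxx.
have [rs e] := closed_field_poly_normal ('X^n - 1 : {poly K}).
rewrite (monicP (monicXnsubC _ n_gt0)) scale1r in e.
exists rs; split.
- by rewrite -separable_prod_XsubC -e separable_Xn_sub_1.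
- by apply/eqP; rewrite -eqSS -(size_prod_XsubC rs id) -e size_XnsubC.
- by apply/allP => z; rewrite -root_prod_XsubC -e.
Qed.

Lemma prim_root_closed (K : closedFieldType) n : n%:R != 0 :> K ->
  exists w : K, n.-primitive_root w.
Proof.
move=> n0; have n_gt0 : (0 < n)%N by case: n n0 => //; rewrite eqxx.
have [rs [urs srs ars]] := unity_roots_seq n0.
have /hasP[w _ w_prim] := has_prim_root n_gt0 ars urs (eq_leq (esym srs)).
by exists w.
Qed.

Section Conjugation.
Variable K : closedFieldType.

(** Some Phi_d with d dividing n vanishes at w; then w^d = 1, and primitivity leaves only d = n. *)
Lemma root_Cyclotomic_prim n (w : K) : n.-primitive_root w ->
  root (map_poly intr 'Phi_n) w.
Proof.
move=> pw; have n0 := prim_order_gt0 pw.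
have := congr1 (map_poly (intr : int -> K)) (prod_Cyclotomic n0).
rewrite rmorph_prod rmorphB rmorph1 /= map_polyXn => e.
have : root ('X^n - 1) w by rewrite rootE !hornerE (prim_expr_order pw) subrr.
rewrite -e; rewrite rootE horner_prod prodf_seq_eq0 => /hasP[d].
rewrite -dvdn_divisors // => dn /= dw.
suff <- : d = n by [].
have d0 : (0 < d)%N by apply: dvdn_gt0 dn.
apply/eqP; rewrite eqn_dvd dn /=.
have := congr1 (map_poly (intr : int -> K)) (prod_Cyclotomic d0).
rewrite rmorph_prod rmorphB rmorph1 /= map_polyXn => /(congr1 (horner^~ w)).
rewrite horner_prod (big_rem d) /=; last by rewrite -dvdn_divisors.
rewrite (eqP dw) mul0r !hornerE => /esym/eqP; rewrite subr_eq0 => /eqP wd.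
by rewrite (prim_order_dvd pw) wd.
Qed.

(* Irreducibility of the cyclotomic polynomials: w and w^-1 are conjugate. *)
Lemma root_prim_inv (iota : {rmorphism rat -> K}) n (w : K) (P : {poly rat}) :
  n.-primitive_root w -> root (map_poly iota P) w -> root (map_poly iota P) w^-1.
Proof.
move=> pw Pw; have n0 := prim_order_gt0 pw.
have [z pz] := C_prim_root_exists n0.
have [M [eM _ divM]] := minCpolyP z.
have Mphi : M = map_poly intr 'Phi_n.
  apply: (map_poly_inj (ratr : {rmorphism rat -> algC})).
  rewrite -eM (minCpoly_cyclotomic pz) -(Cintr_Cyclotomic pz) -map_poly_comp.
  by apply: eq_map_poly => b; rewrite /= rmorph_int.
have MK v : n.-primitive_root v -> root (map_poly iota M) v.
  move=> pv; rewrite Mphi -map_poly_comp.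
  have -> : map_poly (iota \o intr) 'Phi_n = map_poly intr 'Phi_n.
    by apply: eq_map_poly => b; rewrite /= rmorph_int.
  exact: root_Cyclotomic_prim.
have pwV : n.-primitive_root w^-1.
  have -> : w^-1 = w ^+ n.-1.
    have w0 : w != 0.
      apply: contra_eqN (prim_expr_order pw) => /eqP->.
      by rewrite expr0n eqn0Ngt n0 eq_sym oner_eq0.
    by apply: (mulIf w0); rewrite mulVf // -exprSr prednK // prim_expr_order.
  by rewrite prim_root_exp_coprime // -{2}(prednK n0) coprimenS.
suff /dvdpP[q ->] : M %| P by rewrite rmorphM rootM MK ?orbT.
pose D := gcdp P M.
have : ~~ coprimep P M.
  rewrite -(coprimep_map iota); apply/negP => /coprimep_root/(_ Pw).
  by rewrite -rootE MK.
have M0 : M != 0.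
  apply/eqP => M0; move: eM; rewrite M0 rmorph0 => /eqP; apply/negP.
  by rewrite monic_neq0 // minCpoly_monic.
have D0 : D != 0 by rewrite gcdp_eq0 negb_and M0 orbT.
rewrite coprimep_def -/D => sD.
(* Irreducibility enters here: a root of D in [algC] is a primitive n-th root of unity, its minimal
   polynomial is again M, and so M divides D. *)
have /closed_rootP[z' Dz'] : size (map_poly (ratr : rat -> algC) D) != 1%N by rewrite size_map_poly.
have pz' : n.-primitive_root z'.
  rewrite -(root_cyclotomic pz) -(minCpoly_cyclotomic pz) eM.
  by apply: root_dvdp Dz'; rewrite dvdp_map dvdp_gcdr.
have [M' [eM' _ divM']] := minCpolyP z'.
have MM' : M = M'.
  apply: (map_poly_inj (ratr : {rmorphism rat -> algC})); rewrite -eM -eM'.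
  rewrite (minCpoly_cyclotomic pz) (minCpoly_cyclotomic pz').
  by rewrite -(Cintr_Cyclotomic pz) -(Cintr_Cyclotomic pz').
by apply: dvdp_trans (dvdp_gcdl P M); rewrite -/D MM' -divM'.
Qed.

(** What allows inverting the n-th roots of unity inside an algebraic relation. In the second case m
    is a power of the characteristic, so z -> z^m is additive, and z^m = z^-1 when z^n = 1, as n
    divides m + 1. *)
Definition has_unity_conj n :=
  [pchar K] =i pred0 \/ exists m, [pchar K].-nat m /\ (n %| m.+1)%N.

(** In characteristic 0 the four roots are powers of one primitive root w, and the relation is a
    rational polynomial vanishing at w, hence at w^-1. Otherwise both sides are raised to the power
    m. *)
Lemma unity_conj_rel n (a b c d : K) : n%:R != 0 :> K -> has_unity_conj n ->
    a ^+ n = 1 -> b ^+ n = 1 -> c ^+ n = 1 -> d ^+ n = 1 ->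
    (1 - a) * (1 - b) = (1 - c) * (1 - d) ->
  (1 - a^-1) * (1 - b^-1) = (1 - c^-1) * (1 - d^-1).
Proof.
move=> n0 [K0|[m [pm nm]]] an bn cn dn e.
  have [w pw] := prim_root_closed n0.
  have pP (u : K) : u ^+ n = 1 -> exists i, u = w ^+ i.
    by move=> /(prim_rootP pw)[i ->]; exists i.
  have [[i Ea] [j Eb] [k Ec] [l Ed]] := And4 (pP a an) (pP b bn) (pP c cn) (pP d dn).
  rewrite {}Ea {}Eb {}Ec {}Ed in an bn cn dn e *.
  have [iota _] := rat_rmorphism K0.
  pose P : {poly rat} := (1 - 'X^i) * (1 - 'X^j) - (1 - 'X^k) * (1 - 'X^l).
  have PE : map_poly iota P = (1 - 'X^i) * (1 - 'X^j) - (1 - 'X^k) * (1 - 'X^l).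
    by rewrite /P !(rmorphB, rmorphM) /= !rmorph1 !map_polyXn.
  have := @root_prim_inv iota n w P pw.
  rewrite PE !rootE !hornerE e subrr eqxx => /(_ isT).
  by rewrite subr_eq0 -!exprVn => /eqP.
have inv (u : K) : u ^+ n = 1 -> u ^+ m = u^-1.
  have n_gt0 : (0 < n)%N by case: (n) n0 => //; rewrite eqxx.
  move=> un; have u0 : u != 0.
    by apply: contra_eqN un => /eqP->; rewrite expr0n eqn0Ngt n_gt0 eq_sym oner_eq0.
  apply: (mulIf u0); rewrite mulVf // -exprSr; case/dvdnP: nm => q ->.
  by rewrite mulnC exprM un expr1n.
have {}inv (u : K) : u ^+ n = 1 -> 1 - u^-1 = (1 - u) ^+ m.
  by move=> un; rewrite exprDn_pchar // exprNn_pchar // expr1n inv.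
by rewrite !inv // -!exprMn e.
Qed.

(* In terms of the n-th roots of unity (z - 1) / z, comparing the relation
   r1 s2 = r2 s1 with its conjugate. *)
Lemma unity_ratio n (r1 r2 s1 s2 : K) : n%:R != 0 :> K -> has_unity_conj n ->
    r1 ^+ n = (r1 - 1) ^+ n -> r2 ^+ n = (r2 - 1) ^+ n ->
    s1 ^+ n = (s1 - 1) ^+ n -> s2 ^+ n = (s2 - 1) ^+ n ->
  r1 != r2 -> r1 * s2 = r2 * s1 -> r1 = s1.
Proof.
move=> n0 conj r1n r2n s1n s2n r12 e.
have n_gt0 : (0 < n)%N by case: n n0 {conj r1n r2n s1n s2n} => //; rewrite eqxx.
have nz (z : K) : z ^+ n = (z - 1) ^+ n -> z != 0.
  move=> zn; apply: contra_eqN zn => /eqP->; rewrite sub0r expr0n eqn0Ngt n_gt0 eq_sym.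
  by rewrite expf_neq0 // oppr_eq0 oner_eq0.
have un (z : K) : z ^+ n = (z - 1) ^+ n -> (1 - z^-1) ^+ n = 1.
  move=> zn; have z0 := nz z zn.
  have -> : 1 - z^-1 = (z - 1) / z by rewrite mulrBl divff // mul1r.
  by rewrite expr_div_n -zn divff // expf_neq0.
have [[r10 r20] [s10 s20]] := ((nz _ r1n, nz _ r2n), (nz _ s1n, nz _ s2n)).
have n1 (z : K) : z ^+ n = (z - 1) ^+ n -> z != 1.
  move=> zn; apply: contra_eqN zn => /eqP->; rewrite subrr expr1n expr0n eqn0Ngt n_gt0.
  exact: oner_neq0.
have [[r11 r21] [s11 s21]] := ((n1 _ r1n, n1 _ r2n), (n1 _ s1n, n1 _ s2n)).
(* As 1 - (1 - z^-1) = z^-1, the relation r1 s2 = r2 s1 has the shape required by [unity_conj_rel].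
   The conjugate of z^-1 is - (z - 1)^-1. *)
have := @unity_conj_rel n (1 - r1^-1) (1 - s2^-1) (1 - r2^-1) (1 - s1^-1) n0 conj (un _ r1n) (un _ s2n) (un _ r2n) (un _ s1n).
rewrite !subKr -!invfM e => /(_ erefl).
have cj (z : K) : z != 0 -> z != 1 -> 1 - (1 - z^-1)^-1 = - (z - 1)^-1.
  move=> z0 z1; have z1' : z - 1 != 0 by rewrite subr_eq0.
  have -> : 1 - z^-1 = (z - 1) / z by rewrite mulrBl divff // mul1r.
  by rewrite invf_div; field.
rewrite !cj // !mulrNN -!invfM => /invr_inj e'.
have {e'} e' : r1 + s2 = r2 + s1.
  apply/eqP; rewrite -subr_eq0; apply/eqP.
  transitivity ((r1 * s2 - r2 * s1) - ((r1 - 1) * (s2 - 1) - (r2 - 1) * (s1 - 1))); first by ring.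
  by rewrite e e' !subrr.
(* The pairs r1, s2 and r2, s1 have the same sum and the same product. *)
have : (r1 - r2) * (r1 - s1) = 0.
  transitivity (r1 * ((r1 + s2) - (r2 + s1)) - (r1 * s2 - r2 * s1)); first by ring.
  by rewrite e e' !subrr mulr0 subrr.
move/eqP; rewrite mulf_eq0 !subr_eq0 (negPf r12) => /eqP //.
Qed.

End Conjugation.

(** * Three representations f = (x - a)^n + v^2 *)

Section AlgebraicInValring.
Variables (k K : fieldType) (iota : {rmorphism k -> K}) (V : subringClosed K).
Hypotheses (totV : is_valring V) (kV : forall c, iota c \in V).

(** Once factors X are removed, the equation of z has a nonzero constant term c, and z^-1 is - c^-1
    times a polynomial in z over k. *)
Lemma algebraic_inv_valring z :
  algebraicOver iota z -> z \in V -> z != 0 -> z^-1 \in V.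
Proof.
move=> [p p0 pz] Vz z0; elim/poly_ind: p p0 pz => [|p c IH]; first by rewrite eqxx.
rewrite rmorphD rmorphM /= map_polyX map_polyC /= rootE !hornerE /=.
have [-> | c0 _] := eqVneq c 0.
  rewrite addr0 mulf_eq0 polyX_eq0 orbF => p0.
  rewrite rmorph0 addr0 mulf_eq0 (negPf z0) orbF => pz; exact: IH.
rewrite addrC addr_eq0 => /eqP e.
have ic0 : iota c != 0 by rewrite fmorph_eq0.
have -> : z^-1 = - ((map_poly iota p).[z] * iota c^-1).
  apply: (mulIf z0); rewrite mulVf // mulNr mulrAC -mulNr -e.
  by rewrite -rmorphM divff // rmorph1.
rewrite rpredN rpredM // rpred_horner //.
by apply/polyOverP => i; rewrite coef_map; apply: kV.
Qed.

Lemma algebraic_in_valring z : algebraicOver iota z -> z \in V.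
Proof.
move=> az; have /orP[//|Vz] := totV z.
have [-> | z0] := eqVneq z 0; first exact: rpred0.
by rewrite -[z]invrK algebraic_inv_valring ?invr_eq0 //; apply: algebraic_inv.
Qed.

(** Nonzero elements algebraic over k are units of V. Reduction modulo the maximal ideal is thus
    injective on algebraic elements: congruences between them become equalities. *)
Lemma algebraic_maxid_eq0 z : algebraicOver iota z -> maxid V z -> z = 0.
Proof.
move=> az; rewrite /maxid => /predU1P[//|].
by rewrite algebraic_in_valring //; apply: algebraic_inv.
Qed.

End AlgebraicInValring.

(** Chevalley's lemma for the ring k[t]: t^-1 = p(t) would make t a root of p X - 1, which is
    nonzero since its value at 0 is -1. *)
Lemma transcendental_valring (k K : fieldType) (iota : {rmorphism k -> K}) t :
    ~ algebraicOver iota t ->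
  exists V : subringClosed K,
    [/\ is_valring V, forall c, iota c \in V & maxid V t].
Proof.
move=> nt; have t0 : t != 0 by apply/eqP => t0; apply: nt; rewrite t0; apply: algebraic0.
pose A := [set z | exists p : {poly k}, z = (map_poly iota p).[t]]%classic.
have [| | |V [totV AV mt]] := @chevalley K A t.
- split; first by exists 1; rewrite rmorph1 hornerC.
    by move=> _ _ [p ->] [q ->]; exists (p - q); rewrite rmorphB !hornerE.
  by move=> _ _ [p ->] [q ->]; exists (p * q); rewrite rmorphM !hornerE.
- by exists 'X; rewrite map_polyX hornerX.
- move=> [p e]; apply: nt; exists (p * 'X - 1).
    apply/eqP => /(congr1 (fun q : {poly k} => q.[0])) /eqP.
    by rewrite !hornerE oppr_eq0 oner_eq0.
  rewrite rootE rmorphB rmorphM rmorph1 /= map_polyX !hornerE -e.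
  by rewrite mulVf // subrr.
exists V; split=> // c; apply: AV; exists c%:P; by rewrite map_polyC hornerC.
Qed.

(** * Differences of n-th powers *)

Section PowerDifference.
Variable K : fieldType.
Implicit Types a b : K.

Lemma coef_XsubC_exp_pred a n : (0 < n)%N -> (('X - a%:P) ^+ n)`_n.-1 = - (a *+ n).
Proof.
move=> n0; have := @coefPn_prod_XsubC K (nseq n a).
rewrite size_nseq -lt0n => /(_ n0); 
by rewrite !big_nseq iter_mulr_1 iter_addr_0.
Qed.

(** The terms of degree n cancel and those of degree n - 1 differ by n (a - b). This is the origin
    of the products c1 c2 = n (a - b) below. *)
Lemma size_lead_diff_exp a b n : n%:R != 0 :> K -> a != b ->
  size (('X - b%:P) ^+ n - ('X - a%:P) ^+ n) = n /\
  lead_coef (('X - b%:P) ^+ n - ('X - a%:P) ^+ n) = n%:R * (a - b).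
Proof.
move=> n0 ab; have n_gt0 : (0 < n)%N by case: n n0 => //; rewrite eqxx.
set D := _ - _.
have Dn : D`_n.-1 = n%:R * (a - b).
  by rewrite coefB !coef_XsubC_exp_pred // mulrBr !mulr_natl opprK addrC.
have sD : size D = n.
  apply/eqP; rewrite eqn_leq; apply/andP; split.
    apply/leq_sizeP => j; rewrite leq_eqVlt => /predU1P[<-|nj].
      have := monicP (monic_exp n (monicXsubC a)); have := monicP (monic_exp n (monicXsubC b)).
      by rewrite !lead_coefE !size_exp_XsubC /= coefB => -> ->; rewrite subrr.
    by rewrite coefB !nth_default ?size_exp_XsubC ?subrr.
  rewrite -(prednK n_gt0) ltnNge; apply/negP => sD.
  by have /eqP := Dn; rewrite nth_default // eq_sym mulf_eq0 (negPf n0) subr_eq0 (negPf ab).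
by split; rewrite // lead_coefE sD.
Qed.

End PowerDifference.

Lemma algebraic_diff_root (k K : fieldType) (iota : {rmorphism k -> K}) n (z : K) :
  n%:R != 0 :> K -> z ^+ n = (z - 1) ^+ n -> algebraicOver iota z.
Proof.
move=> n0 e; exists (('X - 1%:P) ^+ n - ('X - 0%:P) ^+ n); last first.
  by rewrite rootE rmorphB !rmorphXn !rmorphB /= map_polyX !map_polyC /= rmorph1 rmorph0 subr0 !hornerE e subrr.
have n0k : n%:R != 0 :> k by rewrite -(fmorph_eq0 iota) rmorph_nat.
rewrite -size_poly_eq0.
have [|-> _] := @size_lead_diff_exp k 0 1 n n0k; first by rewrite eq_sym oner_eq0.
by case: (n) n0 => //; rewrite eqxx.
Qed.

Section Core.
Variables (K : closedFieldType) (g : nat).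
Let n := (2 * g + 1)%N.
Hypotheses (g_gt1 : (1 < g)%N) (n0 : n%:R != 0 :> K) (two0 : 2%:R != 0 :> K).
Implicit Types (a b : K) (v w : {poly K}).

(** At a double root z both the n-th and the (n-1)-th powers of z - a and z - b agree; then (a - b)
    (z - a)^(n-1) = 0, so z = a and hence z = b. *)
Lemma separable_diff_exp a b : a != b ->
  separable_poly (('X - b%:P) ^+ n - ('X - a%:P) ^+ n).
Proof.
move=> ab; rewrite unlock; apply/Pdiv.ClosedField.coprimepP => z.
rewrite rootE derivB !deriv_exp !derivXsubC !mul1r !hornerE subr_eq0 => /eqP e.
rewrite !hornerMn -mulrnBl !hornerE -mulr_natl mulf_neq0 // subr_eq0.
move: e; rewrite /n addn1 /= !exprS => e; apply/eqP => e2; move/eqP: e.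
rewrite e2 -subr_eq0 -mulrBl mulf_eq0 opprB addrC addrA subrK subr_eq0 (negPf ab) /=.
rewrite expf_eq0 => /andP[_ za]; move: e2; rewrite (eqP za) expr0n muln_eq0 /=.
have -> : (g == 0)%N = false by rewrite eqn0Ngt ltnW.
move/eqP; rewrite expf_eq0 => /andP[_]; rewrite subr_eq0 => /eqP zb.
by move: za; rewrite zb subr_eq0 eq_sym (negPf ab).
Qed.

(** The product has degree n - 1 = 2 g and neither factor exceeds degree g, so both have degree
    exactly g; separability of the product makes their roots distinct. *)
Lemma factor_diff_exp a b w1 w2 : a != b ->
    w1 * w2 = ('X - b%:P) ^+ n - ('X - a%:P) ^+ n ->
    (size w1 <= g.+1)%N -> (size w2 <= g.+1)%N ->
  exists c1 c2 s1 s2,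
    [/\ w1 = c1 *: \prod_(z <- s1) ('X - z%:P), w2 = c2 *: \prod_(z <- s2) ('X - z%:P),
        [/\ size s1 = g, size s2 = g, uniq s1 & uniq s2],
        forall z, z \in s1 ++ s2 -> (z - a) ^+ n = (z - b) ^+ n &
        c1 * c2 = n%:R * (a - b)].
Proof.
move=> ab e sw1 sw2; have [sD lD] := size_lead_diff_exp n0 ab.
have := separable_diff_exp ab; rewrite -e in sD lD *.
have [s1 e1] := closed_field_poly_normal w1; have [s2 e2] := closed_field_poly_normal w2.
have w12 : w1 * w2 != 0 by rewrite -size_poly_eq0 sD /n addn1.
have [w10 w20] : w1 != 0 /\ w2 != 0 by apply/andP; rewrite -negb_or -mulf_eq0.
rewrite separable_mul => /and3P[sep1 sep2 _].
have sz (w : {poly K}) s : w = lead_coef w *: \prod_(z <- s) ('X - z%:P) -> w != 0 -> size w = (size s).+1.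
  by move=> ew w0; rewrite ew size_scale ?lead_coef_eq0 // size_prod_XsubC.
have us (w : {poly K}) s : w = lead_coef w *: \prod_(z <- s) ('X - z%:P) -> w != 0 -> separable_poly w -> uniq s.
  move=> ew w0; rewrite ew (eqp_separable (eqp_scale _ _)) ?lead_coef_eq0 //.
  by rewrite separable_prod_XsubC.
have [ss1 ss2] : size s1 = g /\ size s2 = g.
  have := size_mul w10 w20; rewrite sD (sz _ _ e1 w10) (sz _ _ e2 w20).
  move: sw1 sw2; rewrite (sz _ _ e1 w10) (sz _ _ e2 w20) !ltnS /n => h1 h2 h3.
  split; apply/eqP; rewrite eqn_leq ?h1 ?h2 /=.
    by move: h2 h3; move: (size s1) (size s2) => i j; clear; lia.
  by move: h1 h3; move: (size s1) (size s2) => i j; clear; lia.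
exists (lead_coef w1), (lead_coef w2), s1, s2; split=> //.
- by split=> //; [apply: (us w1) | apply: (us w2)].
- move=> z zs; have : root (w1 * w2) z.
    rewrite rootM e1 e2 !rootZ ?lead_coef_eq0 // !root_prod_XsubC.
    by rewrite -mem_cat.
  by rewrite e rootE !hornerE subr_eq0 => /eqP.
- by rewrite -lead_coefM.
Qed.

(* For G the right-hand side,
   (x - 1) (2 g G - x G') + (x + 2 g) G = x^(2g) ((n + C) x + 2 g C),
   so that v, dividing G and G', divides (n + C) x + 2 g C. *)
Lemma not_square_degenerate (C : K) v :
  v ^+ 2 <> C *: 'X^(2 * g) + 'X^n - ('X - 1) ^+ n.
Proof.
set G := _ - _ => e.
have dG : G^`() = (C * (2 * g)%:R) *: 'X^((2 * g).-1) + n%:R *: 'X^(2 * g) - n%:R *: ('X - 1) ^+ (2 * g).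
  rewrite /G derivB derivD derivZ !derivXn deriv_exp derivB derivX derivC subr0 mul1r.
  by rewrite /n addn1 /= -scaler_nat scalerA -!scaler_nat.
have dv : G^`() = 2%:R *: (v * v^`()).
  by rewrite -e expr2 derivM mulrC -mulr2n scaler_nat.
have g2 : (0 < 2 * g)%N by rewrite muln_gt0 (ltnW g_gt1).
have gE : (2 * g == 0)%N = false by rewrite eqn0Ngt g2.
have nE : (n == 0)%N = false by rewrite /n addn1.
have N1n : (-1) ^+ n = -1 :> K by rewrite /n addn1 exprS exprM sqrrN !expr1n mulr1.
pose Q : {poly K} := (n%:R + C) *: 'X + (C * (2 * g)%:R)%:P.
have id : ('X - 1) * ((2 * g)%:R *: G - 'X * G^`()) + ('X + ((2 * g)%:R)%:P) * G = 'X^(2 * g) * Q.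
  rewrite dG /Q /G.
  have -> : ('X : {poly K}) ^+ n = 'X * 'X^(2 * g) by rewrite /n addn1 exprS.
  have -> : ('X - 1 : {poly K}) ^+ n = ('X - 1) * ('X - 1) ^+ (2 * g) by rewrite /n addn1 exprS.
  have -> : (n%:R : K) = (2 * g)%:R + 1 by rewrite /n natrD.
  rewrite -(prednK g2) [in 'X ^+ _]exprS /=.
  set Y := 'X^((2 * g).-1); set Z := ('X - 1) ^+ _; set m := _%:R.
  rewrite -!mul_polyC !(rmorphD, rmorphM, rmorph1) /=.
  ring.
have vQ : v %| Q.
  have : v %| 'X^(2 * g) * Q.
    rewrite -id dv -e; apply: dvdp_add.
      apply: dvdp_mull; apply: dvdp_sub.
        by rewrite expr2 scalerAl; apply: dvdp_mulIr.
      by apply: dvdp_mull; rewrite scalerAr; apply: dvdp_mulIl.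
    by rewrite expr2 mulrA; apply: dvdp_mulIr.
  rewrite Gauss_dvdpr // coprimep_expr //.
  have -> : ('X : {poly K}) = 'X - 0%:P by rewrite subr0.
  rewrite coprimep_XsubC.
  rewrite rootE; apply/eqP => v0.
  have := congr1 (horner^~ 0) e; rewrite /G !hornerE v0 expr0n /= !expr0n.
  rewrite gE nE !mulr0 addr0 sub0r => /eqP.
  by rewrite eq_sym oppr_eq0 expf_eq0 oppr_eq0 oner_eq0 andbF.
have v2s : (size v <= 1)%N -> v ^+ 2 = 1.
  move=> /size1_polyC ev.
  have := congr1 (horner^~ 0) e; rewrite /G ev !hornerE /= !expr0n.
  by rewrite gE nE N1n mulr0 !add0r opprK => h; rewrite -rmorphXn /= h.
have G1 : G.[1] = C + 1 by rewrite /G !hornerE !expr1n subrr expr0n nE subr0 mulr1.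
have dG1 : G^`().[1] = C * (2 * g)%:R + n%:R.
  rewrite dG !hornerE !expr1n subrr expr0n.
  rewrite gE; by rewrite !mulr1 mulr0 subr0.
(* If n + C != 0, then v divides the linear [Q], whereas v^2 has degree at least 2 g > 2, its
   coefficient in degree 2 g being n + C. *)
have [nC|nC] := eqVneq (n%:R + C) 0; last first.
  have Q0 : Q != 0.
    apply/eqP => /(congr1 (fun q : {poly K} => q`_1)); rewrite /Q coefD coefZ coefX coefC /= coef0.
    by rewrite mulr1 addr0 => /eqP; apply/negP.
  have := dvdp_leq Q0 vQ; apply/negP; rewrite -ltnNge.
  have -> : size Q = 2%N.
    rewrite /Q size_polyDl ?size_scale ?size_polyX // size_polyC; by case: eqP.
  have sG : (2 * g < size G)%N.
    rewrite ltnNge; apply/negP => sG; have : G`_(2 * g) = 0 by rewrite nth_default.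
    rewrite /G coefB coefD coefZ !coefXn eqxx.
    have := @coef_XsubC_exp_pred K 1 n; rewrite {1}/n addn1 => /(_ isT).
    have -> : n.-1 = (2 * g)%N by rewrite /n addn1.
    have -> : (2 * g == n)%N = false by rewrite /n addn1 ltn_eqF.
    by rewrite polyC1 => -> ; rewrite mulr1 addr0 opprK addrC => /eqP; apply/negP.
  have : (2 * g < size v + size v)%N.
    apply: leq_trans sG _; rewrite -e expr2; apply: leq_trans (size_polyMleq _ _) _.
    exact: leq_pred.
  by move: g_gt1; move: (size v) => m; clear; lia.
have Cn : C = - n%:R by apply/eqP; rewrite -addr_eq0 addrC nC.
(* Now C = - n. If 2 g != 0 in K, v divides a nonzero constant and G(0) = 1 gives v^2 = 1, against
   G(1) = 1 + C. If 2 g = 0 in K, then C = -1, so v(1) = 0 and G'(1) = 0, against G'(1) = 2 g C + n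
   = n. *)
have [m0|m0] := eqVneq ((2 * g)%:R : K) 0; last first.
  have sv : (size v <= 1)%N.
    have eQ : Q = (C * (2 * g)%:R)%:P by rewrite /Q nC scale0r add0r.
    have CQ0 : C * (2 * g)%:R != 0 by rewrite mulf_neq0 // Cn oppr_eq0.
    have Q0 : Q != 0 by rewrite eQ polyC_eq0.
    by apply: leq_trans (dvdp_leq Q0 vQ) _; rewrite eQ size_polyC CQ0.
  move: G1; rewrite -e v2s // hornerC => /eqP; rewrite -subr_eq0 opprD addrCA subrr addr0 oppr_eq0.
  by rewrite Cn oppr_eq0 (negPf n0).
have n1 : n%:R = 1 :> K by rewrite /n natrD m0 add0r.
have v1 : v.[1] = 0.
  apply/eqP; rewrite -sqrf_eq0 -horner_exp e G1 Cn n1 addNr //.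
move: dG1; rewrite dv hornerZ hornerM v1 mul0r mulr0 m0 mulr0 add0r => /eqP.
by rewrite eq_sym (negPf n0).
Qed.
End Core.

(** * Congruences between roots modulo the maximal ideal *)

Section Limits.
Variables (K : fieldType) (V : subringClosed K).
Hypothesis totV : is_valring V.
Implicit Types (s : seq K).

Lemma two_factor_split (c d S : K) : c + d = S -> S \in V -> c * d \in V -> c \in V /\ d \in V.
Proof.
move=> e SV cdV; have cV : c \in V.
  by apply: (valring_quad totV SV cdV); rewrite -e [c + d]addrC addrK.
by split=> //; rewrite (_ : d = S - c) ?rpredB // -e addrC addKr.
Qed.

(** The identity is multiplied by t. Then t c and t c' have sum t^2 + t t' and product t^2 c c', so
    they lie in V and one of them is in the maximal ideal. Modulo that ideal, the unit t t' times
    the product over s2 is therefore a multiple of the product over p or over p', and at a root r of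
    the former one of the factors r - z has to vanish. *)
Lemma limit_roots (t t' c c' : K) s1 s2 p p' :
    (forall z, t * \prod_(x <- s1) (z - x) + t' * \prod_(x <- s2) (z - x) =
               c * \prod_(x <- p) (z - x) + c' * \prod_(x <- p') (z - x)) ->
    t + t' = c + c' -> maxid V t -> t * t' \in V -> ~~ maxid V (t * t') ->
    c * c' \in V -> {subset s1 <= V} -> {subset s2 <= V} ->
    {subset p <= V} -> {subset p' <= V} ->
  exists2 q, q = p \/ q = p' & forall r, r \in s2 -> exists2 z, z \in q & maxid V (r - z).
Proof.
move=> ez ec mt ttV ttm ccV s1V s2V pV p'V.
have tV := maxid_in totV mt.
have [TV T'V] : t * c \in V /\ t * c' \in V.
  apply: (@two_factor_split _ _ (t * t + t * t')).
  - by rewrite -!mulrDr ec.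
  - by rewrite rpredD // rpredM.
  - have -> : t * c * (t * c') = t * t * (c * c') by ring.
    by rewrite rpredM // rpredM.
have mTT : maxid V (t * c) || maxid V (t * c').
  rewrite -maxidM //; have -> : t * c * (t * c') = (t * (c * c')) * t by ring.
  by apply: maxidMr => //; rewrite rpredM.
have mainq (d d' : K) q q' :
    (forall z, t * \prod_(x <- s1) (z - x) + t' * \prod_(x <- s2) (z - x) =
               d * \prod_(x <- q) (z - x) + d' * \prod_(x <- q') (z - x)) ->
    t + t' = d + d' -> {subset q <= V} -> {subset q' <= V} ->
    t * d' \in V -> maxid V (t * d) ->
    forall r, r \in s2 -> exists2 z, z \in q' & maxid V (r - z).
  move=> ezd ed qV q'V dV md r rs2; have rV := s2V r rs2.
  have prodV s : {subset s <= V} -> \prod_(x <- s) (r - x) \in V.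
    by move=> sV; rewrite big_seq rpred_prod // => x xs; rewrite rpredB //; apply: sV.
  have : maxid V (t * d' * \prod_(x <- q') (r - x)).
    have := ezd r; rewrite [X in _ + t' * X](big_rem r) //= subrr mul0r mulr0 addr0 => e.
    have -> : t * d' * \prod_(x <- q') (r - x) =
        (t * \prod_(x <- s1) (r - x)) * t - \prod_(x <- q) (r - x) * (t * d).
      by rewrite e; ring.
    by apply: maxidB => //; apply: maxidMr => //; rewrite ?rpredM ?prodV.
  (* If t d' were in the maximal ideal as well, so would be t t' = t d + t d' - t^2. *)
  rewrite maxidM ?prodV // => /orP[md'|].
    case/negP: ttm; have -> : t * t' = t * d + t * d' - t * t by rewrite -mulrDr -ed; ring.
    by apply: maxidB => //; [apply: maxidD | apply: maxidMr].
  rewrite big_seq big_mkcond maxid_prod => [/hasP[z zq']|z]; last first.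
    by case: ifP => [/q'V ? | _]; rewrite ?rpredB ?rpred1.
  by rewrite zq' => mz; exists z.
case/orP: mTT => mT.
  exists p'; first by right.
  exact: mainq ez ec pV p'V T'V mT.
exists p; first by left.
apply: (mainq c' c p' p) => //; first by move=> z; rewrite ez addrC.
by rewrite ec addrC.
Qed.

End Limits.

(** * Algebraicity of the coefficients of f *)

Section Core.
Variables (K : closedFieldType) (k : fieldType) (iota : {rmorphism k -> K}) (g : nat).
Let n := (2 * g + 1)%N.
Hypotheses (g_gt1 : (1 < g)%N) (n0 : n%:R != 0 :> K) (two0 : 2%:R != 0 :> K).
Hypothesis conj : has_unity_conj K n.
Implicit Types (a b : K) (v w : {poly K}).
Local Notation alg := (algebraicOver iota).

(** Subtracting the two expressions of f gives (v - w) (v + w) = (x - b)^n - (x - a)^n. *)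
Lemma factor_pair (f : {poly K}) a b v w : a != b ->
    f = ('X - a%:P) ^+ n + v ^+ 2 -> f = ('X - b%:P) ^+ n + w ^+ 2 ->
    (size v <= g.+1)%N -> (size w <= g.+1)%N ->
  exists c1 c2 s1 s2,
    [/\ v - w = c1 *: \prod_(z <- s1) ('X - z%:P), v + w = c2 *: \prod_(z <- s2) ('X - z%:P),
        [/\ size s1 = g, size s2 = g, uniq s1 & uniq s2],
        forall z, z \in s1 ++ s2 -> (z - a) ^+ n = (z - b) ^+ n &
        c1 * c2 = n%:R * (a - b)].
Proof.
move=> ab ev ew sv sw; apply: (factor_diff_exp g_gt1 n0 ab).
- transitivity ((('X - a%:P) ^+ n + v ^+ 2) - ('X - a%:P) ^+ n - w ^+ 2); first by ring.
  by rewrite -ev ew; ring.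
- by rewrite (leq_trans (size_polyD _ _)) // size_polyN geq_max sv sw.
- by rewrite (leq_trans (size_polyD _ _)) // geq_max sv sw.
Qed.

Lemma lead_prod_XsubC c (s : seq K) :
  (c *: \prod_(z <- s) ('X - z%:P))`_(size s) = c.
Proof.
have /monicP := monic_prod_XsubC s predT id.
by rewrite lead_coefE size_prod_XsubC coefZ => ->; rewrite mulr1.
Qed.

Lemma horner_prod_seq c (s : seq K) x :
  (c *: \prod_(z <- s) ('X - z%:P)).[x] = c * \prod_(z <- s) (x - z).
Proof.
rewrite hornerZ horner_prod; congr (_ * _); apply: eq_bigr => z _.
by rewrite !hornerE.
Qed.

Lemma sqrt_closed (x : K) : exists y : K, y ^+ 2 = x.
Proof.
have /closed_rootP[y] : size ('X^2 - x%:P : {poly K}) != 1%N by rewrite size_XnsubC.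
by rewrite rootE !hornerE subr_eq0 => /eqP <-; exists y.
Qed.

Section WithValring.
Variable V : subringClosed K.
Hypotheses (totV : is_valring V) (kV : forall c, iota c \in V).

Let algV := algebraic_in_valring totV kV.
Let algm0 := algebraic_maxid_eq0 totV kV.

Lemma alg_nat m : alg m%:R.
Proof. by rewrite -(rmorph_nat iota); apply: algebraic_id. Qed.

Lemma n_unit : n%:R \in V /\ ~~ maxid V n%:R.
Proof.
split; first exact: rpred_nat.
by apply/negP => /(algm0 (alg_nat n)) /eqP; apply/negP.
Qed.

(** The affine map sending 0 to a and 1 to b carries the solutions of r^n = (r - 1)^n, a finite set
    independent of a and b, onto the roots in question. *)
Lemma diff_root_param a b z : a != b -> (z - a) ^+ n = (z - b) ^+ n ->
  exists r, [/\ z = a + (b - a) * r, r ^+ n = (r - 1) ^+ n & alg r].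
Proof.
move=> ab e; have ba : b - a != 0 by rewrite subr_eq0 eq_sym.
exists ((z - a) / (b - a)).
have er : ((z - a) / (b - a)) ^+ n = ((z - a) / (b - a) - 1) ^+ n.
  have -> : (z - a) / (b - a) - 1 = (z - b) / (b - a).
    by apply: (mulIf ba); rewrite mulrBl mul1r !mulfVK //; ring.
  by rewrite !expr_div_n e.
by split=> //; [rewrite mulrCA divff // mulr1 addrC subrK | apply: algebraic_diff_root er].
Qed.

Lemma diff_root_nz (r : K) : r ^+ n = (r - 1) ^+ n -> r != 0 /\ r != 1.
Proof.
have nE : (n == 0)%N = false by rewrite /n addn1.
move=> e; split; apply: contra_eqN e => /eqP->.
  by rewrite sub0r expr0n nE eq_sym expf_neq0 // oppr_eq0 oner_eq0.
by rewrite subrr expr0n nE expr1n oner_eq0.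
Qed.

(* If t is in the maximal ideal, u_2 reduces to a factor of v1^2 - v3^2 and to a
   factor of v2^2 - v3^2, so that every root of u_2 is congruent to a
   multiple by a of a root of (z - 1)^n = z^n. With two such roots, unity_ratio
   gives a = 1 modulo the maximal ideal, and then 1 would be a root of u_2. *)
Lemma lead_not_maxid (f : {poly K}) a v1 v2 v3 t t' s1 s2 :
    f = ('X - 0%:P) ^+ n + v1 ^+ 2 -> f = ('X - 1%:P) ^+ n + v2 ^+ 2 ->
    f = ('X - a%:P) ^+ n + v3 ^+ 2 -> a != 0 -> a != 1 -> a \in V ->
    (size v1 <= g.+1)%N -> (size v2 <= g.+1)%N -> (size v3 <= g.+1)%N ->
    v1 - v2 = t *: \prod_(z <- s1) ('X - z%:P) ->
    v1 + v2 = t' *: \prod_(z <- s2) ('X - z%:P) ->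
    [/\ size s1 = g, size s2 = g, uniq s1 & uniq s2] ->
    (forall z, z \in s1 ++ s2 -> z ^+ n = (z - 1) ^+ n) -> t * t' = - n%:R ->
  ~~ maxid V t.
Proof.
move=> e1 e2 e3 a0 a1 aV sv1 sv2 sv3 d12 p12 [ss1 ss2 us1 us2] rs tt'; apply/negP => mt.
have [nV nm] := n_unit.
have ttV : t * t' \in V by rewrite tt' rpredN.
have ttm : ~~ maxid V (t * t') by rewrite tt' maxidN.
have rsV z : z \in s1 ++ s2 -> z \in V by move=> /rs/(algebraic_diff_root iota n0)/algV.
have s1V : {subset s1 <= V} by move=> z zs; apply: rsV; rewrite mem_cat zs.
have s2V : {subset s2 <= V} by move=> z zs; apply: rsV; rewrite mem_cat zs orbT.
have rs2 z : z \in s2 -> z ^+ n = (z - 1) ^+ n by move=> zs; apply: rs; rewrite mem_cat zs orbT.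
have alg2 z : z \in s2 -> alg z by move=> /rs2; apply: algebraic_diff_root.
(* Used for v = v1 with u = t and for v = v2 with u = - t, since 2 v1 and 2 v2 are the sum and the
   difference of v1 + v2 and v1 - v2. *)
have key (u c c' : K) v w p p' : u = t \/ u = - t -> v - w = c *: \prod_(z <- p) ('X - z%:P) ->
    v + w = c' *: \prod_(z <- p') ('X - z%:P) -> size p = g -> size p' = g ->
    v *+ 2 = u *: \prod_(z <- s1) ('X - z%:P) + t' *: \prod_(z <- s2) ('X - z%:P) ->
    c * c' \in V -> {subset p <= V} -> {subset p' <= V} ->
    exists2 q, q = p \/ q = p' & forall r, r \in s2 -> exists2 z, z \in q & maxid V (r - z).
  move=> eu dv pv sp sp' ev ccV pV p'V.
  have e : u *: \prod_(z <- s1) ('X - z%:P) + t' *: \prod_(z <- s2) ('X - z%:P) =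
           c *: \prod_(z <- p) ('X - z%:P) + c' *: \prod_(z <- p') ('X - z%:P).
    by rewrite -ev -dv -pv mulr2n; ring.
  apply: (@limit_roots K V totV u t' c c' s1 s2 p p') => //.
  - by move=> z; rewrite -!horner_prod_seq -!hornerD e.
  - have := congr1 (fun q : {poly K} => q`_g) e.
    by rewrite !coefD -{1}ss1 -{1}ss2 -{1}sp -{1}sp' !lead_prod_XsubC.
  - by case: eu => ->; rewrite ?maxidN.
  - by case: eu => ->; rewrite ?mulNr ?rpredN.
  - by case: eu => ->; rewrite ?mulNr ?maxidN.
have a0' : 0 != a by rewrite eq_sym.
have a1' : 1 != a by rewrite eq_sym.
have [c [c' [p [p' [d13 p13 [sp sp' _ _] rp cc']]]]] := factor_pair a0' e1 e3 sv1 sv3.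
have [d [d' [q [q' [d23 p23 [sq sq' _ _] rq dd']]]]] := factor_pair a1' e2 e3 sv2 sv3.
have pV z : z \in p ++ p' -> z \in V.
  by move=> /rp/(diff_root_param a0')[r [-> _ /algV rV]]; rewrite add0r subr0 rpredM.
have qV z : z \in q ++ q' -> z \in V.
  by move=> /rq/(diff_root_param a1')[r [-> _ /algV rV]]; rewrite rpredD ?rpred1 // rpredM // rpredB ?rpred1.
have [||||Q eQ HQ] := key t c c' v1 v3 p p' (or_introl erefl) d13 p13 sp sp'.
- by rewrite -d12 -p12; rewrite mulr2n; ring.
- by rewrite cc' rpredM // rpredB ?rpred0.
- by move=> z zp; apply: pV; rewrite mem_cat zp.
- by move=> z zp; apply: pV; rewrite mem_cat zp orbT.
have {eQ} HQ r : r \in s2 -> exists x, [/\ x ^+ n = (x - 1) ^+ n, alg x & maxid V (r - a * x)].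
  move=> /HQ[z zQ mz]; have : z \in p ++ p' by rewrite mem_cat; case: eQ zQ => -> ->; rewrite ?orbT.
  by move=> /rp/(diff_root_param a0')[x [ez xn ax]]; exists x; split=> //; rewrite ez add0r subr0 in mz.
have [||||Q' eQ' HQ'] := key (- t) d d' v2 v3 q q' (or_intror erefl) d23 p23 sq sq'.
- by rewrite scaleNr -d12 -p12; rewrite mulr2n; ring.
- by rewrite dd' rpredM // rpredB ?rpred1.
- by move=> z zp; apply: qV; rewrite mem_cat zp.
- by move=> z zp; apply: qV; rewrite mem_cat zp orbT.
have {eQ'} HQ' r : r \in s2 -> exists2 x, alg x & maxid V (r - (1 + (a - 1) * x)).
  move=> /HQ'[z zQ mz]; have : z \in q ++ q' by rewrite mem_cat; case: eQ' zQ => -> ->; rewrite ?orbT.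
  by move=> /rq/(diff_root_param a1')[x [ez xn ax]]; exists x => //; rewrite ez in mz.
(* Two distinct roots exist because g > 1. *)
have [r1 [r2 [r1s r2s r12]]] : exists r1 r2, [/\ r1 \in s2, r2 \in s2 & r1 != r2].
  case: s2 ss2 us2 {p12 key rs rsV s2V rs2 alg2 HQ HQ'} => [|x [|y s]] /=; rewrite ?inE.
  - by move=> g0; move: g_gt1; rewrite -g0.
  - by move=> g1; move: g_gt1; rewrite -g1.
  - by move=> _ /andP[]; rewrite negb_or => /andP[xy _] _; exists x, y; rewrite !inE !eqxx orbT.
have [x1 [x1n ax1 m1]] := HQ _ r1s; have [x2 [x2n ax2 m2]] := HQ _ r2s.
(* The unknown a is eliminated from the two congruences; what is left involves algebraic elements
   only, so it is an equality. *)
have rx : r1 * x2 = r2 * x1.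
  apply/eqP; rewrite -subr_eq0; apply/eqP/algm0.
    by apply: algebraic_sub; apply: algebraic_mul => //; apply: alg2.
  have -> : r1 * x2 - r2 * x1 = x2 * (r1 - a * x1) - x1 * (r2 - a * x2) by ring.
  by apply: maxidB => //; apply: maxidMr; rewrite ?algV.
have r1x1 := unity_ratio n0 conj (rs2 _ r1s) (rs2 _ r2s) x1n x2n r12 rx.
have [r10 r11] := diff_root_nz (rs2 _ r1s).
have ma : maxid V (a - 1).
  have : maxid V (r1 * (1 - a)) by have <- : r1 - a * x1 = r1 * (1 - a) by rewrite -r1x1; ring.
  rewrite maxidM ?(s2V _ r1s) ?rpredB ?rpred1 // => /orP[/(algm0 (alg2 _ r1s))/eqP|].
    by rewrite (negPf r10).
  by rewrite -maxidN opprB.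
have [x ax mx] := HQ' _ r1s.
have : maxid V (r1 - 1).
  have -> : r1 - 1 = (r1 - (1 + (a - 1) * x)) + x * (a - 1) by ring.
  by apply: maxidD => //; apply: maxidMr; rewrite ?algV.
move=> /(algm0 (algebraic_sub (alg2 _ r1s) (algebraic1 _)))/eqP.
by rewrite subr_eq0 (negPf r11).
Qed.

Lemma near_power z (q : seq K) : z \in V -> (forall x, x \in q -> maxid V x) ->
  maxid V (\prod_(x <- q) (z - x) - z ^+ size q).
Proof.
move=> zV; elim: q => [|x q IH] qm; first by rewrite big_nil subrr maxid0.
have mx : maxid V x by rewrite qm ?mem_head.
rewrite big_cons exprS; set P := \prod_(_ <- _) _.
have -> : (z - x) * P - z * z ^+ size q = (z - x) * (P - z ^+ size q) - z ^+ size q * x by ring.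
apply: maxidB => //; last by apply: maxidMr; rewrite ?rpredX.
apply: maxidMr; first by rewrite rpredB // (maxid_in totV).
by apply: IH => y yq; rewrite qm // inE yq orbT.
Qed.

Lemma alg_prod z (s : seq K) : alg z -> (forall x, x \in s -> alg x) ->
  alg (\prod_(x <- s) (z - x)).
Proof.
move=> az as_; rewrite big_seq; apply: (big_ind alg) => [||x xs].
- exact: algebraic1.
- exact: algebraic_mul.
- exact: algebraic_sub (as_ _ xs).
Qed.

(* If a is in the maximal ideal, the factors of v1^2 - v3^2 reduce to multiples of
   x^g, hence t^2 u_1 - n u_2 is congruent to (t^2 - n) x^g. Evaluating at 0, t^2 is
   congruent to an algebraic T. As congruent algebraic elements are equal,
   T u_1 - n u_2 = (T - n) x^g, and completing the square with n u_1 u_2 contradicts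
   not_square_degenerate. *)
Lemma third_not_maxid (f : {poly K}) a v1 v2 v3 :
    f = ('X - 0%:P) ^+ n + v1 ^+ 2 -> f = ('X - 1%:P) ^+ n + v2 ^+ 2 ->
    f = ('X - a%:P) ^+ n + v3 ^+ 2 -> a != 0 -> a != 1 ->
    (size v1 <= g.+1)%N -> (size v2 <= g.+1)%N -> (size v3 <= g.+1)%N ->
  ~~ maxid V a.
Proof.
move=> e1 e2 e3 a0 a1 sv1 sv2 sv3; apply/negP => ma.
have aV := maxid_in totV ma; have [nV nm] := n_unit.
have o01 : 0 != 1 :> K by rewrite eq_sym oner_eq0.
have [t [t' [s1 [s2 [d12 p12 [ss1 ss2 us1 us2] rs tt']]]]] := factor_pair o01 e1 e2 sv1 sv2.
have {}tt' : t * t' = - n%:R by rewrite tt' sub0r mulrN1.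
have {}rs z : z \in s1 ++ s2 -> z ^+ n = (z - 1) ^+ n by move=> /rs; rewrite subr0.
(* Changing the sign of v2 exchanges v1 - v2 and v1 + v2, so that [lead_not_maxid] applies to t' too
   and both t and t' are units of V. *)
have e2' : f = ('X - 1%:P) ^+ n + (- v2) ^+ 2 by rewrite sqrrN.
have nmt : ~~ maxid V t.
  exact: (lead_not_maxid e1 e2 e3 a0 a1 aV sv1 sv2 sv3 d12 p12 (And4 ss1 ss2 us1 us2) rs tt').
have nmt' : ~~ maxid V t'.
  apply: (lead_not_maxid e1 e2' e3 a0 a1 aV sv1 _ sv3 _ _ (And4 ss2 ss1 us2 us1)).
  - by rewrite size_polyN.
  - by rewrite opprK p12.
  - by rewrite d12.
  - by move=> z zs; apply: rs; move: zs; rewrite !mem_cat orbC.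
  - by rewrite mulrC.
have [t0 t'0] : t != 0 /\ t' != 0.
  by apply/andP; rewrite -negb_or -mulf_eq0 tt' oppr_eq0.
have [tV t'V] : t \in V /\ t' \in V.
  move: nmt nmt'; rewrite /maxid !negb_or !negbK => /andP[_ tV] /andP[_ t'V].
  split; [rewrite -(mulfK t'0 t) tt' | rewrite -(mulfK t0 t') [t' * t]mulrC tt'];
    by rewrite rpredM ?rpredN.
have a0' : 0 != a by rewrite eq_sym.
have [c [c' [p [p' [d13 p13 [sp sp' _ _] rp cc']]]]] := factor_pair a0' e1 e3 sv1 sv3.
have pm z : z \in p ++ p' -> maxid V z.
  by move=> /rp/(diff_root_param a0')[r [-> _ /algV rV]]; rewrite add0r subr0 mulrC; apply: maxidMr.
have ez : t *: \prod_(z <- s1) ('X - z%:P) + t' *: \prod_(z <- s2) ('X - z%:P) =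
          c *: \prod_(z <- p) ('X - z%:P) + c' *: \prod_(z <- p') ('X - z%:P).
  by rewrite -d12 -p12 -d13 -p13; ring.
have ec : c + c' = t + t'.
  have := congr1 (fun q : {poly K} => q`_g) ez.
  by rewrite !coefD -{1}ss1 -{1}ss2 -{1}sp -{1}sp' !lead_prod_XsubC.
have mcc : maxid V (c * c').
  by rewrite cc' sub0r mulrN maxidN; apply: maxidMr.
have [cV c'V] : c \in V /\ c' \in V.
  by apply: (two_factor_split totV ec); rewrite ?(maxid_in totV mcc) // rpredD.
have near z : z \in V -> maxid V (t * \prod_(x <- s1) (z - x) + t' * \prod_(x <- s2) (z - x) - (t + t') * z ^+ g).
  move=> zV; have pp q : (forall x, x \in q -> maxid V x) -> size q = g ->
      maxid V (\prod_(x <- q) (z - x) - z ^+ g) /\ \prod_(x <- q) (z - x) \in V.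
    move=> qm sq; split; first by rewrite -sq near_power.
    by rewrite big_seq rpred_prod // => x /qm/(maxid_in totV) xV; rewrite rpredB.
  have [mp pV] := pp p (fun x xp => pm x (eq_ind_r is_true (introT orP (or_introl xp)) (mem_cat _ _ _))) sp.
  have [mp' p'V] := pp p' (fun x xp => pm x (eq_ind_r is_true (introT orP (or_intror xp)) (mem_cat _ _ _))) sp'.
  rewrite -!horner_prod_seq -hornerD ez hornerD !horner_prod_seq -ec.
  set P := \prod_(_ <- _) _; set P' := \prod_(_ <- _) _.
  have -> : c * P + c' * P' - (c + c') * z ^+ g = c * (P - z ^+ g) + c' * (P' - z ^+ g) by ring.
  by apply: maxidD => //; apply: maxidMr.
pose U x := \prod_(y <- s1) (x - y); pose U' x := \prod_(y <- s2) (x - y).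
have {}near z : alg z -> maxid V (t ^+ 2 * U z - n%:R * U' z - (t ^+ 2 - n%:R) * z ^+ g).
  move=> az; have := maxidMr tV (near z (algV az)); rewrite -/(U z) -/(U' z).
  by congr (maxid V _); rewrite !mulrDr mulrN !mulrA !mulrDr tt'; ring.
have alg1 x : x \in s1 -> alg x.
  by move=> xs; apply: (algebraic_diff_root iota n0); apply: rs; rewrite mem_cat xs.
have alg2 x : x \in s2 -> alg x.
  by move=> xs; apply: (algebraic_diff_root iota n0); apply: rs; rewrite mem_cat xs orbT.
have aU z : alg z -> alg (U z) by move=> az; apply: alg_prod.
have aU' z : alg z -> alg (U' z) by move=> az; apply: alg_prod.
have U0 : U 0 != 0.
  rewrite /U big_seq prodf_seq_neq0; apply/allP => x _; apply/implyP => xs.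
  rewrite sub0r oppr_eq0; have /diff_root_nz[] // : x ^+ n = (x - 1) ^+ n.
  by apply: rs; rewrite mem_cat xs.
have U'0 : U' 0 != 0.
  rewrite /U' big_seq prodf_seq_neq0; apply/allP => x _; apply/implyP => xs.
  rewrite sub0r oppr_eq0; have /diff_root_nz[] // : x ^+ n = (x - 1) ^+ n.
  by apply: rs; rewrite mem_cat xs orbT.
pose T := n%:R * U' 0 / U 0.
have alg0 := algebraic0 iota.
have aT : alg T by apply: algebraic_mul; [apply: algebraic_mul; [apply: alg_nat | apply: aU'] | apply/algebraic_inv/aU].
have mT : maxid V (t ^+ 2 - T).
  have := maxidMr (algV (algebraic_inv (aU _ alg0))) (near 0 alg0).
  rewrite expr0n -[(g == 0)%N]negbK -lt0n (ltnW g_gt1) /= mulr0 subr0.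
  by congr (maxid V _); rewrite /T mulrBr mulrC mulfK // mulrC.
have id z : alg z -> T * U z - n%:R * U' z - (T - n%:R) * z ^+ g = 0.
  move=> az; have azg : alg (z ^+ g).
    by elim: g => [|i IH]; [apply: algebraic1 | rewrite exprS; apply: algebraic_mul].
  have an := alg_nat n.
  apply: algm0.
    apply: algebraic_sub; last by apply: algebraic_mul => //; apply: algebraic_sub.
    by apply: algebraic_sub; apply: algebraic_mul => //; [apply: aU | apply: aU'].
  have -> : T * U z - n%:R * U' z - (T - n%:R) * z ^+ g =
    (t ^+ 2 * U z - n%:R * U' z - (t ^+ 2 - n%:R) * z ^+ g) - (U z - z ^+ g) * (t ^+ 2 - T) by ring.
  apply: maxidB; [by [] | exact: near | apply: maxidMr => //].
  by apply: rpredB; apply: algV => //; apply: aU.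
pose W := \prod_(z <- s1) ('X - z%:P); pose W' := \prod_(z <- s2) ('X - z%:P).
have Wid : T *: W - n%:R *: W' = (T - n%:R) *: 'X^g.
  apply/eqP; rewrite -subr_eq0; apply/negPn/negP => nz.
  (* The identity is known at algebraic points, among them the n-th roots of unity, and n exceeds
     the degree g. *)
  have [rt [urt srt art]] := unity_roots_seq n0.
  have := max_poly_roots nz _ urt; rewrite srt => lt.
  have {lt} : (n < g.+1)%N.
    apply: leq_trans (lt _) _.
      apply/allP => z /(allP art)/unity_rootP zn; rewrite rootE !hornerD !hornerN.
      rewrite !horner_prod_seq hornerZ hornerXn; apply/eqP/id.
      exists ('X^n - 1); first by rewrite -size_poly_gt0 size_XnsubC // /n addn1.
      by rewrite rootE rmorphB rmorph1 /= map_polyXn !hornerE zn subrr.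
    have sW (s : seq K) : size s = g -> (size (\prod_(z <- s) ('X - z%:P))%R <= g.+1)%N.
      by move=> <-; rewrite size_prod_XsubC.
    rewrite (leq_trans (size_polyD _ _)) // size_polyN geq_max; apply/andP; split; last first.
      by rewrite (leq_trans (size_scale_leq _ _)) // size_polyXn.
    rewrite (leq_trans (size_polyD _ _)) // size_polyN geq_max.
    by rewrite !(leq_trans (size_scale_leq _ _)) ?sW.
  by rewrite /n; clear; lia.
have T0 : T != 0 by rewrite !mulf_neq0 ?invr_eq0.
have [th thT] := sqrt_closed T.
have th0 : th != 0 by apply: contraNneq T0 => th0; rewrite -thT th0 expr0n.
have nWW : n%:R *: (W * W') = 'X^n - ('X - 1) ^+ n.
  have : (v1 - v2) * (v1 + v2) = ('X - 1) ^+ n - 'X^n.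
    transitivity ((('X - 0%:P) ^+ n + v1 ^+ 2) - ('X - 0%:P) ^+ n - v2 ^+ 2); first by ring.
    by rewrite -e1 e2 polyC0 subr0 polyC1; ring.
  rewrite d12 p12 -/W -/W' -scalerAl -scalerAr scalerA tt' scaleNr => /eqP.
  by rewrite eqr_oppLR opprB => /eqP.
(* With th^2 = T, A = th W and B = (n / th) W', this is ((A + B) / 2)^2 = ((A - B) / 2)^2 + A B,
   where A - B = ((T - n) / th) x^g and A B = n W W'. *)
apply: (@not_square_degenerate K g g_gt1 n0 (((T - n%:R) / (2%:R * th)) ^+ 2) (2%:R^-1 *: (th *: W + (n%:R / th) *: W'))).
rewrite -addrA -nWW.
have -> : (((T - n%:R) / (2%:R * th)) ^+ 2) *: 'X^(2 * g) = ((2%:R * th)^-1 *: ((T - n%:R) *: 'X^g)) ^+ 2 :> {poly K}.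
  by rewrite scalerA !exprZn -exprM mulnC [_^-1 * _]mulrC.
pose m := n%:R / th; pose A := th *: W; pose B := m *: W'.
have -> : (2%:R * th)^-1 *: ((T - n%:R) *: 'X^g) = 2%:R^-1 *: (A - B).
  rewrite -Wid -thT /A /B /m !scalerBr !scalerA; congr (_ *: _ - _ *: _); field; rewrite ?th0 ?two0 //.
have -> : n%:R *: (W * W') = 2%:R^-1 ^+ 2 *: ((A * B) *+ 4).
  rewrite -scaler_nat scalerA /A /B -scalerAl -scalerAr !scalerA; congr (_ *: _).
  by rewrite /m; field; rewrite th0 two0.
by rewrite !exprZn -scalerDr; congr (_ *: _); ring.
Qed.

End WithValring.

Lemma algebraic_coefs (t t' : K) (s1 s2 : seq K) :
    alg t -> alg t' -> (forall z, z \in s1 ++ s2 -> alg z) ->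
  forall i, alg (('X^n + (2%:R^-1 *: (t *: \prod_(z <- s1) ('X - z%:P) + t' *: \prod_(z <- s2) ('X - z%:P))) ^+ 2)`_i).
Proof.
move=> at_ at'_ as_.
have [|B BE] := @subringClosed_of_set K [set z | alg z]%classic.
  by split; [apply: algebraic1 | apply: algebraic_sub | apply: algebraic_mul].
have inB z : alg z -> z \in B by rewrite BE => ?; apply/asboolP.
have a2 : alg 2%:R by rewrite -(rmorph_nat iota); apply: algebraic_id.
have prodB s : (forall z, z \in s -> alg z) -> \prod_(z <- s) ('X - z%:P) \is a polyOver B.
  move=> sB; rewrite big_seq rpred_prod // => z zs.
  by rewrite rpredB ?polyOverX // polyOverC; apply/inB/sB.
suff /polyOverP h : 'X^n + (2%:R^-1 *: (t *: \prod_(z <- s1) ('X - z%:P) + t' *: \prod_(z <- s2) ('X - z%:P))) ^+ 2 \is a polyOver B.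
  by move=> i; have := h i; rewrite BE => /asboolP.
apply: rpredD; first exact: polyOverXn.
apply/rpredX/polyOverZ; first exact/inB/algebraic_inv.
by apply: rpredD; apply: polyOverZ; rewrite ?inB ?prodB // => z zs; apply: as_; rewrite mem_cat zs ?orbT.
Qed.

(** Division by b^n restores a monic n-th power after the substitution x -> b x + c; as n is odd,
    keeping the second term a square takes a square root d of b^n. *)
Lemma rescale (f : {poly K}) a v c b d : b != 0 -> d ^+ 2 = b ^+ n ->
    f = ('X - a%:P) ^+ n + v ^+ 2 ->
  b ^- n *: (f \Po (b *: 'X + c%:P)) =
    ('X - ((a - c) / b)%:P) ^+ n + (d^-1 *: (v \Po (b *: 'X + c%:P))) ^+ 2.
Proof.
move=> b0 d2 ->; rewrite comp_polyD !rmorphXn /= !exprZn exprVn d2 scalerDr; congr (_ + _).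
rewrite comp_polyB comp_polyX comp_polyC.
have -> : b *: 'X + c%:P - a%:P = b *: ('X - ((a - c) / b)%:P).
  rewrite scalerBr -[in RHS]mul_polyC -[b *: _%:P]mul_polyC -polyCM [b * _]mulrC mulfVK // polyCB mul_polyC; ring.
by rewrite exprZn scalerA mulVf ?scale1r // expf_neq0.
Qed.

Lemma size_rescale v c b d : (size v <= g.+1)%N ->
  (size (d^-1 *: (v \Po (b *: 'X + c%:P))) <= g.+1)%N.
Proof.
move=> sv; rewrite (leq_trans (size_scale_leq _ _)) //.
apply: leq_trans sv; have [->|v0] := eqVneq v 0; first by rewrite comp_poly0.
have sb : (size (b *: 'X + c%:P)%R <= 2)%N.
  rewrite (leq_trans (size_polyD _ _)) // geq_max (leq_trans (size_scale_leq _ _)) ?size_polyX //=.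
  by rewrite (leq_trans (size_polyC_leq1 _)).
rewrite (leq_trans (size_comp_poly_leq _ _)) //.
have sv : (0 < size v)%N by rewrite size_poly_gt0.
have : ((size (b *: 'X + c%:P)%R).-1 <= 1)%N by move: sb; case: size => [|[|[]]].
move: sv; move: (size v) (size _).-1 => i j i0 j1; rewrite -[in X in (_ < X)%N](prednK i0) ltnS.
by rewrite -[X in (_ <= X)%N]muln1 leq_mul2l j1 orbT.
Qed.

Lemma normalized_algebraic (f : {poly K}) a v1 v2 v3 :
    f = ('X - 0%:P) ^+ n + v1 ^+ 2 -> f = ('X - 1%:P) ^+ n + v2 ^+ 2 ->
    f = ('X - a%:P) ^+ n + v3 ^+ 2 -> a != 0 -> a != 1 ->
    (size v1 <= g.+1)%N -> (size v2 <= g.+1)%N -> (size v3 <= g.+1)%N ->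
  forall i, alg f`_i.
Proof.
move=> e1 e2 e3 a0 a1 sv1 sv2 sv3.
have o01 : 0 != 1 :> K by rewrite eq_sym oner_eq0.
have [t [t' [s1 [s2 [d12 p12 ss rs tt']]]]] := factor_pair o01 e1 e2 sv1 sv2.
have {}tt' : t * t' = - n%:R by rewrite tt' sub0r mulrN1.
have {}rs z : z \in s1 ++ s2 -> z ^+ n = (z - 1) ^+ n by move=> /rs; rewrite subr0.
have t0 : t != 0.
  by apply: contra_eqN tt' => /eqP->; rewrite mul0r eq_sym oppr_eq0.
have an : alg n%:R by rewrite -(rmorph_nat iota); apply: algebraic_id.
have at_ : alg t.
  apply: contrapT => /transcendental_valring[V [totV kV mt]].
  have [aV|naV] := boolP (a \in V).
    by have := lead_not_maxid totV kV e1 e2 e3 a0 a1 aV sv1 sv2 sv3 d12 p12 ss rs tt'; rewrite mt.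
  have ma : maxid V a^-1 by rewrite maxidVn.
  (* Scaling x by a turns the abscissae 0, 1, a into 0, a^-1, 1, so that v2 and v3 exchange
     roles. *)
  have [b b2] := sqrt_closed (a ^+ n).
  have r1 := rescale 0 a0 b2 e1; have r2 := rescale 0 a0 b2 e2; have r3 := rescale 0 a0 b2 e3.
  rewrite !subr0 ?mul0r ?mul1r ?divff // in r1 r2 r3.
  have aV0 : a^-1 != 0 by rewrite invr_eq0.
  have aV1 : a^-1 != 1 by rewrite invr_eq1.
  by have := third_not_maxid totV kV r1 r3 r2 aV0 aV1 (size_rescale _ _ _ sv1) (size_rescale _ _ _ sv3) (size_rescale _ _ _ sv2); rewrite ma.
have at'_ : alg t'.
  by rewrite -(mulKf t0 t') tt'; apply: algebraic_mul; [apply: algebraic_inv | apply: algebraic_opp].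
have -> : f = 'X^n + (2%:R^-1 *: (t *: \prod_(z <- s1) ('X - z%:P) + t' *: \prod_(z <- s2) ('X - z%:P))) ^+ 2.
  rewrite e1 -d12 -p12 polyC0 subr0; congr (_ + _ ^+ 2).
  have -> : v1 - v2 + (v1 + v2) = 2%:R *: v1 by rewrite scaler_nat; ring.
  by rewrite scalerA mulVf // scale1r.
apply: algebraic_coefs => // z /rs; exact: algebraic_diff_root.
Qed.

Lemma three_points_algebraic (f : {poly K}) a1 a2 a3 v1 v2 v3 :
    f = ('X - a1%:P) ^+ n + v1 ^+ 2 -> f = ('X - a2%:P) ^+ n + v2 ^+ 2 ->
    f = ('X - a3%:P) ^+ n + v3 ^+ 2 -> a1 != a2 -> a1 != a3 -> a2 != a3 ->
    (size v1 <= g.+1)%N -> (size v2 <= g.+1)%N -> (size v3 <= g.+1)%N ->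
  exists2 b, b != 0 & forall i, alg (b ^- n *: (f \Po (b *: 'X + a1%:P)))`_i.
Proof.
move=> e1 e2 e3 a12 a13 a23 sv1 sv2 sv3.
have b0 : a2 - a1 != 0 by rewrite subr_eq0 eq_sym.
exists (a2 - a1) => //.
have [d d2] := sqrt_closed ((a2 - a1) ^+ n).
have r1 := rescale a1 b0 d2 e1; have r2 := rescale a1 b0 d2 e2; have r3 := rescale a1 b0 d2 e3.
rewrite subrr mul0r in r1; rewrite divff // in r2.
apply: (normalized_algebraic r1 r2 r3); rewrite ?size_rescale //.
  by rewrite mulf_neq0 ?invr_eq0 // subr_eq0 eq_sym.
apply: contra_neq a23 => /(congr1 (fun x => x * (a2 - a1))).
by rewrite mulfVK // mul1r => /addIr ->.
Qed.

End Core.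

(** * Points of curves *)

Lemma lin_indep_leq (k L : fieldType) (j : {rmorphism k -> L}) N n
    (w : 'I_N -> L) (b : 'I_n -> L) :
    lin_indep j w -> (forall i, exists c : 'I_n -> k, w i = \sum_l j (c l) * b l) ->
  (N <= n)%N.
Proof.
move=> indw /choice[A HA]; pose M := \matrix_(i < N, l < n) A i l.
suff /eqP <- : row_free M by exact: rank_leq_col.
apply/row_freeP; apply/row_freeP; rewrite -kermx_eq0; apply/eqP/row_matrixP => i.
rewrite row0; set u := row i _; have uM : u *m M = 0 by rewrite /u -row_mul mulmx_ker row0.
apply/rowP => l; rewrite [RHS]mxE; apply: (indw (fun l => u 0 l)).
transitivity (\sum_l0 \sum_l1 j (u 0 l0 * A l0 l1) * b l1).
  apply: eq_bigr => l0 _; rewrite HA mulr_sumr; apply: eq_bigr => l1 _.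
  by rewrite rmorphM mulrA.
rewrite exchange_big big1 // => l1 _; rewrite -mulr_suml -rmorph_sum.
suff -> : \sum_l0 u 0 l0 * A l0 l1 = 0 by rewrite rmorph0 mul0r.
have := congr1 (fun v : 'rV_n => v 0 l1) uM; rewrite [LHS]mxE [RHS]mxE => e; rewrite -[RHS]e.
by apply: eq_bigr => l0 _; congr (_ * _); rewrite mxE.
Qed.

Section Points.
Variables (k : fieldType) (C : curve k).
Local Notation L := (funfield C).
Local Notation j := (constf C).
Implicit Types (P : curve_point C) (a b z : L).

Lemma ord_one P : ord P 1 = 0.
Proof. by rewrite -(rmorph1 j) ord_const ?oner_neq0. Qed.

Lemma ordN P z : ord P (- z) = ord P z.
Proof.
have [->|z0] := eqVneq z 0; first by rewrite oppr0.
by rewrite -mulN1r ordM ?oppr_eq0 ?oner_neq0 // -(rmorph1 j) -rmorphN ord_const ?oppr_eq0 ?oner_neq0 // add0r.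
Qed.

Lemma ordV P z : ord P z^-1 = - ord P z.
Proof.
have [->|z0] := eqVneq z 0; first by rewrite invr0 Defs.ord0 oppr0.
by apply/eqP; rewrite -addr_eq0 -ordM ?invr_eq0 // mulVf // ord_one.
Qed.

Lemma ordX P z m : ord P (z ^+ m) = ord P z * m%:Z.
Proof.
have [->|z0] := eqVneq z 0.
  by rewrite Defs.ord0 mul0r; case: m => [|m]; rewrite ?expr0 ?ord_one // expr0n Defs.ord0.
by elim: m => [|m IH]; rewrite ?expr0 ?ord_one ?mulr0 // exprS ordM ?expf_neq0 // IH -addn1 PoszD mulrDr mulr1 addrC.
Qed.

Lemma ord_prod P (I : Type) (r : seq I) (F : I -> L) : (forall i, F i != 0) ->
  ord P (\prod_(i <- r) F i) = \sum_(i <- r) ord P (F i).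
Proof.
move=> F0; elim: r => [|i r IH]; first by rewrite !big_nil ord_one.
by rewrite !big_cons ordM ?IH // prodf_seq_neq0; apply/(all_nthP i) => x _; apply: F0.
Qed.

Lemma ordZ P c z : c != 0 -> ord P (j c * z) = ord P z.
Proof.
move=> c0; have [->|z0] := eqVneq z 0; first by rewrite mulr0.
by rewrite ordM ?fmorph_eq0 // ord_const // add0r.
Qed.

Lemma ord_addl P a b : a != 0 -> b != 0 -> ord P a < ord P b ->
  a + b != 0 /\ ord P (a + b) = ord P a.
Proof.
move=> a0 b0 ab; have ab0 : a + b != 0.
  by apply: contraTneq ab => /eqP; rewrite addr_eq0 => /eqP->; rewrite ordN ltxx.
split=> //; apply: le_anti; have := ordD P a0 b0 ab0; rewrite minEle (ltW ab) => ->.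
have nb0 : - b != 0 by rewrite oppr_eq0.
have := ordD P ab0 nb0; rewrite addrK ordN => /(_ a0).
by rewrite ge_min => /orP[->//|]; rewrite leNgt ab.
Qed.

Definition point_ring P : {pred L} := fun z => (z == 0) || (0 <= ord P z).

Lemma point_ring_closed P : subring_closed (point_ring P).
Proof.
split=> [|a b|a b]; rewrite !unfold_in ?ord_one ?lexx ?orbT //.
  have [->|a0] := eqVneq a 0; first by rewrite sub0r oppr_eq0 ordN.
  have [->|b0] := eqVneq b 0; first by rewrite subr0 (negPf a0).
  have [//|ab0 /= ha hb] := eqVneq (a - b) 0.
  apply: le_trans (ordD P a0 _ ab0); rewrite ?oppr_eq0 // ordN le_min ha //.
have [->|a0] := eqVneq a 0; first by rewrite mul0r eqxx.
have [->|b0] := eqVneq b 0; first by rewrite mulr0 eqxx.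
by move=> /= ha hb; rewrite ordM // addr_ge0 ?orbT.
Qed.
HB.instance Definition _ P := GRing.isSubringClosed.Build L (point_ring P) (point_ring_closed P).

Lemma point_valring P : is_valring (point_ring P).
Proof.
by move=> z; rewrite !unfold_in ordV invr_eq0 oppr_ge0; case: (z == 0) => //=; case: lerP => // /ltW.
Qed.

Lemma maxid_pointE P z : maxid (point_ring P) z = (z == 0) || (0 < ord P z).
Proof.
by rewrite /maxid !unfold_in ordV invr_eq0 oppr_ge0; case: (z == 0) => //=; rewrite -ltNge.
Qed.

Lemma const_point_ring P c : j c \in point_ring P.
Proof.
by rewrite unfold_in; have [->|c0] := eqVneq c 0; rewrite ?rmorph0 ?eqxx // ord_const ?lexx ?orbT.
Qed.

Lemma const_maxid P c : maxid (point_ring P) (j c) = (c == 0).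
Proof.
rewrite maxid_pointE fmorph_eq0; have [//|c0] := eqVneq c 0.
by rewrite ord_const // ltxx.
Qed.

Lemma ord_unit P z c : c != 0 -> maxid (point_ring P) (z - j c) -> z != 0 /\ ord P z = 0.
Proof.
move=> c0; have jc0 : j c != 0 by rewrite fmorph_eq0.
rewrite maxid_pointE => /orP[|h].
  by rewrite subr_eq0 => /eqP ->; rewrite ord_const // jc0.
have [zj|zj] := eqVneq (z - j c) 0.
  by move/eqP: zj; rewrite subr_eq0 => /eqP ->; rewrite ord_const // jc0.
have := @ord_addl P (j c) (z - j c) jc0 zj; rewrite ord_const // addrCA subrr addr0.
exact.
Qed.

Lemma curve_point_eq P Q : (forall z, ord P z = ord Q z) -> P = Q.
Proof.
case: P => o h0 hM hD hc hs; case: Q => o' h0' hM' hD' hc' hs' /= e.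
have eo : o = o' by apply/funext.
case: _ / eo in h0' hM' hD' hc' hs' *.
by congr CurvePoint; apply: Prop_irrelevance.
Qed.

(** Every nonzero z is a unit times a power of w, whose exponent is unique because w^m lies in V
    only for m >= 0; this exponent is the order at the point. *)
Lemma dvr_point (V : subringClosed L) (w : L) : is_valring V -> (forall c, j c \in V) ->
    w != 0 -> maxid V w ->
    (forall z, z != 0 -> exists m : int, (z * w ^ m \in V) && ((z * w ^ m)^-1 \in V)) ->
  exists P : curve_point C, forall z, (z \in V) = (z \in point_ring P).
Proof.
move=> totV kV w0 mw exw.
have wn0 m : w ^ m != 0 by rewrite expfz_neq0.
have wV m : (w ^ m \in V) = (0 <= m).
  case: m => m; first by rewrite -exprnP rpredX // (maxid_in totV).
  rewrite NegzE -invr_expz -exprnP; transitivity false; last by rewrite oppr_ge0.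
  apply/negbTE/negP => h.
  have : maxid V (w ^+ m.+1) by rewrite exprSr; apply: maxidMr => //; rewrite rpredX // (maxid_in totV).
  by rewrite /maxid expf_eq0 (negPf w0) andbF h.
have unitM u a : u != 0 -> u \in V -> u^-1 \in V -> (u * a \in V) = (a \in V).
  move=> u0 uV uV'; apply/idP/idP => h; last by rewrite rpredM.
  by rewrite -(mulKf u0 a) rpredM.
have /choice[kap kapP] z : exists m : int, z != 0 -> (z * w ^ m \in V) && ((z * w ^ m)^-1 \in V).
  by have [->|/exw[m hm]] := eqVneq z 0; [exists 0 | exists m].
pose o z : int := if z == 0 then 0 else - kap z.
have oE z i : z != 0 -> (z * w ^ (- i) \in V) = (i <= o z).
  move=> z0; rewrite /o (negPf z0); have /andP[uV uV'] := kapP z z0.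
  have -> : z * w ^ (- i) = (z * w ^ kap z) * w ^ (- i - kap z).
    by rewrite -mulrA -expfzDr // addrC subrK.
  by rewrite unitM ?wV ?mulf_neq0 // subr_ge0 lerNr.
have oE' z i : z != 0 -> (z * w ^ i \in V) && ((z * w ^ i)^-1 \in V) -> o z = - i.
  move=> z0 /andP[h1 h2]; apply: le_anti; rewrite -(oE _ _ z0) opprK h1 andbT.
  have := oE z (o z) z0; rewrite lexx => h3.
  have : w ^ (- o z - i) \in V.
    have -> : w ^ (- o z - i) = (z * w ^ (- o z)) * (z * w ^ i)^-1.
      by rewrite expfzDr // -[w ^ (- i)]invr_expz invfM mulrACA divff // mul1r.
    by rewrite rpredM.
  by rewrite wV subr_ge0 lerNr.
have o0 : o 0 = 0 by rewrite /o eqxx.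
have oM a b : a != 0 -> b != 0 -> o (a * b) = o a + o b.
  move=> a0 b0; rewrite (oE' _ (kap a + kap b)) ?mulf_neq0 //.
    by rewrite /o (negPf a0) (negPf b0) opprD.
  have /andP[h1 h2] := kapP a a0; have /andP[h3 h4] := kapP b b0.
  have -> : a * b * w ^ (kap a + kap b) = (a * w ^ kap a) * (b * w ^ kap b).
    by rewrite expfzDr // mulrACA.
  by rewrite invfM; apply/andP; split; apply: rpredM.
have oD a b : a != 0 -> b != 0 -> a + b != 0 -> Num.min (o a) (o b) <= o (a + b).
  move=> a0 b0 ab0; rewrite -oE // mulrDl rpredD // oE // ge_min lexx ?orbT //.
have oc c : c != 0 -> o (j c) = 0.
  move=> c0; rewrite (oE' _ 0) ?oppr0 ?fmorph_eq0 // expr0z mulr1.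
  by rewrite -fmorphV !kV.
have os : exists2 t, t != 0 & o t = 1.
  exists w => //; rewrite (oE' _ (-1)) ?opprK //.
  by rewrite -{1 3}(expr1z w) -expfzDr // subrr expr0z invr1 rpred1.
exists (CurvePoint o0 oM oD oc os) => z; rewrite unfold_in /=.
have [->|z0] := eqVneq z 0; first by rewrite rpred0.
by rewrite -oE // oppr0 expr0z mulr1.
Qed.
End Points.

(** * Hyperelliptic models *)

(** The equation y^2 = f(x) and its involution, stated inside the function field. Squarefreeness is
    tested on linear factors, K being algebraically closed. The parity of deg f is left open: it
    depends on the marked point, see [odd_deg]. *)
Record hyper_model (K : closedFieldType) (C : curve K) := HyperModel {
  hx : funfield C;
  hy : funfield C;
  hf : {poly K};
  hs : {rmorphism funfield C -> funfield C};
  hs_const : forall c, hs (constf C c) = constf C c;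
  hs_x : hs hx = hx;
  hs_y : hs hy = - hy;
  hx_transc : forall p : {poly K}, (map_poly (constf C) p).[hx] = 0 -> p = 0;
  hy_sqr : hy ^+ 2 = (map_poly (constf C) hf).[hx];
  hf_monic : hf \is monic;
  hf_sqfree : forall c, ~~ (('X - c%:P) ^+ 2 %| hf);
  h_gen : forall z : funfield C, exists p q r : {poly K}, r != 0 /\
    z = ((map_poly (constf C) p).[hx] + (map_poly (constf C) q).[hx] * hy)
        / (map_poly (constf C) r).[hx]
}.

Section Model.
Variables (K : closedFieldType) (C : curve K) (M : hyper_model C).
Hypothesis two0 : 2%:R != 0 :> K.
Local Notation L := (funfield C).
Local Notation j := (constf C).
Local Notation x := (hx M).
Local Notation y := (hy M).
Local Notation f := (hf M).
Local Notation s := (hs M).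
Implicit Types (P Q O : curve_point C) (z : L) (p q r : {poly K}) (c : K).

Definition ev p : L := (map_poly j p).[x].

Lemma evE p : ev p = (map_poly j p).[x]. Proof. by []. Qed.

Fact ev_zmod_morphism : zmod_morphism ev.
Proof. by move=> p q; rewrite !evE rmorphB !hornerE. Qed.
Fact ev_monoid_morphism : monoid_morphism ev.
Proof. by split=> [|p q]; rewrite !evE ?rmorph1 ?hornerC // rmorphM hornerM. Qed.
HB.instance Definition _ := GRing.isZmodMorphism.Build {poly K} L ev ev_zmod_morphism.
HB.instance Definition _ := GRing.isMonoidMorphism.Build {poly K} L ev ev_monoid_morphism.

Lemma evC c : ev c%:P = j c.
Proof. by rewrite evE map_polyC hornerC. Qed.
Lemma evX : ev 'X = x.
Proof. by rewrite evE map_polyX hornerX. Qed.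
Lemma evXsubC c : ev ('X - c%:P) = x - j c.
Proof. by rewrite rmorphB /= evX evC. Qed.
Lemma ev_eq0 p : (ev p == 0) = (p == 0).
Proof. by apply/eqP/eqP => [/(@hx_transc _ _ M)//|->]; rewrite rmorph0. Qed.
Lemma evf : y ^+ 2 = ev f. Proof. exact: hy_sqr. Qed.
Lemma gen z : exists p q r, r != 0 /\ z = (ev p + ev q * y) / ev r.
Proof. exact: h_gen. Qed.
Lemma s_ev p : s (ev p) = ev p.
Proof.
rewrite evE -horner_map /= hs_x -map_poly_comp; congr (_.[_]).
by apply: eq_map_poly => c /=; rewrite hs_const.
Qed.
Lemma s_lin p q : s (ev p + ev q * y) = ev p - ev q * y.
Proof. by rewrite rmorphD rmorphM !s_ev hs_y mulrN. Qed.
Lemma sK z : s (s z) = z.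
Proof.
have [p [q [r [_ ->]]]] := gen z; rewrite fmorph_div s_lin s_ev fmorph_div rmorphB rmorphM /=.
by rewrite !s_ev hs_y mulrN opprK.
Qed.
Lemma s_eq0 z : (s z == 0) = (z == 0). Proof. exact: fmorph_eq0. Qed.
Lemma f0 : f != 0. Proof. exact/monic_neq0/hf_monic. Qed.
Lemma y0 : y != 0. Proof. by rewrite -sqrf_eq0 evf ev_eq0 f0. Qed.
Lemma two0L : 2%:R != 0 :> L. Proof. by rewrite -(rmorph_nat j) fmorph_eq0. Qed.
Lemma lin_eq0 p q : ev p + ev q * y = 0 -> p = 0 /\ q = 0.
Proof.
move=> e; have e' : ev p - ev q * y = 0 by rewrite -s_lin e rmorph0.
have p0 : p = 0.
  apply/eqP; rewrite -ev_eq0; have : 2%:R * ev p = 0 by rewrite -[RHS](addr0 0) -{1}e -e'; ring.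
  by move/eqP; rewrite mulf_eq0 (negPf two0L).
split=> //; move: e; rewrite p0 rmorph0 add0r => /eqP; rewrite mulf_eq0 (negPf y0) orbF.
by rewrite ev_eq0 => /eqP.
Qed.
Lemma lin_neq0 p q : (p != 0) || (q != 0) -> ev p + ev q * y != 0.
Proof. by move=> h; apply: contraTneq h => /lin_eq0[-> ->]; rewrite eqxx. Qed.
Lemma normE p q : (ev p + ev q * y) * s (ev p + ev q * y) = ev (p ^+ 2 - q ^+ 2 * f).
Proof. by rewrite s_lin !expr2 rmorphB !rmorphM /= -evf; ring. Qed.
Lemma norm_neq0 p q : (p != 0) || (q != 0) -> p ^+ 2 - q ^+ 2 * f != 0.
Proof. by move=> h; rewrite -ev_eq0 -normE mulf_neq0 ?s_eq0 ?lin_neq0. Qed.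

(** The conjugate point. The definition is transparent, so that [ord_spt] holds by computation. *)
Definition spt P : curve_point C.
Proof.
apply: (@CurvePoint _ _ (fun z => ord P (s z))).
- by rewrite rmorph0 Defs.ord0.
- by move=> a b a0 b0; rewrite rmorphM ordM // fmorph_eq0.
- by move=> a b a0 b0 ab0; rewrite rmorphD ordD ?fmorph_eq0 // -rmorphD fmorph_eq0.
- by move=> c c0; rewrite hs_const ord_const.
- by have [t t0 t1] := ord_surj P; exists (s t); rewrite ?fmorph_eq0 ?sK.
Defined.

Lemma ord_spt P z : ord (spt P) z = ord P (s z). Proof. by []. Qed.

Lemma sptK P : spt (spt P) = P.
Proof. by apply: curve_point_eq => z; rewrite !ord_spt sK. Qed.

Definition lies_over P c := 0 < ord P (x - j c).

Lemma xc0 c : x - j c != 0.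
Proof. by rewrite -evXsubC ev_eq0 polyXsubC_eq0. Qed.

Lemma over_maxid P c : lies_over P c = maxid (point_ring P) (x - j c).
Proof. by rewrite maxid_pointE (negPf (xc0 c)). Qed.

Lemma over_spt P c : lies_over (spt P) c = lies_over P c.
Proof. by rewrite /lies_over ord_spt rmorphB hs_x hs_const. Qed.

Lemma x_point_ring P c : lies_over P c -> x \in point_ring P.
Proof.
rewrite over_maxid => /(maxid_in (@point_valring _ _ P)) h.
by rewrite -(subrK (j c) x) rpredD // const_point_ring.
Qed.

Lemma ev_point_ring P p : x \in point_ring P -> ev p \in point_ring P.
Proof.
by move=> xP; rewrite evE rpred_horner //; apply/polyOverP => i; rewrite coef_map; apply: const_point_ring.
Qed.

Lemma ev_residue P c p : lies_over P c -> maxid (point_ring P) (ev p - j p.[c]).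
Proof.
move=> Pc; have /factor_theorem[q e] : root (p - p.[c]%:P) c by rewrite rootE !hornerE subrr.
have -> : ev p - j p.[c] = ev q * (x - j c) by rewrite -evXsubC -rmorphM -e rmorphB /= evC.
apply: maxidMr; first exact/ev_point_ring/(x_point_ring Pc).
by rewrite -over_maxid.
Qed.

Lemma ord_ev_over P c p : lies_over P c -> ~~ root p c -> ord P (ev p) = 0.
Proof. by move=> Pc nr; case: (ord_unit nr (ev_residue p Pc)). Qed.

Lemma ord_ev_mult P c p m : lies_over P c -> ~~ root p c ->
  ord P (ev (p * ('X - c%:P) ^+ m)) = ord P (x - j c) * m%:Z.
Proof.
move=> Pc nr; have p0 : p != 0 by apply: contraNneq nr => ->; rewrite root0.
rewrite rmorphM rmorphXn /= evXsubC ordM ?ev_eq0 ?expf_neq0 ?xc0 //.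
by rewrite (ord_ev_over Pc nr) ordX add0r.
Qed.

Lemma over_uniq P c c' : lies_over P c -> lies_over P c' -> c = c'.
Proof.
rewrite !over_maxid => h h'; apply/eqP; rewrite -subr_eq0 -(const_maxid P).
have -> : j (c - c') = (x - j c') - (x - j c) by rewrite rmorphB; ring.
by rewrite maxidB // ; apply: point_valring.
Qed.

(** [chevalley] gives a valuation ring V containing K[x] with t = x - c in its maximal ideal; what
    remains is that V is discrete. Up to units of V, every nonzero polynomial in x is a power of t,
    and for every nonzero z either z or z^2 is one. Hence a uniformizer is either t or some w with
    w^2 equal to t up to a unit. *)
Lemma exists_over c : exists P, lies_over P c.
Proof.
pose A := [set z | exists p : {poly K}, z = ev p]%classic.
have [| | |V [totV AV mt]] := @chevalley L A (x - j c).
- split; first by exists 1; rewrite rmorph1.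
    by move=> _ _ [p ->] [q ->]; exists (p - q); rewrite rmorphB.
  by move=> _ _ [p ->] [q ->]; exists (p * q); rewrite rmorphM.
- by exists ('X - c%:P); rewrite evXsubC.
- move=> [p e]; have : ev (p * ('X - c%:P) - 1) = 0.
    by rewrite rmorphB rmorphM rmorph1 /= evXsubC -e mulVf ?xc0 // subrr.
  move/eqP; rewrite ev_eq0 => /eqP/(congr1 (horner^~ c))/eqP.
  by rewrite !hornerE subrr mulr0 sub0r oppr_eq0 oner_eq0.
have kV b : j b \in V by apply: AV; exists b%:P; rewrite evC.
have evV p : ev p \in V by apply: AV; exists p.
set t := x - j c in mt.
have t0 : t != 0 := xc0 c.
have tn0 m : t ^ m != 0 by rewrite expfz_neq0.
pose U z := (z \in V) && (z^-1 \in V).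
have UM a b : U a -> U b -> U (a * b).
  by move=> /andP[? ?] /andP[? ?]; rewrite /U invfM; apply/andP; split; apply: rpredM.
have UV a : U a -> U a^-1 by rewrite /U invrK andbC.
have U2 a : U (a ^+ 2) -> U a.
  have h b : b ^+ 2 \in V -> b \in V.
    have /orP[//|bV] := totV b; have [->|b0 b2] := eqVneq b 0; first by rewrite rpred0.
    by rewrite -(mulfK b0 b) -expr2 rpredM.
  by rewrite /U -exprVn => /andP[/h-> /h->].
pose sim z := exists m : int, U (z * t ^ m).
have nonm z : z \in V -> ~~ maxid V z -> U z.
  by rewrite /U /maxid => zV; rewrite negb_or negbK zV => /andP[].
have simev p : p != 0 -> sim (ev p).
  move=> p0; have [m [q nq ->]] := multiplicity_XsubC p c; rewrite p0 /= in nq.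
  exists (- m%:Z); rewrite rmorphM rmorphXn /= evXsubC -/t -exprnN mulfK ?expf_neq0 //.
  apply: nonm => //; apply/negP => mq.
  have /factor_theorem[h e] : root (q - q.[c]%:P) c by rewrite rootE !hornerE subrr.
  have : maxid V (j q.[c]).
    have -> : j q.[c] = ev q - ev h * t by rewrite /t -evXsubC -rmorphM -e rmorphB /= evC subKr.
    by apply: maxidB => //; apply: maxidMr.
  rewrite /maxid fmorph_eq0 -fmorphV kV orbF => /eqP qc.
  by move: nq; rewrite rootE qc eqxx.
have simM a b : sim a -> sim b -> sim (a * b).
  by move=> [m ha] [l hb]; exists (m + l); rewrite expfzDr // mulrACA UM.
have simV a : sim a -> sim a^-1.
  by move=> [m ha]; exists (- m); rewrite -invr_expz -invfM UV.
have simU a b : sim a -> U b -> sim (a * b).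
  by move=> [m ha] Ub; exists m; rewrite mulrAC UM.
(* For w = p + q y: if w and s w have different values, the one of smaller value equals 2 p = w + s
   w up to a unit, and the norm gives the other; if their values agree, w^2 is the norm up to a
   unit. *)
have dich z : z != 0 -> sim z \/ sim (z ^+ 2).
  move=> z0; have [p [q [r [r0 ez]]]] := gen z.
  have pq : (p != 0) || (q != 0).
    by apply: contraNT z0; rewrite ez negb_or !negbK => /andP[/eqP-> /eqP->]; rewrite !rmorph0 mul0r addr0 mul0r.
  pose w := ev p + ev q * y; have w0 : w != 0 by apply: lin_neq0.
  have sw0 : s w != 0 by rewrite s_eq0.
  suff [h|h] : sim w \/ sim (w ^+ 2).
  - by left; rewrite ez; apply: simM => //; apply/simV/simev.
  - by right; rewrite ez expr_div_n; apply: simM => //; rewrite -rmorphXn; apply/simV/simev; rewrite expf_neq0.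
  have simN : sim (w * s w) by rewrite normE; apply/simev/norm_neq0.
  have p20 : 2%:R *: p != 0 \/ p = 0.
    by have [->|p0] := eqVneq p 0; [right | left; rewrite scale_poly_eq0 negb_or two0].
  have eT : w + s w = ev (2%:R *: p).
    by rewrite s_lin -mul_polyC rmorphM /= evC rmorph_nat /w; ring.
  have TsimL a b : a != 0 -> a + b = ev (2%:R *: p) -> maxid V (b / a) -> sim a.
    move=> a0 e mba; have m1 : ~~ maxid V (1 + b / a).
      apply/negP => m1; have := maxidB totV m1 mba; rewrite addrK.
      by rewrite (negPf (maxid1 V)).
    have U1 : U (1 + b / a) by apply: nonm; rewrite // rpredD ?rpred1 // (maxid_in totV).
    have eab : ev (2%:R *: p) = a * (1 + b / a) by rewrite -e mulrDr mulr1 mulrCA divff // mulr1.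
    have e0 : 2%:R *: p != 0.
      rewrite -ev_eq0 eab mulf_neq0 //; apply: contra m1 => /eqP->; exact: maxid0.
    have -> : a = ev (2%:R *: p) * (1 + b / a)^-1.
      by rewrite eab mulfK //; apply: contra m1 => /eqP->; apply: maxid0.
    by apply: simU; [apply: simev | apply: UV].
  have [m1|m1] := boolP (maxid V (s w / w)); first by left; apply: (TsimL w (s w)).
  have [m2|m2] := boolP (maxid V (w / s w)).
    left; have hs := TsimL (s w) w sw0 (etrans (addrC _ _) eT) m2.
    by rewrite -(mulfK sw0 w); apply: simM => //; apply: simV.
  right; have -> : w ^+ 2 = (w * s w) * (w / s w) by rewrite mulrA -mulrA mulrACA mulfV // mulr1 expr2.
  apply: simU => //; apply/andP; split.
    by move: m1; rewrite /maxid negb_or negbK invf_div => /andP[].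
  by move: m2; rewrite /maxid negb_or negbK => /andP[].
have dvr w : w != 0 -> maxid V w -> (forall z, z != 0 -> exists m : int, U (z * w ^ m)) -> exists P, lies_over P c.
  move=> w0 mw h; have [P HP] := dvr_point totV kV w0 mw h; exists P.
  by rewrite over_maxid -/t; move: mt; rewrite /maxid HP.
have [all_sim|nall] := pselect (forall z, z != 0 -> sim z); first exact: (dvr t).
have [z0 [z00 nsim]] : exists z0, z0 != 0 /\ ~ sim z0.
  apply: contrapT => h; apply: nall => z zn0; apply: contrapT => nz; apply: h; by exists z.
have [//|[m hm]] := dich z0 z00.
have UX a (i : int) : U a -> U (a ^ i).
  have h (i' : nat) : U a -> U (a ^+ i').
    by move=> /andP[? ?]; rewrite /U -exprVn !rpredX.
  by case: i => i Ua; [exact: h | rewrite NegzE -invr_expz -exprnP; exact/UV/h].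
have dbl (a : L) (l : int) : a ^ (l + l) = (a ^ l) ^+ 2.
  have [->|a0] := eqVneq a 0; last by rewrite expfzDr // expr2.
  rewrite !exp0rz; have -> : (l + l == 0) = (l == 0) by apply/eqP/eqP; lia.
  by case: (l == 0); rewrite ?expr1n ?expr0n.
(* The exponent m is odd: m = 2 l would make (z0 t^l)^2, hence z0 t^l, a unit. *)
have [l em] : exists l : int, m = l + l + 1.
  have [l [e|e]] : exists l : int, m = l + l \/ m = l + l + 1.
    by exists (m %/ 2)%Z; lia.
    case: nsim; exists l; apply: U2; move: hm.
    by rewrite e dbl exprMn.
  by exists l.
pose w := (z0 * t ^ l)^-1.
have w0 : w != 0 by rewrite invr_eq0 mulf_neq0.
have wt : U (w ^+ 2 / t).
  have -> : w ^+ 2 / t = (z0 ^+ 2 * t ^ m)^-1.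
    by rewrite em expfzDr // dbl expr1z mulrA -exprMn invfM exprVn.
  exact: UV.
have mw : maxid V w.
  rewrite /maxid (negPf w0) /=; apply: contraL mt => wV.
  rewrite /maxid (negPf t0) negbK /=.
  have -> : t^-1 = (w ^+ 2 / t) * (w^-1 ^+ 2).
    by rewrite mulrAC -exprMn divff // expr1n mul1r.
  by case/andP: wt => ? _; rewrite rpredM // rpredX.
have tw z i : z * w ^ (i + i) = z * t ^ i * (w ^+ 2 / t) ^ i.
  have tt : t ^ i * t^-1 ^ i = 1 by rewrite -expfzMl divff // exp1rz.
  rewrite expfzDr // expr2 !expfzMl -[LHS]mulr1 -tt; ring.
apply: (dvr w) => // z /dich[[i hi]|[i hi]].
  by exists (i + i); rewrite tw; apply: UM => //; apply: UX.
by exists i; apply: U2; rewrite exprMn -dbl tw; apply: UM => //; apply: UX.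
Qed.

(** P is the point with coordinates (c, d). *)
Definition over2 P c d := lies_over P c && maxid (point_ring P) (y - j d).

Lemma y_maxid P c d : lies_over P c -> d ^+ 2 = f.[c] ->
  maxid (point_ring P) (y - j d) || maxid (point_ring P) (y + j d).
Proof.
move=> Pc d2; have totP := @point_valring _ _ P.
have yP : y \in point_ring P.
  have := ev_point_ring f (x_point_ring Pc).
  by rewrite -evf !unfold_in sqrf_eq0 ordX pmulr_lge0.
have jP := const_point_ring P d.
rewrite -maxidM ?rpredB ?rpredD //.
have -> : (y - j d) * (y + j d) = ev f - j f.[c].
  by rewrite -evf -d2 rmorphXn -subr_sqr.
exact: ev_residue.
Qed.

Lemma over2_spt P c d : over2 (spt P) c (- d) = over2 P c d.
Proof.
have e : s (y - j (- d)) = - (y - j d).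
  by rewrite rmorphB hs_y hs_const rmorphN opprK opprB addrC.
by rewrite /over2 over_spt !maxid_pointE ord_spt -(s_eq0 (y - j (- d))) e oppr_eq0 ordN.
Qed.

Lemma over_over2 P c d : lies_over P c -> d ^+ 2 = f.[c] -> over2 P c d \/ over2 (spt P) c d.
Proof.
move=> Pc d2; have /orP[h|h] := y_maxid Pc d2; first by left; rewrite /over2 Pc.
by right; rewrite -[d]opprK over2_spt /over2 Pc rmorphN opprK.
Qed.

Lemma lin_residue P c d p q : over2 P c d ->
  maxid (point_ring P) (ev p + ev q * y - j (p.[c] + q.[c] * d)).
Proof.
move=> /andP[Pc yd]; have totP := @point_valring _ _ P.
have -> : ev p + ev q * y - j (p.[c] + q.[c] * d) =
  (ev p - j p.[c]) + (ev q * (y - j d) + j d * (ev q - j q.[c])).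
  by rewrite rmorphD rmorphM; ring.
apply: maxidD => //; first exact: ev_residue.
apply: maxidD => //; apply: maxidMr; rewrite ?const_point_ring //; last exact: ev_residue.
exact/ev_point_ring/(x_point_ring Pc).
Qed.

Lemma common_root_factor c p q : (p != 0) || (q != 0) ->
  exists m p' q', [/\ p = p' * ('X - c%:P) ^+ m, q = q' * ('X - c%:P) ^+ m &
                      ~~ (root p' c && root q' c)].
Proof.
move=> pq; have [n] := ubnP (size p + size q).
elim: n p q pq => // n IH p q pq sn.
have [/andP[rp rq]|] := boolP (root p c && root q c); last first.
  by move=> h; exists 0, p, q; rewrite expr0 !mulr1.
have /factor_theorem[p1 ep] := rp; have /factor_theorem[q1 eq] := rq.
have pq1 : (p1 != 0) || (q1 != 0).
  by apply: contraTT pq; rewrite ep eq !negb_or !negbK => /andP[/eqP-> /eqP->]; rewrite !mul0r eqxx.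
have sl (r r1 : {poly K}) : r = r1 * ('X - c%:P) -> size r = ((size r1) + (r1 != 0%R))%N.
  have [-> ->|r0 ->] := eqVneq r1 0; first by rewrite mul0r size_poly0.
  by rewrite size_Mmonic ?monicXsubC // size_XsubC addn2 addn1.
have [|m [p' [q' [e1 e2 h]]]] := IH p1 q1 pq1.
  move: sn pq1; rewrite (sl _ _ ep) (sl _ _ eq).
  by case: (p1 != 0) (q1 != 0) => [] []; move: (size p1) (size q1) => i l; clear; lia.
by exists m.+1, p', q'; rewrite exprSr !mulrA -e1 -e2 -ep -eq.
Qed.

Lemma root_hf c : root f c -> exists2 h, f = h * ('X - c%:P) & ~~ root h c.
Proof.
move=> /factor_theorem[h e]; exists h => //; apply/negP => /factor_theorem[h' e'].
by have := hf_sqfree M c; rewrite e e' -mulrA -expr2 dvdp_mulIr.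
Qed.

(* The index e of a point over x = c divides 2, and ord P z / e depends only on
   the coordinates of P. *)
Lemma ord_over2 c d z : d ^+ 2 = f.[c] -> z != 0 ->
  exists m : int, forall P, over2 P c d ->
    ord P z * 2 = m * ord P (x - j c) * (if d == 0 then 1 else 2).
Proof.
move=> d2 z0; have [p [q [r [r0 ez]]]] := gen z.
have pq : (p != 0) || (q != 0).
  by apply: contraNT z0; rewrite ez negb_or !negbK => /andP[/eqP-> /eqP->]; rewrite !rmorph0 mul0r addr0 mul0r.
have [mr [r' nr er]] := multiplicity_XsubC r c; rewrite r0 /= in nr.
have [m1 [p' [q' [ep eq npq]]]] := common_root_factor c pq.
have pq' : (p' != 0) || (q' != 0).
  by apply: contraTT pq; rewrite ep eq !negb_or !negbK => /andP[/eqP-> /eqP->]; rewrite !mul0r eqxx.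
have w0 := lin_neq0 pq'.
suff [m Hm] : exists m : int, forall P, over2 P c d ->
    ord P (ev p' + ev q' * y) * 2 = m * ord P (x - j c) * (if d == 0 then 1 else 2).
  exists (m + (m1%:Z - mr%:Z) * (if d == 0 then 2 else 1)) => P Pcd.
  have Pc : lies_over P c by case/andP: Pcd.
  have -> : z = (ev p' + ev q' * y) * ev ('X - c%:P) ^+ m1 / ev r.
    rewrite ez ep eq !rmorphM !rmorphXn /=; congr (_ / _); ring.
  rewrite ordM ?invr_eq0 ?ev_eq0 ?mulf_neq0 ?expf_neq0 ?ev_eq0 ?polyXsubC_eq0 //.
  rewrite ordV ordM ?expf_neq0 ?ev_eq0 ?polyXsubC_eq0 // ordX evXsubC.
  rewrite er (ord_ev_mult _ Pc nr) !mulrDl Hm // .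
  by case: (d == 0); ring.
(* The values at (c, d) of p' + q' y and of its conjugate. *)
pose e := p'.[c] + q'.[c] * d; pose e' := p'.[c] - q'.[c] * d.
have [ee|e0] := eqVneq e 0; last first.
  exists 0 => P Pcd; have [_ ->] := ord_unit e0 (lin_residue p' q' Pcd).
  by rewrite !mul0r.
have N0 := norm_neq0 pq'; set N := p' ^+ 2 - q' ^+ 2 * f in N0.
(* At a point with d = 0, y has half the order of x - c and q' is a unit, while p' is divisible by x
   - c, so that q' y dominates. *)
have [d0|d0] := eqVneq d 0.
  have pc0 : root p' c by move/eqP: ee; rewrite /e d0 mulr0 addr0.
  have qc0 : ~~ root q' c by move: npq; rewrite pc0.
  have q'0 : q' != 0 by apply: contraNneq qc0 => ->; rewrite root0.
  have fc : root f c by rewrite rootE -d2 d0 expr0n.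
  have [h ef nh] := root_hf fc.
  have [p1 ep1] := factor_theorem _ _ pc0.
  exists 1 => P /andP[Pc _]; rewrite mulr1 mul1r.
  have oy : ord P y * 2 = ord P (x - j c).
    have := congr1 (ord P) evf; rewrite ordX => ->.
    by rewrite ef -['X - _]expr1 (ord_ev_mult 1 Pc nh) mulr1.
  have e_gt0 : 0 < ord P (x - j c) := Pc.
  have oqy : ord P (ev q' * y) = ord P y.
    by rewrite ordM ?ev_eq0 ?y0 // (ord_ev_over Pc qc0) add0r.
  have [p'0|p'0] := eqVneq p' 0; first by rewrite p'0 rmorph0 add0r oqy.
  have op : ord P (x - j c) <= ord P (ev p').
    have p10 : p1 != 0 by apply: contraNneq p'0 => p10; rewrite ep1 p10 mul0r.
    rewrite ep1 rmorphM /= evXsubC ordM ?ev_eq0 ?xc0 // lerDr.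
    have := ev_point_ring p1 (x_point_ring Pc); rewrite unfold_in ev_eq0 (negPf p10) //.
  rewrite addrC; have [| | |_ ->] := @ord_addl _ _ P (ev q' * y) (ev p').
  - by rewrite mulf_neq0 ?ev_eq0 ?y0.
  - by rewrite ev_eq0.
  - rewrite oqy; apply: lt_le_trans op; rewrite -oy.
    by rewrite ltr_pMr // -(@pmulr_lgt0 _ 2) // oy.
  by rewrite oqy.
(* Both values vanish only if c is a common root of p' and q'. So the conjugate is a unit, and the
   norm carries the whole order. *)
have e'0 : e' != 0.
  apply: contraNneq npq => e'0.
  have h1 : 2%:R * p'.[c] = 0 by rewrite -[RHS](addr0 0) -{1}ee -e'0 /e /e'; ring.
  have h2 : 2%:R * (q'.[c] * d) = 0 by rewrite -[RHS](subr0 0) -{1}ee -e'0 /e /e'; ring.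
  move/eqP: h1; move/eqP: h2; rewrite !mulf_eq0 (negPf two0) (negPf d0) !orbF /= !rootE.
  by move=> -> ->.
have [mN [N' nN eN]] := multiplicity_XsubC N c; rewrite N0 /= in nN.
exists mN%:Z => P Pcd; have Pc : lies_over P c by case/andP: Pcd.
have [sw0 sw] : s (ev p' + ev q' * y) != 0 /\ ord P (s (ev p' + ev q' * y)) = 0.
  have := @ord_unit _ _ P (s (ev p' + ev q' * y)) e' e'0; apply.
  rewrite s_lin -mulNr -rmorphN /e' -mulNr -hornerN; exact: lin_residue.
have := congr1 (ord P) (normE p' q'); rewrite ordM // sw addr0 => ->.
by rewrite -/N eN (ord_ev_mult _ Pc nN); ring.
Qed.

(** By [ord_over2] the order functions of P and Q are proportional; both take the value 1, so the
    factor is 1. *)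
Lemma over2_eq P Q c d : d ^+ 2 = f.[c] -> over2 P c d -> over2 Q c d -> P = Q.
Proof.
move=> d2 Pcd Qcd.
have eP : 0 < ord P (x - j c) by case/andP: Pcd.
have eQ : 0 < ord Q (x - j c) by case/andP: Qcd.
have prop z : z != 0 -> ord P z * ord Q (x - j c) = ord Q z * ord P (x - j c).
  move=> z0; have [m Hm] := ord_over2 d2 z0; have h1 := Hm _ Pcd; have h2 := Hm _ Qcd.
  apply: (@mulIf _ (2 : int)) => //; rewrite mulrAC h1 [RHS]mulrAC h2; ring.
have [t t0 t1] := ord_surj P; have [u u0 u1] := ord_surj Q.
have h1 := prop t t0; have h2 := prop u u0; rewrite t1 mul1r in h1; rewrite u1 mul1r in h2.
have ee : ord P (x - j c) = ord Q (x - j c).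
  move: h1 h2 eP eQ; move: (ord Q t) (ord P u) (ord P _) (ord Q _) => a b e e' h1 h2 e0 e0'.
  have a0 : 0 < a by rewrite -(pmulr_lgt0 _ e0) -h1.
  have b0 : 0 < b by rewrite -(pmulr_lgt0 _ e0') h2.
  apply: le_anti; apply/andP; split; first by rewrite h1 ler_peMl ?(ltW e0).
  by rewrite -h2 ler_peMl ?(ltW e0').
apply: curve_point_eq => z; have [->|z0] := eqVneq z 0; first by rewrite !Defs.ord0.
have eQ0 : ord Q (x - j c) != 0 by rewrite gt_eqF.
by apply: (mulIf eQ0); rewrite (prop z z0) ee.
Qed.

Lemma over_cases P Q c : lies_over P c -> lies_over Q c -> Q = P \/ Q = spt P.
Proof.
move=> Pc Qc; have [d d2] : exists d : K, d ^+ 2 = f.[c].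
  have /closed_rootP[d] : size ('X^2 - (f.[c])%:P : {poly K}) != 1%N by rewrite size_XnsubC.
  by rewrite rootE !hornerE subr_eq0 => /eqP <-; exists d.
have [h|h] := over_over2 Pc d2; have [h'|h'] := over_over2 Qc d2.
- by left; apply: over2_eq h' h.
- by right; rewrite -(over2_eq d2 h' h) sptK.
- by right; apply: over2_eq h' h.
- by left; rewrite -[Q]sptK (over2_eq d2 h' h) sptK.
Qed.

(** Let e be the order of x - c at P. For a uniformizer, [ord_over2] gives 2 = m e at d = 0, where P
    is its own conjugate, and 1 = m e elsewhere. *)
Lemma ramif_le P c : lies_over P c -> ord P (x - j c) <= 1 + (P == spt P)%:Z.
Proof.
move=> Pc; have [d d2] : exists d : K, d ^+ 2 = f.[c].
  have /closed_rootP[d] : size ('X^2 - (f.[c])%:P : {poly K}) != 1%N by rewrite size_XnsubC.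
  by rewrite rootE !hornerE subr_eq0 => /eqP <-; exists d.
wlog Pcd : P Pc / over2 P c d.
  move=> H; have [h|h] := over_over2 Pc d2; first exact: H.
  have := H (spt P); rewrite over_spt sptK [_ == P]eq_sym ord_spt rmorphB hs_x hs_const.
  exact.
have [t t0 t1] := ord_surj P.
have [m Hm] := ord_over2 d2 t0; have := Hm P Pcd; rewrite t1 mul1r.
have e0 : 0 < ord P (x - j c) by [].
have bound (e i : int) : 0 < e -> 0 < i * e -> e <= i * e.
  by move=> h; rewrite pmulr_lgt0 // => i0; rewrite ler_peMl ?(ltW h).
have [d0|d0] := eqVneq d 0.
  have -> : P == spt P.
    by apply/eqP/(over2_eq d2 Pcd); rewrite -[d]opprK over2_spt d0 oppr0 -d0.
  by rewrite mulr1 => em; have := bound _ m e0; rewrite -em; apply.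
move=> em; have em1 : m * ord P (x - j c) = 1 by apply: (@mulIf _ (2 : int)); rewrite // mul1r.
have := bound _ m e0; rewrite em1 => /(_ isT) h; apply: le_trans h _.
by case: (_ == _).
Qed.

End Model.

(** * Orders at a pole of x *)

Section AtInfinity.
Variables (K : closedFieldType) (C : curve K) (M : hyper_model C).
Hypothesis two0 : 2%:R != 0 :> K.
Local Notation L := (funfield C).
Local Notation j := (constf C).
Local Notation x := (hx M).
Local Notation y := (hy M).
Local Notation f := (hf M).
Local Notation s := (hs M).
Local Notation ev := (ev M).
Variable O : curve_point C.
Hypothesis Ox : ord O x < 0.
Implicit Types (P Q : curve_point C) (z : L) (p q r : {poly K}) (c : K).

Lemma x_neq0 : x != 0.
Proof. by apply: contraTneq Ox => ->; rewrite Defs.ord0 ltxx. Qed.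

Lemma inf_XsubC c : ord O (x - j c) = ord O x.
Proof.
have [->|c0] := eqVneq c 0; first by rewrite rmorph0 subr0.
have jc : - j c != 0 by rewrite oppr_eq0 fmorph_eq0.
by case: (@ord_addl _ _ O x (- j c) x_neq0 jc) => //; rewrite ordN ord_const.
Qed.

Lemma inf_ev p : p != 0 -> ord O (ev p) = ord O x * (size p).-1%:Z.
Proof.
move=> p0; have [rs e] := closed_field_poly_normal p.
have lp0 : lead_coef p != 0 by rewrite lead_coef_eq0.
rewrite {1}e -mul_polyC rmorphM rmorph_prod /= evC ordZ // ord_prod; last first.
  by move=> c; rewrite evXsubC xc0.
rewrite (eq_bigr (fun=> ord O x)) => [|c _]; last by rewrite evXsubC inf_XsubC.
by rewrite e size_scale // size_prod_XsubC /= big_const_seq count_predT iter_addr_0 -mulr_natr natz.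
Qed.

(** If deg f = 2 m, then u = y / x^m satisfies u^2 = 1 at O. The involution fixes O and sends u to -
    u, so u - 1 and u + 1 would both vanish at O, and so would 2. *)
Lemma odd_deg : (forall z, ord O (s z) = ord O z) -> odd (size f).-1.
Proof.
move=> Os; apply/negPn/negP => ev_d; have totO := @point_valring _ _ O.
have [m em] : exists m, (size f).-1 = (m + m)%N.
  by exists (size f).-1./2; rewrite addnn -[LHS]odd_double_half (negPf ev_d).
have x0 := x_neq0; have xm0 : x ^+ m != 0 by rewrite expf_neq0.
pose u := y / x ^+ m.
have fm := hf_monic M.
have mu : maxid (point_ring O) ((u - 1) * (u + 1)).
  have -> : (u - 1) * (u + 1) = ev (f - 'X^(m + m)) / x ^+ (m + m).
    transitivity (u ^+ 2 - 1); first by ring.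
    rewrite rmorphB rmorphXn /= evX -evf [RHS]mulrBl divff ?expf_neq0 //.
    by rewrite expr_div_n -exprM muln2 addnn.
  rewrite maxid_pointE mulf_eq0 ev_eq0; have [//|h0 /=] := eqVneq (f - 'X^(m + m)) 0.
  rewrite ordM ?invr_eq0 ?expf_neq0 ?ev_eq0 // ordV ordX inf_ev // -mulrBr.
  rewrite (negPf (expf_neq0 _ x0)) nmulr_rgt0 // subr_lt0 ltz_nat -em.
  have sf : size f = (size f).-1.+1 by rewrite prednK // lt0n size_poly_eq0 f0.
  have : (size (f - 'X^((size f).-1))%R <= (size f).-1)%N.
    apply/leq_sizeP => i; rewrite coefB coefXn leq_eqVlt => /predU1P[<-|hi].
      by rewrite eqxx -lead_coefE (monicP fm) subrr.
    by rewrite gtn_eqF // nth_default ?subrr // sf.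
  by rewrite -[X in (X <= _)%N]prednK // lt0n size_poly_eq0 em.
have su : s u = - u by rewrite fmorph_div rmorphXn hs_x hs_y mulNr.
have uO : u \in point_ring O.
  have h : u ^+ 2 \in point_ring O.
    have -> : u ^+ 2 = (u - 1) * (u + 1) + 1 by ring.
    by rewrite rpredD ?rpred1 // (maxid_in totO).
  by move: h; rewrite !unfold_in sqrf_eq0 ordX pmulr_lge0.
have ms z : maxid (point_ring O) (s z) = maxid (point_ring O) z.
  by rewrite !maxid_pointE s_eq0 Os.
have both : maxid (point_ring O) (u - 1) = maxid (point_ring O) (u + 1).
  by rewrite -ms rmorphB rmorph1 su -opprD maxidN.
move: mu; rewrite maxidM ?rpredB ?rpredD ?rpred1 // -both orbb => mu1.
have := mu1; rewrite both => mu2; have := maxidB totO mu2 mu1.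
have -> : u + 1 - (u - 1) = j 2%:R by rewrite rmorph_nat; ring.
by rewrite const_maxid (negPf two0).
Qed.

Hypothesis oddf : odd (size f).-1.

Definition hgenus := ((size f).-1)./2.

Lemma size_hf : size f = (2 * hgenus + 1).+1.
Proof.
have sf : size f = (size f).-1.+1 by rewrite prednK // lt0n size_poly_eq0 f0.
by rewrite sf /hgenus -[in LHS](odd_double_half (size f).-1) oddf mul2n addnC.
Qed.

Lemma ord_y_inf : ord O y * 2 = ord O x * (2 * hgenus + 1)%N%:Z.
Proof.
by have := congr1 (ord O) (evf M); rewrite ordX => ->; rewrite inf_ev ?f0 // size_hf.
Qed.

(** Doubled, the orders of p and q y are an even and an odd multiple of the order of x, so they
    never agree and no cancellation occurs. *)
Lemma inf_lin p q : p != 0 -> q != 0 ->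
  (ord O (ev p) < ord O (ev q * y) /\ ord O (ev p + ev q * y) = ord O (ev p)) \/
  (ord O (ev q * y) < ord O (ev p) /\ ord O (ev p + ev q * y) = ord O (ev q * y)).
Proof.
move=> p0 q0; have p0' : ev p != 0 by rewrite ev_eq0.
have q0' : ev q * y != 0 by rewrite mulf_neq0 ?ev_eq0 ?y0.
case: (ltgtP (ord O (ev p)) (ord O (ev q * y))) => h.
- by left; split=> //; case: (ord_addl p0' q0' h).
- by right; split=> //; rewrite addrC; case: (ord_addl q0' p0' h).
- move: h => /(congr1 (fun i => i * 2)); rewrite ordM ?ev_eq0 ?y0 // mulrDl ord_y_inf !inf_ev //.
  rewrite -!mulrA -mulrDr => /mulfI; rewrite lt_eqF // => /(_ isT).
  by move: (size p).-1 (size q).-1 => a b; clear; lia.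
Qed.

(** Twice any order is a multiple of the order of x, so a uniformizer shows that the latter divides
    2; it is even because twice the order of y is an odd multiple of it. *)
Lemma ord_x_inf : ord O x = -2.
Proof.
have h z : z != 0 -> exists m : int, ord O z * 2 = ord O x * m.
  move=> z0; have [p [q [r [r0 ez]]]] := gen M z.
  have ep p' : p' != 0 -> exists m : int, ord O (ev p') * 2 = ord O x * m.
    by move=> p0; exists ((size p').-1%:Z * 2); rewrite inf_ev // mulrA.
  have eq q' : q' != 0 -> exists m : int, ord O (ev q' * y) * 2 = ord O x * m.
    move=> q0; exists ((size q').-1%:Z * 2 + (2 * hgenus + 1)%N%:Z).
    by rewrite ordM ?ev_eq0 ?y0 // mulrDl ord_y_inf inf_ev //; ring.
  have [m hm] : exists m : int, ord O (ev p + ev q * y) * 2 = ord O x * m.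
    have [p0|p0] := eqVneq p 0.
      rewrite p0 rmorph0 add0r; apply: eq; apply: contraNneq z0 => q0.
      by rewrite ez p0 q0 !rmorph0 mul0r addr0 mul0r.
    have [q0|q0] := eqVneq q 0; first by rewrite q0 rmorph0 mul0r addr0; apply: ep.
    by have [[_ ->]|[_ ->]] := inf_lin p0 q0; [apply: ep | apply: eq].
  have w0 : ev p + ev q * y != 0.
    by apply: contraNneq z0 => w0; rewrite ez w0 mul0r.
  have [l hl] := ep r r0; exists (m - l).
  by rewrite ez ordM ?invr_eq0 ?ev_eq0 // ordV mulrBl hm hl mulrBr.
have [t t0 t1] := ord_surj O; have [m] := h t t0; rewrite t1 mul1r => hm.
have := ord_y_inf; move: hm Ox; move: (ord O x) (ord O y) => a b; move: hgenus => g.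
clear; move=> e a0 e'.
have am : a \in [:: -2; -1; 1; 2].
  have : (`|a| %| 2)%N by apply/dvdnP; exists `|m|%N; rewrite -abszM mulrC -e.
  by rewrite dvdn_divisors // !inE; lia.
by move: am a0 e'; rewrite !inE; lia.
Qed.

Lemma ord_ev_inf p : p != 0 -> ord O (ev p) = - (2 * (size p).-1)%N%:Z.
Proof. by move=> p0; rewrite inf_ev // ord_x_inf; lia. Qed.

Lemma ord_evy_inf q : q != 0 -> ord O (ev q * y) = - (2 * (size q).-1 + 2 * hgenus + 1)%N%:Z.
Proof.
move=> q0; rewrite ordM ?ev_eq0 ?y0 // ord_ev_inf //.
by have := ord_y_inf; rewrite ord_x_inf; lia.
Qed.

Lemma ord_lin_inf p q (m : nat) : ev p + ev q * y != 0 ->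
  (- m%:Z <= ord O (ev p + ev q * y)) =
  ((p == 0) || (2 * (size p).-1 <= m)%N) && ((q == 0) || (2 * (size q).-1 + 2 * hgenus + 1 <= m)%N).
Proof.
have [p0|p0] := eqVneq p 0; have [q0|q0] := eqVneq q 0.
- by rewrite p0 q0 !rmorph0 mul0r addr0 eqxx.
- by rewrite p0 rmorph0 add0r ord_evy_inf // lerN2 lez_nat.
- by rewrite q0 rmorph0 mul0r addr0 ord_ev_inf // lerN2 lez_nat andbT.
move=> _; have [] := inf_lin p0 q0; rewrite ord_ev_inf // ord_evy_inf // => -[h ->];
  move: h; rewrite lerN2 lez_nat ltrN2 ltz_nat /= => h.
  by apply/idP/andP => [h1|[]//]; split=> //; lia.
by apply/idP/andP => [h1|[]//]; split=> //; lia.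
Qed.

End AtInfinity.

(** * Affine points and functions regular away from O *)

Section MarkedModel.
Variables (K : closedFieldType) (C : curve K) (M : hyper_model C).
Hypothesis two0 : 2%:R != 0 :> K.
Local Notation L := (funfield C).
Local Notation j := (constf C).
Local Notation x := (hx M).
Local Notation y := (hy M).
Local Notation f := (hf M).
Local Notation s := (hs M).
Local Notation ev := (ev M).
Variable O : curve_point C.
Hypotheses (Ox : ord O x < 0) (Os : forall z, ord O (s z) = ord O z).
Implicit Types (P Q : curve_point C) (z : L) (p q r : {poly K}) (c : K).

Let oddf : odd (size f).-1 := odd_deg two0 Ox Os.

Lemma sptO : spt M O = O.
Proof. by apply: curve_point_eq => z; rewrite ord_spt Os. Qed.

(** At any pole of x the orders of p and q y are fixed by the degrees and do not cancel, so the
    whole order function is determined. *)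
Lemma inf_uniq P : ord P x < 0 -> P = O.
Proof.
move=> Px; apply: curve_point_eq => z.
have [->|z0] := eqVneq z 0; first by rewrite !Defs.ord0.
have [p [q [r [r0 ez]]]] := gen M z.
have hp p' : p' != 0 -> ord P (ev p') = ord O (ev p') by move=> p0; rewrite !ord_ev_inf.
have hq q' : q' != 0 -> ord P (ev q' * y) = ord O (ev q' * y) by move=> q0; rewrite !ord_evy_inf.
have w0 : ev p + ev q * y != 0 by apply: contraNneq z0 => w0; rewrite ez w0 mul0r.
rewrite ez !ordM ?invr_eq0 ?ev_eq0 // !ordV hp //; congr (_ - _).
have [p0|p0] := eqVneq p 0.
  move: w0; rewrite p0 rmorph0 add0r => w0; apply: hq; apply: contraNneq w0 => ->.
  by rewrite rmorph0 mul0r.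
have [q0|q0] := eqVneq q 0; first by rewrite q0 rmorph0 mul0r addr0 hp.
have [[h1 ->]|[h1 ->]] := inf_lin Px oddf p0 q0; have [[h2 ->]|[h2 ->]] := inf_lin Ox oddf p0 q0.
- by rewrite hp.
- by move: h1; rewrite hp // hq // ltNge (ltW h2).
- by move: h1; rewrite hp // hq // ltNge (ltW h2).
- by rewrite hq.
Qed.

Lemma over_neqO P c : lies_over M P c -> P != O.
Proof.
move=> Pc; apply: contraTneq Ox => <-; have := x_point_ring Pc.
by rewrite unfold_in; case: eqP => [->|_ /=]; rewrite ?Defs.ord0 ?ltxx // leNgt.
Qed.

(** Otherwise every nonzero polynomial in x would have order 0 at P. So would the norm of p + q y,
    and as both conjugate factors are regular at P, all orders would vanish. *)
Lemma exists_x P : P != O -> exists c, lies_over M P c.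
Proof.
move=> PO; have xP : x \in point_ring P.
  rewrite unfold_in leNgt orbC; apply/orP; left; apply: contra PO => Px.
  by apply/eqP/inf_uniq.
apply: contrapT => no; have totP := @point_valring _ _ P.
have ordp p : p != 0 -> ord P (ev p) = 0.
  move=> p0; have [rs e] := closed_field_poly_normal p.
  have lp0 : lead_coef p != 0 by rewrite lead_coef_eq0.
  rewrite e -mul_polyC rmorphM rmorph_prod /= evC ordZ // ord_prod => [|c]; last first.
    by rewrite evXsubC xc0.
  rewrite big1 // => c _; rewrite evXsubC; apply/eqP/negPn/negP => h.
  apply: no; exists c; rewrite /lies_over lt_neqAle eq_sym h /=.
  have : x - j c \in point_ring P by rewrite rpredB ?const_point_ring.
  by rewrite unfold_in (negPf (xc0 M c)).
have yP : y \in point_ring P.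
  have := ev_point_ring f xP.
  by rewrite -evf !unfold_in sqrf_eq0 ordX pmulr_lge0.
have linP p q : ev p + ev q * y \in point_ring P.
  by rewrite rpredD ?rpredM ?ev_point_ring.
have [t t0 t1] := ord_surj P; have [p [q [r [r0 ez]]]] := gen M t.
have pq : (p != 0) || (q != 0).
  by apply: contraNT t0; rewrite ez negb_or !negbK => /andP[/eqP-> /eqP->]; rewrite !rmorph0 mul0r addr0 mul0r.
have w0 := lin_neq0 M two0 pq; have sw0 : s (ev p + ev q * y) != 0 by rewrite s_eq0.
have := congr1 (ord P) (normE M p q); rewrite ordp ?norm_neq0 // ordM //.
have h1 := linP p q; have h2 := linP p (- q); rewrite rmorphN mulNr -s_lin in h2.
move: h1 h2; rewrite !unfold_in (negPf w0) (negPf sw0) /= => h1 h2 h3.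
have h4 : ord P (ev p + ev q * y) = 0.
  by move: h1 h2 h3; move: (ord P _) (ord P _) => a b; clear; lia.
by move: t1; rewrite ez ordM ?invr_eq0 ?ev_eq0 // ordV ordp // h4.
Qed.

Lemma root_or_const r : r != 0 -> (exists c, root r c) \/ exists2 c, c != 0 & r = c%:P.
Proof.
move=> r0; have [s1|s1] := eqVneq (size r) 1%N.
  right; have /size_poly1P[c c0 ->] : size r == 1%N by apply/eqP.
  by exists c.
by left; apply/closed_rootP.
Qed.

(** In lowest terms, a root c of the denominator would give a pole at a point over c, which exists
    by [exists_over]. *)
Lemma dvdp_of_regular p r : r != 0 ->
  (forall P, P != O -> ev p / ev r \in point_ring P) -> r %| p.
Proof.
move=> r0 reg; have [->|p0] := eqVneq p 0; first exact: dvdp0.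
set d := gcdp p r; have d0 : d != 0 by rewrite gcdp_eq0 negb_and p0.
have ep : p = p %/ d * d by rewrite divpK // dvdp_gcdl.
have er : r = r %/ d * d by rewrite divpK // dvdp_gcdr.
have cop : coprimep (p %/ d) (r %/ d) by apply: coprimep_div_gcd; rewrite p0.
have r'0 : r %/ d != 0 by apply: contraNneq r0 => h; rewrite er h mul0r.
have [[c rc]|[c c0 ec]] := root_or_const r'0; last first.
  by rewrite er ec mul_polyC dvdpZl // dvdp_gcdl.
have [P Pc] := exists_over M two0 c.
have := reg P (over_neqO Pc).
have -> : ev p / ev r = ev (p %/ d) / ev (r %/ d).
  by rewrite {1}ep {1}er !rmorphM /= invfM mulrACA divff ?mulr1 // ev_eq0.
have npc : ~~ root (p %/ d) c.
  apply/negP => pc; have := coprimep_root cop pc.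
  by rewrite -rootE rc.
have p'0 : p %/ d != 0 by apply: contraNneq npc => ->; rewrite root0.
have [m [q nq eq]] := multiplicity_XsubC (r %/ d) c; rewrite r'0 /= in nq.
rewrite unfold_in mulf_eq0 invr_eq0 !ev_eq0 (negPf p'0) (negPf r'0) /=.
rewrite ordM ?invr_eq0 ?ev_eq0 // (ord_ev_over Pc npc) ordV eq (ord_ev_mult m Pc nq) add0r.
rewrite oppr_ge0 pmulr_rle0 //; case: m eq => // eq _.
by move: nq; rewrite -[q]mulr1 -[1](expr0 ('X - c%:P)) -eq rc.
Qed.

Lemma dvdp_sqfree q r : r != 0 -> r ^+ 2 %| q ^+ 2 * f -> r %| q.
Proof.
move=> r0 dv; have [->|q0] := eqVneq q 0; first exact: dvdp0.
set d := gcdp q r; have d0 : d != 0 by rewrite gcdp_eq0 negb_and q0.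
have eq : q = q %/ d * d by rewrite divpK // dvdp_gcdl.
have er : r = r %/ d * d by rewrite divpK // dvdp_gcdr.
have cop : coprimep (q %/ d) (r %/ d) by apply: coprimep_div_gcd; rewrite q0.
have r'0 : r %/ d != 0 by apply: contraNneq r0 => h; rewrite er h mul0r.
have [[c rc]|[c c0 ec]] := root_or_const r'0; last first.
  by rewrite er ec mul_polyC dvdpZl // dvdp_gcdl.
have : (r %/ d) ^+ 2 * d ^+ 2 %| (q %/ d) ^+ 2 * f * d ^+ 2.
  by rewrite -exprMn -er mulrAC -exprMn -eq.
rewrite dvdp_mul2r ?expf_neq0 // Gauss_dvdpr; last by rewrite coprimep_expl // coprimep_expr // coprimep_sym.
move=> rf; have := hf_sqfree M c; rewrite (dvdp_trans _ rf) //.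
by rewrite dvdp_exp2r // dvdp_XsubCl.
Qed.

(** The affine ring K[x, y] is integrally closed. For z = (p + q y) / r, the half-sum p / r of z and
    s z and the square q^2 f / r^2 of their half-difference are regular; so r divides p, and it
    divides q because f is squarefree. *)
Lemma regular_away_from_O z : (forall P, P != O -> z \in point_ring P) ->
  exists p q, z = ev p + ev q * y.
Proof.
move=> reg; have [p [q [r [r0 ez]]]] := gen M z.
have sreg P : P != O -> s z \in point_ring P.
  move=> PO; have : z \in point_ring (spt M P).
    by apply: reg; apply: contraNneq PO => e; rewrite -[P](sptK M) e sptO.
  by rewrite !unfold_in ord_spt s_eq0.
have half : 2%:R^-1 != 0 :> K by rewrite invr_eq0.
have jh : j 2%:R^-1 * 2%:R = 1 by rewrite -(rmorph_nat j) -rmorphM mulVf // rmorph1.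
have sz : s z = (ev p - ev q * y) / ev r by rewrite ez fmorph_div s_lin s_ev.
have /dvdpP[p1 ep] : r %| p.
  apply: dvdp_of_regular => // P PO.
  have -> : ev p / ev r = j 2%:R^-1 * (z + s z).
    by rewrite sz ez -mulrDl -[ev p in LHS]mul1r -jh; ring.
  by rewrite rpredM ?const_point_ring // rpredD ?reg ?sreg.
have /dvdpP[q1 eq] : r %| q.
  apply: dvdp_sqfree => //; apply: dvdp_of_regular; rewrite ?expf_neq0 // => P PO.
  have -> : ev (q ^+ 2 * f) / ev (r ^+ 2) = (j 2%:R^-1 * (z - s z)) ^+ 2.
    have -> : j 2%:R^-1 * (z - s z) = ev q * y / ev r.
      by rewrite sz ez -mulrBl -[ev q * y in RHS]mul1r -jh; ring.
    by rewrite rmorphM !rmorphXn /= -evf expr_div_n exprMn.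
  by rewrite rpredX // rpredM ?const_point_ring // rpredB ?reg ?sreg.
exists p1, q1; rewrite ez ep eq !rmorphM /=.
by rewrite mulrAC -mulrDl mulfK // ev_eq0.
Qed.

End MarkedModel.

Definition divsum (K : closedFieldType) (C : curve K) (A : seq (curve_point C)) : divisor C :=
  \sum_(P <- A) << P >>.

(** * The genus *)

Section Divisors.
Variables (K : closedFieldType) (C : curve K).
Local Notation L := (funfield C).
Local Notation j := (constf C).
Implicit Types (P Q : curve_point C) (z : L) (D : divisor C) (A B : seq (curve_point C)).

Lemma ordXz P z (m : int) : z != 0 -> ord P (z ^ m) = ord P z * m.
Proof.
move=> z0; case: m => m; first by rewrite -exprnP ordX.
by rewrite NegzE -invr_expz ordV -exprnP ordX mulrN.
Qed.

Lemma divsum_cat A B : divsum (A ++ B) = divsum A + divsum B.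
Proof. exact: big_cat. Qed.

Lemma divsum_cons P A : divsum (P :: A) = << P >> + divsum A.
Proof. exact: big_cons. Qed.

Lemma divsum_nseq P m : divsum (nseq m P) = << P >> *+ m.
Proof. by rewrite /divsum big_nseq iter_addr_0. Qed.

Lemma deg_divsum A : deg (divsum A) = (size A)%:Z.
Proof.
by rewrite /divsum raddf_sum /= (eq_bigr (fun=> 1)) => [|P _]; rewrite ?degU // big_const_seq count_predT iter_addr_0 natz.
Qed.

Lemma divisor_split D : exists A B, D = divsum A - divsum B.
Proof.
rewrite -[D]freeg_sumE; elim/big_ind: _ => [|_ _ [A [B ->]] [A' [B' ->]]|P _].
- by exists [::], [::]; rewrite subrr.
- by exists (A ++ A'), (B ++ B'); rewrite !divsum_cat opprD addrACA.
case: (coeff P D) => m.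
  by exists (nseq m P), [::]; rewrite divsum_nseq /divsum big_nil subr0 freegU_muln natz.
exists [::], (nseq m.+1 P); rewrite divsum_nseq /divsum big_nil sub0r freegU_muln natz freegUN.
by rewrite NegzE.
Qed.

Lemma rr_spaceE D z : rr_space D z <-> forall P, z == 0 \/ - coeff P D <= ord P z.
Proof.
split=> [h P|h z0 P].
  by have [|z0] := eqVneq z 0; [left | right; rewrite lerNl -subr_ge0 opprK addrC h].
by have [e|] := h P; [rewrite e in z0 | rewrite lerNl -subr_ge0 opprK addrC].
Qed.

Lemma rr_space_lin D c z w : rr_space D z -> rr_space D w -> rr_space D (z - j c * w).
Proof.
move=> /rr_spaceE hz /rr_spaceE hw; apply/rr_spaceE => P.
have [e|e0] := eqVneq (z - j c * w) 0; [by left | right].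
have [c0|c0] := eqVneq c 0.
  rewrite c0 rmorph0 mul0r subr0 in e0 *; by have [h|] := hz P; first by rewrite h in e0.
have [w0|w0] := eqVneq w 0.
  rewrite w0 mulr0 subr0 in e0 *; by have [h|] := hz P; first by rewrite h in e0.
have [h|hw'] := hw P; first by rewrite h in w0.
have jw0 : - (j c * w) != 0 by rewrite oppr_eq0 mulf_neq0 ?fmorph_eq0.
have [z0|z0] := eqVneq z 0; first by rewrite z0 sub0r ordN ordZ.
have [h|hz'] := hz P; first by rewrite h in z0.
by apply: le_trans (ordD P z0 jw0 e0); rewrite ordN ordZ // le_min hz'.
Qed.

(** This says l(D) >= N without supposing the space finite-dimensional. *)
Definition indep_in D N :=
  exists b : 'I_N -> L, (forall i, rr_space D (b i)) /\ lin_indep j b.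

Hypothesis residue : forall P z, z \in point_ring P -> exists c, maxid (point_ring P) (z - j c).

(** Adding one point raises the dimension by at most one: a pivot b i0 serves to cancel the residues
    at P of the other functions, all scaled by w^kap to be regular there. *)
Lemma indep_in_sub_point D P N : indep_in (D + << P >>) N.+1 -> indep_in D N.
Proof.
move=> [b [bD bi]]; have totP := @point_valring _ _ P.
have [w w0 w1] := ord_surj P; pose kap := coeff P D + 1.
have wk0 : w ^ kap != 0 by rewrite expfz_neq0.
have owk : ord P (w ^ kap) = kap by rewrite ordXz // w1 mul1r.
have coP : coeff P (D + << P >>) = kap by rewrite coeffD coeffU eqxx mulr1.
have bV i : b i * w ^ kap \in point_ring P.
  have /rr_spaceE/(_ P)[/eqP->|h] := bD i; first by rewrite mul0r rpred0.
  rewrite unfold_in; have [//|b0 /=] := eqVneq (b i * w ^ kap) 0.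
  have bi0 : b i != 0 by apply: contraNneq b0 => ->; rewrite mul0r.
  by rewrite ordM // owk -coP -lerBlDr sub0r.
have /choice[c cP] i := residue (bV i).
(* The pivot has nonzero residue if possible. If all residues vanish, any index serves: the
   quotients c i / c i0 are then 0. *)
have [i0 Hi0] : exists i0, c i0 = 0 -> forall i, c i = 0.
  have [/existsP[i ci]|/existsPn h] := boolP [exists i, c i != 0].
    by exists i => ci0; rewrite ci0 eqxx in ci.
  by exists ord0 => _ i; apply/eqP; have := h i; rewrite negbK.
pose b' i := b (fintype.lift i0 i) - j (c (fintype.lift i0 i) / c i0) * b i0.
exists b'; split=> [i|d]; last first.
  move=> e l; pose S := \sum_i d i * (c (fintype.lift i0 i) / c i0).
  pose e' k := if unlift i0 k is Some i then d i else - S.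
  suff : e' (fintype.lift i0 l) = 0 by rewrite /e' liftK.
  apply: bi; rewrite (bigD1_ord i0) //= {1}/e' unlift_none -[RHS]e.
  rewrite rmorphN mulNr /S rmorph_sum mulr_suml addrC -sumrB; apply: eq_bigr => i _.
  by rewrite /e' liftK /b' !rmorphM /=; ring.
have hDP : rr_space (D + << P >>) (b' i) by apply: rr_space_lin.
apply/rr_spaceE => Q; have [e|b0] := eqVneq (b' i) 0; [by left | right].
have [<-|PQ] := eqVneq P Q; last first.
  have /rr_spaceE/(_ Q)[e|] := hDP; first by rewrite e in b0.
  by rewrite coeffD coeffU (negPf PQ) mulr0 addr0.
have : maxid (point_ring P) (b' i * w ^ kap).
  have -> : b' i * w ^ kap = (b (fintype.lift i0 i) * w ^ kap - j (c (fintype.lift i0 i))) -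
      j (c (fintype.lift i0 i) / c i0) * (b i0 * w ^ kap - j (c i0)).
    have ec : c (fintype.lift i0 i) = c (fintype.lift i0 i) / c i0 * c i0.
      by have [z|z] := eqVneq (c i0) 0; [rewrite z mulr0 Hi0 | rewrite mulfVK].
    have : j (c (fintype.lift i0 i)) = j (c (fintype.lift i0 i) / c i0) * j (c i0) by rewrite -rmorphM -ec.
    rewrite /b'; move: (w ^ kap) (j (c (fintype.lift i0 i))) (j (_ / _)) (j (c i0)) => W u v v0 ->.
    by ring.
  by apply: maxidB => //; apply: maxidMr; rewrite ?const_point_ring.
rewrite maxid_pointE mulf_eq0 (negPf b0) (negPf wk0) /= ordM // owk /kap.
by move: (ord P _) (coeff P D) => a b1; clear; lia.
Qed.

Lemma indep_in_sub D B N : indep_in (D + divsum B) N -> indep_in D (N - size B).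
Proof.
elim: B D N => [|P B IH] D N; first by rewrite /divsum big_nil addr0 subn0.
rewrite divsum_cons addrA => /IH; rewrite /= subnS; case: (N - size B)%N => [_|m].
  by exists (fun=> 0); split=> [[]|c _ []].
exact: indep_in_sub_point.
Qed.

Lemma indep_in_dim D N n : indep_in D N -> rr_dim D n -> (N <= n)%N.
Proof.
move=> [w [wD wi]] [b [_ _ span]].
by apply: (lin_indep_leq wi) => i; apply/span/wD.
Qed.

End Divisors.

Section Genus.
Variables (K : closedFieldType) (C : curve K) (M : hyper_model C).
Hypothesis two0 : 2%:R != 0 :> K.
Local Notation L := (funfield C).
Local Notation j := (constf C).
Local Notation x := (hx M).
Local Notation y := (hy M).
Local Notation f := (hf M).
Local Notation s := (hs M).
Local Notation ev := (ev M).
Variable O : curve_point C.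
Hypotheses (Ox : ord O x < 0) (Os : forall z, ord O (s z) = ord O z).
Implicit Types (P Q : curve_point C) (z : L) (p q r : {poly K}) (c : K) (D : divisor C).
Local Notation gam := (hgenus M).
Let oddf : odd (size f).-1 := odd_deg two0 Ox Os.

Lemma maxid_frac P z w a b : b != 0 -> maxid (point_ring P) (z - j a) ->
  maxid (point_ring P) (w - j b) -> maxid (point_ring P) (z / w - j (a / b)).
Proof.
move=> b0 hz hw; have totP := @point_valring _ _ P.
have jb0 : j b != 0 by rewrite fmorph_eq0.
have [w0 ow] := ord_unit b0 hw.
have -> : z / w - j (a / b) = (w * j b)^-1 * (j b * (z - j a) - j a * (w - j b)).
  by rewrite fmorph_div; field; rewrite w0 jb0.
apply: maxidMr; first by rewrite unfold_in ordV ordM // ow ord_const // addr0 oppr0 lexx orbT.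
by apply: maxidB => //; apply: maxidMr; rewrite ?const_point_ring.
Qed.

Lemma rat_residue P c p r : lies_over M P c -> r != 0 -> ev p / ev r \in point_ring P ->
  exists b, maxid (point_ring P) (ev p / ev r - j b).
Proof.
move=> Pc r0; have [p0 _|p0] := eqVneq p 0.
  by exists 0; rewrite p0 !rmorph0 mul0r subr0 maxid0.
have [l [p' np ep]] := multiplicity_XsubC p c; rewrite p0 /= in np.
have [m [r' nr er]] := multiplicity_XsubC r c; rewrite r0 /= in nr.
rewrite unfold_in mulf_eq0 invr_eq0 !ev_eq0 (negPf p0) (negPf r0) /= => ge0.
have [h|h] := ltnP m l.
  exists 0; rewrite rmorph0 subr0 maxid_pointE mulf_eq0 invr_eq0 !ev_eq0 (negPf p0) (negPf r0) /=.
  rewrite ordM ?invr_eq0 ?ev_eq0 // ordV ep er !(ord_ev_mult _ Pc) // -mulrBr.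
  by rewrite pmulr_rgt0 // subr_gt0 ltz_nat.
have lm : l = m.
  move: ge0; rewrite ordM ?invr_eq0 ?ev_eq0 // ordV ep er !(ord_ev_mult _ Pc) // -mulrBr.
  by rewrite pmulr_rge0 // subr_ge0 lez_nat => h'; apply/eqP; rewrite eqn_leq h h'.
exists (p'.[c] / r'.[c]).
have -> : ev p / ev r = ev p' / ev r'.
  rewrite ep er lm !rmorphM invfM mulrACA divff ?mulr1 //.
  by rewrite rmorphXn expf_neq0 //= ev_eq0 polyXsubC_eq0.
by apply: maxid_frac; [exact: nr | exact: ev_residue | exact: ev_residue].
Qed.

Lemma const_of_quadratic P z t n : z \in point_ring P ->
  maxid (point_ring P) (z ^+ 2 - j t * z + j n) -> exists c, maxid (point_ring P) (z - j c).
Proof.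
move=> zP; have totP := @point_valring _ _ P.
have [a ea] : exists a : K, a ^+ 2 - t * a + n = 0.
  have [a] := @solve_monicpoly K 2%N (fun i => if i is 0 then - n else t) isT.
  by rewrite big_ord_recl big_ord1 /= mulr1 expr1 => e; exists a; rewrite e; ring.
have -> : z ^+ 2 - j t * z + j n = (z - j a) * (z - j (t - a)).
  have -> : j n = j t * j a - j a ^+ 2.
    by rewrite -rmorphXn -rmorphM -rmorphB; congr (j _); apply/eqP; rewrite -subr_eq0 -ea; apply/eqP; ring.
  by rewrite rmorphB; ring.
by rewrite maxidM ?rpredB ?const_point_ring // => /orP[h|h]; [exists a | exists (t - a)].
Qed.

(** z is a root of X^2 - T X + N with trace and norm in K(x). If s z is regular at P, both have
    residues, and the residue of z solves a quadratic equation over K. If s z has a pole, z is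
    congruent to N / T. *)
Lemma residue_over P c z : lies_over M P c -> z \in point_ring P ->
  exists b, maxid (point_ring P) (z - j b).
Proof.
move=> Pc zP; have totP := @point_valring _ _ P.
have [p [q [r [r0 ez]]]] := gen M z.
have r20 : r ^+ 2 != 0 by rewrite expf_neq0.
have eT : z + s z = ev (2%:R *: p) / ev r.
  rewrite ez fmorph_div s_lin s_ev -mulrDl -mul_polyC rmorphM /= evC rmorph_nat.
  by congr (_ / _); ring.
have eN : z * s z = ev (p ^+ 2 - q ^+ 2 * f) / ev (r ^+ 2).
  by rewrite -normE ez fmorph_div s_ev rmorphXn expr2 invfM mulrACA.
have [sP|nsP] := boolP (s z \in point_ring P).
  have [t ht] : exists b, maxid (point_ring P) (z + s z - j b).
    by rewrite eT; apply: (rat_residue Pc) => //; rewrite -eT rpredD.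
  have [n hn] : exists b, maxid (point_ring P) (z * s z - j b).
    by rewrite eN; apply: (rat_residue Pc) => //; rewrite -eN rpredM.
  apply: (const_of_quadratic (t := t) (n := n) zP).
  have -> : z ^+ 2 - j t * z + j n = z * (z + s z - j t) - (z * s z - j n) by ring.
  by apply: maxidB => //; apply: maxidMr.
have sz0 : s z != 0 by apply: contraNneq nsP => ->; rewrite rpred0.
have mw : maxid (point_ring P) (s z)^-1 by rewrite maxidVn.
have wP := maxid_in totP mw.
have [z0|z0] := eqVneq z 0; first by move: sz0; rewrite z0 rmorph0 eqxx.
have mzw : maxid (point_ring P) (z / s z) by apply: maxidMr.
have T0 : z + s z != 0.
  apply: contraNneq (maxid1 (point_ring P)) => /eqP; rewrite addr_eq0 => /eqP e.
  by move: mzw; rewrite {1}e mulNr divff // maxidN.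
have eTw : (z + s z) / s z = 1 + z / s z by rewrite mulrDl divff // addrC.
have NT : (z * s z) / (z + s z) = z / (1 + z / s z).
  by rewrite -eTw; field; rewrite T0 sz0.
have u1 : maxid (point_ring P) (1 + z / s z - j 1) by rewrite rmorph1 addrAC subrr add0r.
have [u0 ou] := ord_unit (oner_neq0 K) u1.
have NTP : (z * s z) / (z + s z) \in point_ring P.
  by rewrite NT rpredM // unfold_in ordV ou oppr0 lexx orbT.
have p20 : 2%:R *: p != 0 by rewrite -(ev_eq0 M); apply: contraNneq T0 => e; rewrite eT e mul0r.
have e2 : (z * s z) / (z + s z) = ev ((p ^+ 2 - q ^+ 2 * f) * r) / ev (r ^+ 2 * (2%:R *: p)).
  by rewrite eN eT !rmorphM /=; field; rewrite !ev_eq0 r0 p20.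
have [b hb] : exists b, maxid (point_ring P) ((z * s z) / (z + s z) - j b).
  by rewrite e2; apply: (rat_residue Pc); rewrite ?mulf_neq0 // -e2.
exists b; have -> : z - j b = ((z * s z) / (z + s z) - j b) + ((z * s z) / (z + s z)) * (z / s z).
  have e : z = (z * s z) / (z + s z) * (1 + z / s z) by rewrite NT mulfVK.
  by rewrite {1}e mulrDr mulr1 addrAC.
by apply: maxidD => //; apply: maxidMr.
Qed.

Lemma residue_inf z : z \in point_ring O -> exists b, maxid (point_ring O) (z - j b).
Proof.
move=> zO; have totO := @point_valring _ _ O.
have [hz|hz] := boolP (maxid (point_ring O) z); first by exists 0; rewrite rmorph0 subr0.
move: zO hz; rewrite maxid_pointE unfold_in negb_or; have [//|z0 /=] := eqVneq z 0.
rewrite -leNgt => h1 h2; have oz : ord O z = 0 by apply: le_anti; rewrite h1 h2.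
have [p [q [r [r0 ez]]]] := gen M z.
have r0' : ev r != 0 by rewrite ev_eq0.
have w0 : ev p + ev q * y != 0 by apply: contraNneq z0 => w0; rewrite ez w0 mul0r.
have ow : ord O (ev p + ev q * y) = - (2 * (size r).-1)%N%:Z.
  by move: oz; rewrite ez ordM ?invr_eq0 // ordV ord_ev_inf // => /eqP; rewrite subr_eq0 => /eqP.
have p0 : p != 0.
  apply/eqP => p0; move: ow w0; rewrite p0 rmorph0 add0r; have [->|q0] := eqVneq q 0.
    by rewrite rmorph0 mul0r eqxx.
  by rewrite ord_evy_inf // => e _; move: e; clear; lia.
have [spr mq] : size p = size r /\ maxid (point_ring O) (ev q * y / ev r).
  have sp : (0 < size p)%N by rewrite size_poly_gt0.
  have sr : (0 < size r)%N by rewrite size_poly_gt0.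
  have [q0|q0] := eqVneq q 0.
    move: ow; rewrite q0 rmorph0 !mul0r addr0 maxid0 ord_ev_inf // => e; split=> //.
    by move: e sp sr; move: (size p) (size r) => a b; clear; lia.
  have qy0 : ev q * y != 0 by rewrite mulf_neq0 ?ev_eq0 ?y0.
  have [[h e]|[h e]] := inf_lin Ox oddf p0 q0; rewrite ow in e; last first.
    by move: e; rewrite ord_evy_inf //; clear; lia.
  split.
    by move: e; rewrite ord_ev_inf //; move: sp sr; move: (size p) (size r) => a b; clear; lia.
  rewrite maxid_pointE [ord O (_ / _)]ordM ?invr_eq0 // ordV (ord_ev_inf two0 Ox oddf r0) opprK.
  by rewrite -ltrBlDr sub0r e h orbT.
(* Order 0 at O forces deg p = deg r and makes q y / r vanish there. *)
exists (lead_coef p / lead_coef r).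
have lr0 : lead_coef r != 0 by rewrite lead_coef_eq0.
have -> : z - j (lead_coef p / lead_coef r) =
    ev (p - (lead_coef p / lead_coef r) *: r) / ev r + ev q * y / ev r.
  by rewrite ez -mul_polyC [ev (_ - _)]rmorphB /= [ev (_ * _)]rmorphM /= evC; move: (j (_ / _)) => J; field.
apply: maxidD => //; set p' := p - _.
rewrite maxid_pointE mulf_eq0 invr_eq0 ev_eq0 (negPf r0') orbF.
have [//|p'0 /=] := eqVneq p' 0.
have sp' : (size p' < size r)%N.
  have sr : (0 < size r)%N by rewrite size_poly_gt0.
  rewrite -(prednK sr) ltnS; apply/leq_sizeP => i; rewrite leq_eqVlt => /predU1P[<-|hi].
    by rewrite coefB coefZ -lead_coefE -{1}spr -lead_coefE mulfVK // subrr.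
  rewrite coefB coefZ !nth_default ?mulr0 ?subrr //; move: hi; rewrite prednK //; by rewrite ?spr.
rewrite ordM ?invr_eq0 ?ev_eq0 // ordV !ord_ev_inf //.
by move: sp'; rewrite -size_poly_gt0 in p'0; move: p'0; move: (size p') (size r) => a b; clear; lia.
Qed.

Lemma residue P z : z \in point_ring P -> exists b, maxid (point_ring P) (z - j b).
Proof.
have [->|PO] := eqVneq P O; first exact: residue_inf.
by have [c Pc] := exists_x two0 Ox Os PO; apply: residue_over Pc.
Qed.

Lemma y_point_ring P : x \in point_ring P -> y \in point_ring P.
Proof.
move=> xP; have := ev_point_ring f xP.
by rewrite -evf !unfold_in sqrf_eq0 ordX pmulr_lge0.
Qed.

Lemma ord_XsubC_le P c Q : lies_over M P c ->
  ord Q (x - j c) <= coeff Q (<< P >> + << spt M P >>) - (2 * (Q == O))%N%:Z.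
Proof.
move=> Pc; rewrite coeffD !coeffU !mul1r.
have PO := over_neqO Ox Pc.
have [->|QO] := eqVneq Q O.
  rewrite inf_XsubC // (ord_x_inf Ox oddf) (negPf PO).
  have -> : (spt M P == O) = false.
    by apply: contraNF PO => /eqP e; rewrite -[P](sptK M) e sptO.
  by [].
rewrite muln0 subr0; have [Qc|nQc] := boolP (lies_over M Q c); last first.
  have : ord Q (x - j c) <= 0 by rewrite leNgt.
  by move/le_trans; apply; rewrite addr_ge0 //; case: (_ == _).
have [->|->] := over_cases two0 Pc Qc.
  apply: le_trans (ramif_le two0 Pc) _; rewrite eqxx lerD2l eq_sym natz //.
rewrite eqxx [X in _ <= X]addrC; have sPc : lies_over M (spt M P) c by rewrite over_spt.
by apply: le_trans (ramif_le two0 sPc) _; rewrite sptK eq_sym lerD2l natz.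
Qed.

Definition divpair (A : seq (curve_point C)) : divisor C := divsum A + divsum [seq spt M P | P <- A].

(** q is the product of the x - x(P) over the points P != O of A, each with divisor (P) + (s P) - 2
    (O). A point O contributes the factor 1, since (O) + (s O) - 2 (O) = 0. *)
Lemma exists_denominator A : exists2 q, q != 0 &
  forall Q, ord Q (ev q) <= coeff Q (divpair A) - (2 * size A * (Q == O))%N%:Z.
Proof.
elim: A => [|P A [q q0 IH]].
  exists 1; rewrite ?oner_neq0 // => Q.
  by rewrite rmorph1 ord_one /divpair /divsum /= !big_nil coeffD !coeff0 mul0n.
have [h [h0 Hh]] : exists h, h != 0 /\ forall Q, ord Q (ev h) <= coeff Q (<< P >> + << spt M P >>) - (2 * (Q == O))%N%:Z.
  have [->|PO] := eqVneq P O; last first.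
    have [c Pc] := exists_x two0 Ox Os PO; exists ('X - c%:P).
    by rewrite polyXsubC_eq0; split=> // Q; rewrite evXsubC; apply: ord_XsubC_le.
  exists 1; rewrite oner_neq0; split=> // Q; rewrite rmorph1 ord_one sptO // coeffD !coeffU !mul1r.
  by rewrite eq_sym; case: (Q == O).
exists (q * h) => [|Q]; first by rewrite mulf_neq0.
rewrite rmorphM /= ordM ?ev_eq0 //; apply: le_trans (lerD (IH Q) (Hh Q)) _.
rewrite /divpair /= !divsum_cons !coeffD.
move: (coeff _ _) (coeff _ _) (coeff _ _) (coeff _ _) => a b c d.
by case: (Q == O); clear; lia.
Qed.

(** The functions are x^i / q with i <= gam + a and x^i y / q with i < a, for a = [size A]; their
    numerators have pole order at most 2 (gam + a) at O. Their number 2 a + gam + 1 is the degree 2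
    a + 2 gam of the divisor plus 1 - gam. *)
Lemma indep_in_divpair A : indep_in (divpair A + << O >> *+ (2 * gam)) (gam + (size A)%N + 1 + size A).
Proof.
have [q q0 Hq] := exists_denominator A; have q0' : ev q != 0 by rewrite ev_eq0.
pose a := size A; pose n1 := (gam + a + 1)%N.
pose b (i : 'I_(n1 + a)) : L := match fintype.split i with
  | inl i1 => ev 'X^i1 / ev q | inr i2 => ev 'X^i2 * y / ev q end.
exists b; split=> [i|c]; last first.
  move=> e; pose p1 : {poly K} := \poly_(i < n1) (if insub i is Some i' then c (lshift a i') else 0).
  pose p2 : {poly K} := \poly_(i < a) (if insub i is Some i' then c (rshift n1 i') else 0).
  have : ev p1 + ev p2 * y = 0.
    apply: (mulIf (invr_neq0 q0')); rewrite mul0r -[RHS]e big_split_ord /= mulrDl; congr (_ + _).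
      rewrite /p1 poly_def rmorph_sum mulr_suml; apply: eq_bigr => i _.
      rewrite valK /b; case: split_ordP => [i' /lshift_inj<-|i' /eqP]; last by rewrite eq_lrshift.
      by rewrite -mul_polyC rmorphM /= evC mulrA.
    rewrite /p2 poly_def rmorph_sum !mulr_suml; apply: eq_bigr => i _.
    rewrite valK /b; case: split_ordP => [i' /eqP|i' /rshift_inj<-]; first by rewrite eq_rlshift.
    by rewrite -mul_polyC rmorphM /= evC !mulrA.
  move/(lin_eq0 two0) => [p10 p20] i.
  have [i'->|i'->] := split_ordP i.
    by have := congr1 (fun p : {poly K} => p`_i') p10; rewrite coef0 coef_poly ltn_ord valK.
  by have := congr1 (fun p : {poly K} => p`_i') p20; rewrite coef0 coef_poly ltn_ord valK.
apply/rr_spaceE => Q; right.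
have [w [-> w0 wQ wO]] : exists w, [/\ b i = w / ev q, w != 0, Q != O -> 0 <= ord Q w & - (2 * (gam + a))%N%:Z <= ord O w].
  have nX m : 'X^m != 0 :> {poly K} by rewrite monic_neq0 ?monicXn.
  have Xreg m : Q != O -> 0 <= ord Q (ev 'X^m).
    move=> QO; have [c Qc] := exists_x two0 Ox Os QO.
    have := ev_point_ring 'X^m (x_point_ring Qc).
    by rewrite unfold_in ev_eq0 (negPf (nX m)).
  rewrite /b; case: (fintype.split i) => i'.
    exists (ev 'X^i'); split; rewrite ?ev_eq0 //; first exact: Xreg.
    rewrite (ord_ev_inf two0 Ox oddf) // size_polyXn /= lerN2 lez_nat.
    by have := ltn_ord i'; rewrite /n1; move: (nat_of_ord i') => m; clear; lia.
  exists (ev 'X^i' * y); split; rewrite ?mulf_neq0 ?ev_eq0 ?y0 //.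
    move=> QO; rewrite ordM ?ev_eq0 ?y0 // addr_ge0 ?Xreg //.
    have [c Qc] := exists_x two0 Ox Os QO.
    by have := y_point_ring (x_point_ring Qc); rewrite unfold_in (negPf (y0 M)).
  rewrite (ord_evy_inf two0 Ox oddf) // size_polyXn /= lerN2 lez_nat.
  by have := ltn_ord i'; move: (nat_of_ord i') => m; clear; lia.
rewrite ordM ?invr_eq0 // ordV coeffD coeffMn coeffU mul1r.
have := Hq Q; rewrite -/a; have [eQ|QO] := eqVneq Q O.
  have -> : true%:R *+ (2 * gam) = (2 * gam)%N%:Z :> int by rewrite mulr1n natz.
  move: wO; rewrite eQ; move: (ord O w) (ord O (ev q)) (coeff O _) gam => u v d m.
  by clear; lia.
have := wQ QO; move: (ord Q w) (ord Q (ev q)) (coeff Q _) => u v d.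
by rewrite mul0rn; clear; lia.
Qed.

(** For D = A - B, the divisor of [indep_in_divpair] exceeds D by an effective divisor, each point
    of which costs at most one dimension. *)
Lemma riemann D n : rr_dim D n -> deg D - n%:Z + 1 <= gam%:Z.
Proof.
move=> Dn; have [A [B eD]] := divisor_split D.
have := indep_in_divpair A.
have -> : divpair A + << O >> *+ (2 * gam) =
    D + divsum (B ++ [seq spt M P | P <- A] ++ nseq (2 * gam) O).
  rewrite eD !divsum_cat divsum_nseq /divpair !addrA; congr (_ + _ + _).
  by rewrite subrK.
move/(indep_in_sub residue)/indep_in_dim/(_ Dn).
rewrite eD degB !deg_divsum !size_cat size_map size_nseq.
by move: (size A) (size B) gam => a b m; clear; lia.
Qed.

(** y has pole order 2 gam + 1 at O, one too many, so only 1, x, ..., x^gam remain. This divisor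
    attains the bound of [riemann]. *)
Lemma rr_dim_canonical : rr_dim (<< O >> *+ (2 * gam)) gam.+1.
Proof.
have Xn0 m : 'X^m != 0 :> {poly K} by rewrite monic_neq0 ?monicXn.
exists (fun i => ev 'X^i); split.
- move=> i; apply/rr_spaceE => Q; right; rewrite coeffMn coeffU mul1r.
  have [<-|QO] := eqVneq O Q.
    rewrite (ord_ev_inf two0 Ox oddf) // size_polyXn /= pmulrn.
    by have := ltn_ord i; move: (nat_of_ord i) => m; move: gam => m'; clear; lia.
  rewrite mul0rn oppr0; rewrite eq_sym in QO; have [c Qc] := exists_x two0 Ox Os QO.
  have := ev_point_ring 'X^i (x_point_ring Qc).
  by rewrite unfold_in ev_eq0 (negPf (Xn0 i)).
- move=> c e i; pose p1 : {poly K} := \poly_(i < gam.+1) (if insub i is Some i' then c i' else 0).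
  have : ev p1 = 0.
    rewrite -[RHS]e /p1 poly_def rmorph_sum; apply: eq_bigr => l _.
    by rewrite valK -mul_polyC rmorphM /= evC.
  move/eqP; rewrite ev_eq0 => /eqP/(congr1 (fun p : {poly K} => p`_i)).
  by rewrite coef0 coef_poly ltn_ord valK.
move=> z /rr_spaceE hz.
have [|p [q ez]] := @regular_away_from_O _ _ M two0 O Ox Os z.
  move=> P PO; rewrite unfold_in; have [/eqP->|h] := hz P; first by rewrite eqxx.
  by apply/orP; right; move: h; rewrite coeffMn coeffU mul1r eq_sym (negPf PO) mul0rn oppr0.
have szp : (size p <= gam.+1)%N /\ q = 0.
  have [/eqP z0|h] := hz O.
    by rewrite z0 in ez; have [-> ->] := lin_eq0 two0 (esym ez); rewrite size_poly0.
  have [z0|z0] := eqVneq z 0.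
    by rewrite z0 in ez; have [-> ->] := lin_eq0 two0 (esym ez); rewrite size_poly0.
  move: h; rewrite coeffMn coeffU eqxx mulr1 natz ez (ord_lin_inf two0 Ox oddf) -?ez // => /andP[h1 h2].
  split.
    move: h1; have [->|p0] := eqVneq p 0; first by rewrite size_poly0.
    by rewrite /= leq_mul2l /=; case: (size p).
  by move: h2; case: eqP => //= _; rewrite addn1 ltnNge leq_addl.
case: szp => szp q0; exists (fun i => p`_i).
rewrite ez q0 rmorph0 mul0r addr0 evE.
rewrite (@horner_coef_wide _ gam.+1) ?size_map_poly //; apply: eq_bigr => i _.
by rewrite coef_map /= rmorphXn /= evX.
Qed.

Lemma genus_unique g : has_genus C g -> gam = g.
Proof.
move=> [up [D [n [Dn e]]]]; apply/eqP; rewrite eqn_leq; apply/andP; split.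
  have := up _ _ rr_dim_canonical; rewrite degMn degU natz.
  by move: gam => m; clear; lia.
by have := riemann Dn; rewrite e lez_nat.
Qed.

End Genus.

Lemma card_ge_seq (T : choiceType) (A : set T) n : (`I_n #<= A)%card ->
  exists s : seq T, [/\ uniq s, size s = n & forall a, a \in s -> A a].
Proof.
move=> /card_leP[h].
have hmem (i : 'I_n) : (i : nat) \in `I_n%classic by apply/mem_set/ltn_ord.
pose k (i : 'I_n) : T := val (h (SigSub (hmem i))).
exists [seq k i | i <- enum 'I_n]; split.
- rewrite map_inj_uniq ?enum_uniq // => i l /val_inj e.
  have := @inj _ _ _ h _ _ (mem_set I) (mem_set I) e.
  by move=> /(congr1 val) /= /val_inj.
- by rewrite size_map size_enum_ord.
- by move=> _ /mapP[i _ ->]; apply: set_mem; exact: valP.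
Qed.

Lemma torsion_function (K : closedFieldType) (C : curve K) (O P : curve_point C) n :
    (1 < n)%N -> torsion_points O n P ->
  P != O /\ exists2 h : funfield C, h != 0 &
    forall Q, ord Q h = ((P == Q)%:R - (O == Q)%:R) * n%:Z.
Proof.
move=> n1 [n0 hn hm].
have pin m : to_jacobian O P *+ m = \pi_(jacobian C)%qT (Div0 (deg0_pointB P O) *+ m).
  by rewrite /to_jacobian raddfMn.
split.
  apply: contraTneq isT => PO; have /negP := hm 1%N n1; case.
  rewrite pin mulr1n -[0](raddf0 (\pi_(jacobian C)%qT)) -Quotient.idealrBE subr0.
  have -> : Div0 (deg0_pointB P O) = 0 by apply: val_inj; rewrite /= PO subrr.
  exact: rpred0.
move: hn; rewrite pin -[0](raddf0 (\pi_(jacobian C)%qT)) => /eqP.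
rewrite -Quotient.idealrBE subr0 => /asboolP[h h0 hP]; exists h => // Q.
by rewrite -hP raddfMn /= coeffMn coeffB !coeffU !mul1r -[in RHS]natz mulr_natr.
Qed.

(** * Torsion points *)

Section Torsion.
Variables (K : closedFieldType) (C : curve K) (M : hyper_model C).
Hypothesis two0 : 2%:R != 0 :> K.
Local Notation L := (funfield C).
Local Notation j := (constf C).
Local Notation x := (hx M).
Local Notation y := (hy M).
Local Notation f := (hf M).
Local Notation s := (hs M).
Local Notation ev := (ev M).
Variable O : curve_point C.
Hypotheses (Ox : ord O x < 0) (Os : forall z, ord O (s z) = ord O z).
Implicit Types (P Q : curve_point C) (z : L) (p q r : {poly K}) (c : K).
Local Notation gam := (hgenus M).
Let oddf : odd (size f).-1 := odd_deg two0 Ox Os.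

(** The function h with divisor n (P) - n (O) is p + q y. Its odd pole order n = 2 gam + 1 is that
    of y, so q is a nonzero constant c and deg p <= gam. The norm of h has degree n and no other
    root than a. *)
Lemma torsion_relation P : (0 < gam)%N -> torsion_points O (2 * gam + 1) P ->
  exists a v, [/\ lies_over M P a, f = ('X - a%:P) ^+ (2 * gam + 1) + v ^+ 2 & (size v <= gam.+1)%N].
Proof.
set n := (2 * gam + 1)%N => gam0 tP.
have [|PO [h h0 hord]] := torsion_function _ tP.
  by rewrite /n; move: gam gam0 => m; clear; lia.
have ordQ Q : Q != O -> ord Q h = (P == Q)%:R * n%:Z.
  by move=> QO; rewrite hord [O == Q]eq_sym (negPf QO) subr0.
have ordO : ord O h = - n%:Z by rewrite hord eqxx (negPf PO) sub0r mulN1r.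
have [|p [q eh]] := @regular_away_from_O _ _ M two0 O Ox Os h.
  by move=> Q QO; rewrite unfold_in ordQ // mulr_ge0 ?orbT //; case: (_ == _).
have := @ord_lin_inf _ _ M two0 O Ox oddf p q n; rewrite -eh => /(_ h0).
rewrite ordO lexx => /esym/andP[hp hq].
have q0 : q != 0.
  apply/eqP => q0; move: ordO h0; rewrite eh q0 rmorph0 mul0r addr0 ev_eq0 => e p0.
  move: e; rewrite (ord_ev_inf two0 Ox oddf) // /n; move: (size p) gam => a m; clear; lia.
have sq : size q = 1%N.
  move: hq; rewrite (negPf q0) /= /n; have : (0 < size q)%N by rewrite size_poly_gt0.
  by move: (size q) gam => a m; clear; lia.
have [c c0 eq] : exists2 c, c != 0 & q = c%:P.
  by have /size_poly1P[c c0 ->] : size q == 1%N; [rewrite sq | exists c].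
have sp : (size p <= gam.+1)%N.
  move: hp; have [->|p0] := eqVneq p 0; first by rewrite size_poly0.
  by rewrite /= /n; move: (size p) gam => a m; clear; lia.
have [a Pa] := exists_x two0 Ox Os PO.
pose N := p ^+ 2 - q ^+ 2 * f.
have sf : size f = n.+1 := size_hf oddf.
have sqf : size (q ^+ 2 * f) = n.+1.
  by rewrite eq -rmorphXn /= mul_polyC size_scale ?expf_neq0.
have sp2 : (size (p ^+ 2) < n.+1)%N.
  rewrite ltnS expr2 (leq_trans (size_polyMleq _ _)) // /n.
  by move: sp; move: (size p) gam => b m; clear; lia.
have sN : size N = n.+1 by rewrite /N addrC size_polyDl size_polyN sqf.
have lN : lead_coef N = - c ^+ 2.
  rewrite /N addrC lead_coefDl ?size_polyN ?sqf // lead_coefN eq -rmorphXn /= mul_polyC lead_coefZ.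
  by rewrite (monicP (hf_monic M)) mulr1.
have [rs eN] := closed_field_poly_normal N.
(* A root b of the norm is the abscissa of some Q != O at which h or its conjugate vanishes, so P is
   Q or the conjugate of Q. *)
have rsa (b : K) : b \in rs -> b = a.
  move=> rrs; have [Q Qr] := exists_over M two0 b.
  have QO := over_neqO Ox Qr; have sQO : spt M Q != O.
    by apply: contraNneq QO => e; rewrite -[Q](sptK M) e sptO.
  have rN : root N b by rewrite eN rootZ ?lead_coef_eq0 -?size_poly_eq0 ?sN // root_prod_XsubC.
  have mN : maxid (point_ring Q) (ev N).
    by have := ev_residue N Qr; rewrite (eqP rN) rmorph0 subr0.
  have : 0 < ord Q (ev N).
    by move: mN; rewrite maxid_pointE ev_eq0 -size_poly_eq0 sN.
  rewrite /N -normE -eh ordM ?s_eq0 // -ord_spt !ordQ //.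
  have [e _|_] := eqVneq P Q; first by apply: over_uniq Pa; rewrite e.
  have [e _|_] := eqVneq P (spt M Q); last by rewrite !mul0r addr0.
  by apply: (over_uniq (P := P) (M := M)) => //; rewrite e over_spt.
have eN' : N = (- c ^+ 2) *: ('X - a%:P) ^+ n.
  rewrite eN lN; congr (_ *: _).
  have srs : size rs = n.
    by have := sN; rewrite eN size_scale ?lN ?oppr_eq0 ?expf_neq0 // size_prod_XsubC => -[].
  rewrite -srs; elim: rs rsa {eN srs} => [|r rs IH] h1; first by rewrite big_nil.
  rewrite big_cons exprS (h1 r) ?mem_head // IH // => r' hr; apply: h1.
  by rewrite inE hr orbT.
exists a, (c^-1 *: p); split=> //; last by rewrite (leq_trans (size_scale_leq _ _)).
have ef : f = c ^- 2 *: (q ^+ 2 * f).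
  by rewrite eq -rmorphXn /= mul_polyC scalerA mulVf ?scale1r // expf_neq0.
have -> : f = c ^- 2 *: (p ^+ 2 - N) by rewrite /N opprB addrC subrK.
by rewrite eN' exprZn exprVn scaleNr opprK scalerDr scalerA mulVf ?scale1r ?expf_neq0 // addrC.
Qed.

Lemma three_relations : (0 < gam)%N -> (`I_5 #<= torsion_points O (2 * gam + 1))%card ->
  exists a1 a2 a3 v1 v2 v3,
    [/\ [/\ a1 != a2, a1 != a3 & a2 != a3],
        [/\ f = ('X - a1%:P) ^+ (2 * gam + 1) + v1 ^+ 2,
            f = ('X - a2%:P) ^+ (2 * gam + 1) + v2 ^+ 2 &
            f = ('X - a3%:P) ^+ (2 * gam + 1) + v3 ^+ 2] &
        [/\ (size v1 <= gam.+1)%N, (size v2 <= gam.+1)%N & (size v3 <= gam.+1)%N]].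
Proof.
move=> gam0 /card_ge_seq[l [ul sl tl]].
have /choice[A HA] P : exists a, P \in l -> exists v, [/\ lies_over M P a,
    f = ('X - a%:P) ^+ (2 * gam + 1) + v ^+ 2 & (size v <= gam.+1)%N].
  have [Pl|_] := boolP (P \in l); last by exists 0.
  by have [a [v H]] := torsion_relation gam0 (tl P Pl); exists a => _; exists v.
(* Over one abscissa lie at most the points P and [spt M P], so discarding an abscissa removes at
   most two points. *)
have fiber (r : seq (curve_point C)) P : uniq r -> {subset r <= l} -> P \in l ->
    (size r - 2 <= size [seq Q <- r | A Q != A P])%N.
  move=> ur rl Pl; rewrite leq_subLR -(count_predC (fun Q => A Q == A P) r) size_filter leq_add2r.
  rewrite -size_filter; have : {subset [seq Q <- r | A Q == A P] <= [:: P; spt M P]}.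
    move=> Q; rewrite mem_filter => /andP[/eqP e /rl Ql].
    have [v [h1 _ _]] := HA P Pl; have [w [h2 _ _]] := HA Q Ql; rewrite e in h2.
    by have [->|->] := over_cases two0 h1 h2; rewrite !inE eqxx ?orbT.
  by apply: (uniq_leq_size (filter_uniq _ ur)).
case: l => [//|P1 l'] in ul sl tl HA fiber *; set l := P1 :: l' in ul sl tl HA fiber *.
have P1l : P1 \in l by rewrite mem_head.
pose r1 := [seq Q <- l | A Q != A P1].
have sr1 : (3 <= size r1)%N by have := fiber l P1 ul (fun _ h => h) P1l; rewrite sl.
have r1l : {subset r1 <= l} by move=> Q; rewrite mem_filter => /andP[].
have [P2 P2r] : exists P2, P2 \in r1.
  by case: (r1) sr1 => [//|P2 t] _; exists P2; rewrite mem_head.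
have P2l := r1l _ P2r.
have [P3 P3r] : exists P3, P3 \in [seq Q <- r1 | A Q != A P2].
  have : (0 < size [seq Q <- r1 | A Q != A P2])%N.
    apply: leq_trans (fiber r1 P2 (filter_uniq _ ul) r1l P2l).
    by rewrite subn_gt0.
  by case: [seq _ <- _ | _] => [//|P3 t] _; exists P3; rewrite mem_head.
move: P3r; rewrite mem_filter => /andP[A32 P3r]; have P3l := r1l _ P3r.
move: P2r P3r; rewrite !mem_filter => /andP[A21 _] /andP[A31 _].
have [v1 [_ e1 h1]] := HA P1 P1l; have [v2 [_ e2 h2]] := HA P2 P2l; have [v3 [_ e3 h3]] := HA P3 P3l.
exists (A P1), (A P2), (A P3), v1, v2, v3; split=> //.
by split; rewrite eq_sym.
Qed.

End Torsion.

(** * Existence of a model *)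

Lemma frac_quotient (R : idomainType) (r : {fraction R}) :
  exists p q, q != 0 /\ r = FracField.tofrac p / FracField.tofrac q.
Proof.
elim/quotW: r => u; exists (frac u).1, (frac u).2; split; first exact: denom_ratioP.
have d0 : FracField.tofrac (frac u).2 != 0 by rewrite tofrac_eq0 denom_ratioP.
apply: (mulIf d0); rewrite mulfVK //; unlock FracField.tofrac.
rewrite -[LHS]FracField.pi_mul; apply/eqmodP; rewrite /= FracField.equivfE /FracField.mulf.
by rewrite !numden_Ratio ?mulf_neq0 ?oner_neq0 ?denom_ratioP // !mulr1 mulrC.
Qed.

Lemma square_part (K : closedFieldType) (p : {poly K}) : p != 0 ->
  exists h q, p = h ^+ 2 * q /\ forall c, ~~ (('X - c%:P) ^+ 2 %| q).
Proof.
have [n] := ubnP (size p); elim: n p => // n IH p sp p0.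
have [[c cp]|no] := pselect (exists c, ('X - c%:P) ^+ 2 %| p); last first.
  exists 1, p; rewrite expr1n mul1r; split=> // c; apply/negP => cp; apply: no; by exists c.
move/dvdpP: cp => [q e]; have q0 : q != 0 by apply: contraNneq p0 => q0; rewrite e q0 mul0r.
have [|h [r [eq sr]]] := IH q _ q0.
  by rewrite e size_Mmonic ?monic_exp ?monicXsubC // size_exp_XsubC in sp; move: sp; clear; lia.
by exists (h * ('X - c%:P)), r; rewrite e eq exprMn mulrAC.
Qed.

Section RationalIn.
Variables (k L : fieldType) (j : {rmorphism k -> L}) (x : L).
Local Notation "p @x" := ((map_poly j p).[x]) (at level 2).

Definition rational_in (z : L) := exists p q : {poly k}, q@x != 0 /\ z = p@x / q@x.

Lemma rational_poly (p : {poly k}) : rational_in p@x.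
Proof. by exists p, 1; rewrite rmorph1 hornerC oner_neq0 divr1. Qed.

Lemma rational_const c : rational_in (j c).
Proof. by have := rational_poly c%:P; rewrite map_polyC hornerC. Qed.

Lemma rational_gen : rational_in x.
Proof. by have := rational_poly 'X; rewrite map_polyX hornerX. Qed.

Lemma rationalD z w : rational_in z -> rational_in w -> rational_in (z + w).
Proof.
move=> [p [q [q0 ->]]] [r [t [t0 ->]]]; exists (p * t + r * q), (q * t).
rewrite rmorphD !rmorphM !hornerE mulf_neq0 //; split=> //; field.
by rewrite q0 t0.
Qed.

Lemma rationalM z w : rational_in z -> rational_in w -> rational_in (z * w).
Proof.
move=> [p [q [q0 ->]]] [r [t [t0 ->]]]; exists (p * r), (q * t).
by rewrite !rmorphM !hornerM; split; [exact: mulf_neq0 | rewrite invfM mulrACA].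
Qed.

Lemma rationalV z : rational_in z -> rational_in z^-1.
Proof.
move=> [p [q [q0 ->]]]; have [p0|p0] := eqVneq p@x 0.
  by rewrite p0 mul0r invr0 -(rmorph0 j); apply: rational_const.
by exists q, p; rewrite invf_div.
Qed.

Lemma rational_horner (p : {poly k}) z : rational_in z -> rational_in (map_poly j p).[z].
Proof.
move=> hz; elim/poly_ind: p => [|p c IH]; first by rewrite rmorph0 horner0 -(rmorph0 j); apply: rational_const.
rewrite rmorphD rmorphM /= map_polyX map_polyC !hornerE.
by apply: rationalD; [apply: rationalM | apply: rational_const].
Qed.

End RationalIn.

Section QuadraticInvolution.
Variables (k L : fieldType) (e : {rmorphism k -> L}) (s : {rmorphism L -> L}).
Hypotheses (two0_ff : 2%:R != 0 :> L) (ed : has_ext_degree e 2) (se : forall r, s (e r) = e r).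

Lemma E_dep (w : 'I_3 -> L) : exists c : 'I_3 -> k,
  \sum_i e (c i) * w i = 0 /\ exists i, c i != 0.
Proof.
apply: contrapT => no; have [b [_ _ span]] := ed.
have : lin_indep e w.
  move=> c ce i; apply/eqP/negPn/negP => ci; apply: no; exists c; split=> //; by exists i.
by move/lin_indep_leq => /(_ _ b (fun i => span _ I)).
Qed.

Lemma E_dep3 (a b d : L) : exists c0 c1 c2,
  e c0 * a + e c1 * b + e c2 * d = 0 /\ ~~ [&& c0 == 0, c1 == 0 & c2 == 0].
Proof.
have [c [ce [i ci]]] := E_dep (fun i : 'I_3 => nth 0 [:: a; b; d] i).
exists (c ord0), (c (fintype.lift ord0 ord0)), (c (fintype.lift ord0 (fintype.lift ord0 ord0))); split.
  by rewrite -[RHS]ce !big_ord_recl big_ord0 /= addr0 addrA.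
apply/negP => /and3P[/eqP h0 /eqP h1 /eqP h2]; move/eqP: ci; apply.
case: (unliftP ord0 i) => [i1 ->|->]; last exact: h0.
case: (unliftP ord0 i1) => [i2 ->|->]; last exact: h1.
by have -> : i2 = ord0; [apply: val_inj; case: i2 => [[]] | exact: h2].
Qed.

(** y0 = z0 - s z0, where z0 is a root of c2 X^2 + c1 X + c0: s z0 is the other root, and y0^2 is
    the discriminant divided by c2^2. *)
Lemma exists_antisym z0 : s z0 != z0 -> exists y0, [/\ s y0 = - y0, y0 != 0 & exists r, y0 ^+ 2 = e r].
Proof.
move=> sz0; have [c0 [c1 [c2 [rel nc]]]] := E_dep3 1 z0 (z0 ^+ 2).
have c20 : c2 != 0.
  apply/eqP => c20; move: rel nc; rewrite c20 rmorph0 mul0r addr0 mulr1 eqxx andbT => rel.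
  have [c10|c10] := eqVneq c1 0.
    by move: rel; rewrite c10 rmorph0 mul0r addr0 => /eqP; rewrite fmorph_eq0 => ->.
  move=> _; case/eqP: sz0; have -> : z0 = e (- c0 / c1); last exact: se.
  have h : e c1 != 0 by rewrite fmorph_eq0.
  apply: (mulfI h); rewrite fmorph_div rmorphN mulrCA divff // mulr1.
  by apply/eqP; rewrite -addr_eq0 addrC rel.
have e20 : e c2 != 0 by rewrite fmorph_eq0.
have srel : e c0 * 1 + e c1 * s z0 + e c2 * s z0 ^+ 2 = 0.
  by have := congr1 s rel; rewrite rmorph0 !rmorphD !rmorphM /= !se rmorph1.
have d0 : z0 - s z0 != 0 by rewrite subr_eq0 eq_sym.
have sumE : e c1 + e c2 * (z0 + s z0) = 0.
  apply: (mulIf d0); rewrite mul0r -[RHS](subrr 0) -{1}rel -srel.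
  by move: (e c0) (e c1) (e c2) (s z0) => *; ring.
pose T := - e c1 / e c2.
have eT : z0 + s z0 = T.
  by apply: (mulfI e20); rewrite /T mulrCA divff // mulr1; apply/eqP; rewrite -addr_eq0 addrC sumE.
have es : s z0 = T - z0 by rewrite -eT addrAC subrr add0r.
have sT : s T = T by rewrite /T fmorph_div rmorphN /= !se.
exists (z0 - s z0); split=> //.
  by rewrite rmorphB /= es rmorphB /= sT /= es; ring.
exists ((- c1 / c2) ^+ 2 + - (c0 / c2) *+ 4).
rewrite rmorphD rmorphMn rmorphN rmorphXn !fmorph_div rmorphN /= -/T es.
have z2 : z0 ^+ 2 = T * z0 - e c0 / e c2.
  apply: (mulfI e20); apply/eqP; rewrite -subr_eq0 -[X in _ == X]rel /T.
  by apply/eqP; move: (e c0) (e c1) (e c2) e20 => ? ? ? ?; field.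
have -> : (z0 - (T - z0)) ^+ 2 = T ^+ 2 + (z0 ^+ 2 - T * z0) *+ 4 by ring.
by rewrite z2; move: (_ / _) => *; ring.
Qed.

Lemma E_gen y0 : s y0 = - y0 -> y0 != 0 -> forall w, exists a b, w = e a + e b * y0.
Proof.
move=> sy y00 w; have [c0 [c1 [c2 [rel nc]]]] := E_dep3 1 y0 w.
have y0s : y0 != - y0.
  by rewrite -subr_eq0 opprK -mulr2n -mulr_natl mulf_neq0 .
have c20 : c2 != 0.
  apply/eqP => c20; move: rel nc; rewrite c20 rmorph0 mul0r addr0 mulr1 eqxx andbT => rel.
  have [c10|c10] := eqVneq c1 0.
    by move: rel; rewrite c10 rmorph0 mul0r addr0 => /eqP; rewrite fmorph_eq0 => ->.
  move=> _; case/eqP: y0s; rewrite -sy; have -> : y0 = e (- c0 / c1); last by rewrite se.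
  have h : e c1 != 0 by rewrite fmorph_eq0.
  apply: (mulfI h); rewrite fmorph_div rmorphN mulrCA divff // mulr1.
  by apply/eqP; rewrite -addr_eq0 addrC rel.
have e20 : e c2 != 0 by rewrite fmorph_eq0.
exists (- c0 / c2), (- c1 / c2); apply: (mulfI e20).
rewrite !fmorph_div !rmorphN /= mulrDr [X in _ = X + _]mulrCA divff // mulr1 !mulrA.
rewrite [e c2 * - e c1]mulrC mulfK // mulNr -opprD; apply/eqP.
by rewrite -addr_eq0 addrC -[e c0]mulr1 rel.
Qed.

End QuadraticInvolution.

Section ModelExistence.
Variables (K : closedFieldType) (C : curve K) (O : curve_point C).
Hypothesis two0 : 2%:R != 0 :> K.
Local Notation L := (funfield C).
Local Notation j := (constf C).
Variable s : {rmorphism L -> L}.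
Variable e : {rmorphism {fraction {poly K}} -> L}.
Hypotheses (ec : const_compat j e) (ed : has_ext_degree e 2)
  (se : forall r, s (e r) = e r) (Os : forall z, ord O (s z) = ord O z).
Variable z0 : L.
Hypothesis sz0 : s z0 != z0.

Let x0 := e (FracField.tofrac 'X).

Lemma two0_ff : 2%:R != 0 :> L. Proof. by rewrite -(rmorph_nat j) fmorph_eq0. Qed.

Lemma e_poly (p : {poly K}) : e (FracField.tofrac p) = (map_poly j p).[x0].
Proof.
elim/poly_ind: p => [|p c IH]; first by rewrite !rmorph0 horner0.
rewrite rmorphD rmorphM /= [LHS]rmorphD rmorphM /= IH ec.
by rewrite rmorphD rmorphM /= map_polyX map_polyC !hornerE.
Qed.

(** The given x0 need not have a pole at O. If it takes a value c there, (x0 - c)^-1 has one.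
    Otherwise all of K(x0) would have order 0 at O; but for t of order 1, the product t * s t lies
    in K(x0) and has order 2, as s fixes O. *)
Lemma exists_coordinate : exists x, [/\ ord O x < 0, s x = x, rational_in j x x0 &
  forall p : {poly K}, (map_poly j p).[x] = 0 -> p = 0].
Proof.
have x0tr (p : {poly K}) : (map_poly j p).[x0] = 0 -> p = 0.
  by rewrite -e_poly => /eqP; rewrite fmorph_eq0 tofrac_eq0 => /eqP.
have [h|h] := ltP (ord O x0) 0.
  by exists x0; split=> //; [rewrite /x0 se | apply: rational_gen].
have xc0 c : x0 - j c != 0.
  apply/eqP => xc; have /eqP := polyXsubC_eq0 c; apply; apply: x0tr.
  by rewrite rmorphB /= map_polyX map_polyC !hornerE xc.
have [[c hc]|no] := pselect (exists c, 0 < ord O (x0 - j c)).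
  exists (x0 - j c)^-1; split.
  - by rewrite ordV oppr_lt0.
  - by rewrite fmorphV rmorphB /= /x0 se -ec se.
  - rewrite -[X in rational_in _ _ X](subrK (j c)) -[X in rational_in _ _ (X + _)]invrK.
    by apply: rationalD; [apply/rationalV/rational_gen | apply: rational_const].
  move=> p px; apply/eqP/negPn/negP => p0.
  have : algebraicOver j (x0 - j c)^-1 by exists p; rewrite // rootE px.
  move/algebraic_inv; rewrite invrK => /algebraic_add/(_ (algebraic_id _ c)).
  by rewrite subrK => -[q q0] /eqP/x0tr/eqP; apply/negP.
have o0 (p : {poly K}) : p != 0 -> ord O (map_poly j p).[x0] = 0.
  move=> p0; have [rs er] := closed_field_poly_normal p.
  have lp0 : lead_coef p != 0 by rewrite lead_coef_eq0.
  rewrite er map_polyZ rmorph_prod hornerZ horner_prod ordZ // ord_prod => [|c]; last first.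
    by rewrite rmorphB /= map_polyX map_polyC !hornerE xc0.
  rewrite big1 // => c _; rewrite rmorphB /= map_polyX map_polyC !hornerE.
  have [|//|->//] := ltgtP (ord O (x0 - j c)) 0 => hc; last by case: no; exists c.
  have : x0 - j c \in point_ring O.
    by rewrite rpredB ?const_point_ring // unfold_in h orbT.
  by rewrite unfold_in (negPf (xc0 c)) leNgt hc.
have oE r : ord O (e r) = 0.
  have [->|r0] := eqVneq r 0; first by rewrite rmorph0 Defs.ord0.
  have [p [q [q0 er]]] := frac_quotient r.
  have p0 : p != 0 by apply: contraNneq r0 => p0; rewrite er p0 tofrac0 mul0r.
  have nz (p' : {poly K}) : p' != 0 -> (map_poly j p').[x0] != 0.
    by move=> h'; apply: contraNneq h' => /x0tr->.
  by rewrite er fmorph_div /= !e_poly ordM ?invr_eq0 ?nz // ordV !o0 // subr0.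
have [y0 [sy y00 [D eD]]] := exists_antisym ed se sz0.
have [t t0 t1] := ord_surj O; have [a [b et]] := E_gen two0_ff ed se sy y00 t.
have st0 : s t != 0 by rewrite fmorph_eq0.
have := ordM O t0 st0; rewrite Os t1.
have -> : t * s t = e (a * a - b * b * D).
  rewrite et rmorphD rmorphM /= !se sy rmorphB /= ![e (_ * _)]rmorphM /= -eD.
  by move: (e a) (e b) => *; ring.
by rewrite oE.
Qed.

Lemma exists_model : exists M : hyper_model C,
  (ord O (hx M) < 0) /\ (forall z, ord O (hs M z) = ord O z).
Proof.
have [x [Ox sx xx0 xtr]] := exists_coordinate.
have [y0 [sy y00 [D eD]]] := exists_antisym ed se sz0.
have sj c : s (j c) = j c by rewrite -ec se.
have rE r : rational_in j x (e r).
  have [p [q [q0 ->]]] := frac_quotient r; rewrite fmorph_div /= !e_poly.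
  by apply: rationalM; [|apply: rationalV]; apply: rational_horner.
have xn0 (p : {poly K}) : p != 0 -> (map_poly j p).[x] != 0.
  by move=> h'; apply: contraNneq h' => /xtr->.
have sp (p : {poly K}) : s (map_poly j p).[x] = (map_poly j p).[x].
  rewrite -horner_map /= sx -map_poly_comp; congr (_.[_]).
  by apply: eq_map_poly => c /=; rewrite sj.
have [P [Q [Q0 ePQ]]] := rE D; rewrite -eD in ePQ.
have P0 : (map_poly j P).[x] != 0.
  by apply: contraNneq y00 => P0; rewrite -sqrf_eq0 ePQ P0 mul0r.
have PQ0 : P * Q != 0.
  by rewrite mulf_neq0 //; [apply: contraNneq P0 | apply: contraNneq Q0] => ->;
    rewrite rmorph0 horner0.
have [h [q [ehq sqq]]] := square_part PQ0.
have h0 : h != 0 by apply: contraNneq PQ0 => h0; rewrite ehq h0 expr0n mul0r.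
have q0 : q != 0 by apply: contraNneq PQ0 => q0; rewrite ehq q0 mulr0.
have lq0 : lead_coef q != 0 by rewrite lead_coef_eq0.
have [m m2] := sqrt_closed (lead_coef q).
have m0 : m != 0 by apply: contraNneq lq0 => m0; rewrite -m2 m0 expr0n.
(* From y0^2 = P / Q and P Q = h^2 q, the function Q y0 / h has square q; dividing it by a square
   root m of the leading coefficient makes the polynomial monic. *)
pose u := (map_poly j Q).[x] / (map_poly j h).[x] / j m.
pose y := u * y0; pose f := (lead_coef q)^-1 *: q.
have hx0 := xn0 h h0; have jm0 : j m != 0 by rewrite fmorph_eq0.
have u0 : u != 0 by rewrite !mulf_neq0 ?invr_eq0.
have su : s u = u by rewrite !fmorph_div /= !sp sj.
have sy' : s y = - y by rewrite rmorphM /= su sy mulrN.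
have y2 : y ^+ 2 = (map_poly j f).[x].
  have := congr1 (fun p : {poly K} => (map_poly j p).[x]) ehq.
  rewrite expr2 !rmorphM !hornerM -expr2 /= => e1.
  rewrite /y /u /f exprMn ePQ map_polyZ hornerZ /= fmorphV -m2 rmorphXn.
  have -> : (map_poly j q).[x] = (map_poly j P).[x] * (map_poly j Q).[x] / (map_poly j h).[x] ^+ 2.
    by rewrite e1 mulrC mulKf ?expf_neq0.
  move: (_.[x]) (_.[x]) (_.[x]) (j m) Q0 hx0 jm0 => a b c d Q0 hx0 jm0; field.
  by rewrite jm0 Q0 hx0.
have fm : f \is monic by rewrite monicE lead_coefZ mulVf.
have fsq c : ~~ (('X - c%:P) ^+ 2 %| f) by rewrite dvdpZr ?invr_eq0.
have gen (w : L) : exists p q r : {poly K}, r != 0 /\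
    w = ((map_poly j p).[x] + (map_poly j q).[x] * y) / (map_poly j r).[x].
  have [a [b ew]] := E_gen two0_ff ed se sy y00 w.
  have ru : rational_in j x u.
    by apply: rationalM; [apply: rationalM; [|apply: rationalV] | apply: rationalV]; try apply: rational_poly; apply: rational_const.
  have [p1 [q1 [q10 e1]]] := rE a.
  have [p2 [q2 [q20 e2]]] : rational_in j x (e b / u) by apply: rationalM (rE b) (rationalV ru).
  exists (p1 * q2), (p2 * q1), (q1 * q2); split.
    by apply: contraNneq (mulf_neq0 q10 q20) => e0; rewrite -hornerM -rmorphM e0 rmorph0 horner0.
  have -> : w = e a + (e b / u) * y by rewrite ew /y mulrA mulfVK.
  by rewrite e1 e2 !rmorphM !hornerM; field; rewrite q10 q20.
by exists (HyperModel sj sx sy' xtr y2 fm fsq gen).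
Qed.

End ModelExistence.

Lemma marked_model (K : closedFieldType) (C : curve K) (O : curve_point C) g :
    2%:R != 0 :> K -> marked_odd_hyperelliptic g O ->
  has_genus C g /\ exists M : hyper_model C,
    ord O (hx M) < 0 /\ forall z, ord O (hs M z) = ord O z.
Proof.
move=> two0 [hg [s [[e [ec ed se [z0 sz0]]] Os]]]; split=> //.
exact: (exists_model two0 ec (s := s) ed se Os sz0).
Qed.

(** * Descent of the base field *)

Section SubField.
Variables (L : fieldType) (S : divringClosed L).

Record sub_field := SubField { sub_field_val : L; sub_fieldP : sub_field_val \in S }.

HB.instance Definition _ := [isSub for sub_field_val].
HB.instance Definition _ := [Choice of sub_field by <:].
HB.instance Definition _ := [SubChoice_isSubUnitRing of sub_field by <:].
HB.instance Definition _ := [SubNzRing_isSubComNzRing of sub_field by <:].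
HB.instance Definition _ := [SubComUnitRing_isSubIntegralDomain of sub_field by <:].
HB.instance Definition _ := [SubIntegralDomain_isSubField of sub_field by <:].

Lemma sub_field_rmorphism (R : pzRingType) (h : {rmorphism R -> L}) :
  (forall r, h r \in S) ->
  exists h' : {rmorphism R -> sub_field}, forall r, \val (h' r) = h r.
Proof.
move=> hS; pose h0 r := SubField (hS r).
have hB : zmod_morphism h0 by move=> a b; apply: val_inj; rewrite /= !rmorphB.
have hM : monoid_morphism h0 by split=> [|a b]; apply: val_inj; rewrite /= ?rmorph1 ?rmorphM.
pose h1 : {rmorphism R -> sub_field} := HB.pack h0
  (GRing.isZmodMorphism.Build _ _ h0 hB) (GRing.isMonoidMorphism.Build _ _ h0 hM).
by exists h1.
Qed.

End SubField.

Lemma divringClosed_of_set (L : fieldType) (A : set L) :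
    [/\ A 1, forall x y, A x -> A y -> A (x - y) & forall x y, A x -> A y -> A (x / y)] ->
  exists S : divringClosed L, forall z, (z \in S) = `[< A z >].
Proof.
case=> A1 AB AV; pose P : {pred L} := fun z => `[< A z >].
have sP : divring_closed P.
  split=> [|x y /asboolP ? /asboolP ?|x y /asboolP ? /asboolP ?]; apply/asboolP => //.
    exact: AB.
  exact: AV.
pose S : divringClosed L := HB.pack P (GRing.isDivringClosed.Build L P sP).
by exists S.
Qed.

Lemma frac_lift (R : idomainType) (L : fieldType) (h : {rmorphism R -> L}) :
    (forall r, h r = 0 -> r = 0) ->
  exists e : {rmorphism {fraction R} -> L}, forall r, e (FracField.tofrac r) = h r.
Proof.
move=> h0; have hn0 r : r != 0 -> h r != 0 by apply: contraNneq => /h0 ->.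
have [n nP] := choice (fun r : {fraction R} => frac_quotient r).
have [d dP] := choice nP.
pose e0 r := h (n r) / h (d r).
have e0E p q : q != 0 -> e0 (FracField.tofrac p / FracField.tofrac q) = h p / h q.
  move=> q0; rewrite /e0; set r := FracField.tofrac p / _; have [dr er] := dP r.
  have fq0 : FracField.tofrac q != 0 by rewrite tofrac_eq0.
  have fd0 : FracField.tofrac (d r) != 0 by rewrite tofrac_eq0.
  move: er => /eqP; rewrite {1}/r eqr_div // -!rmorphM /= tofrac_eq => /eqP er.
  by apply/eqP; rewrite eqr_div ?hn0 // -!rmorphM -er.
have eC p : e0 (FracField.tofrac p) = h p.
  by rewrite -[FracField.tofrac p]divr1 -tofrac1 e0E ?oner_neq0 // rmorph1 divr1.
have eD : zmod_morphism e0.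
  move=> r s; have [dr {1}->] := dP r; have [ds {1}->] := dP s.
  rewrite -mulNr -tofracN addf_div ?tofrac_eq0 // -!tofracM -tofracD e0E ?mulf_neq0 //.
  rewrite rmorphD !rmorphM rmorphN /e0 -mulNr addf_div ?hn0 //.
have eM : monoid_morphism e0.
  split=> [|r s]; first by rewrite -tofrac1 eC rmorph1.
  have [dr {1}->] := dP r; have [ds {1}->] := dP s.
  by rewrite mulf_div -!tofracM e0E ?mulf_neq0 // !rmorphM -mulf_div.
pose e : {rmorphism {fraction R} -> L} := HB.pack e0
  (GRing.isZmodMorphism.Build _ _ e0 eD) (GRing.isMonoidMorphism.Build _ _ e0 eM).
by exists e.
Qed.

Section QuadraticCurve.
Variables (F L : fieldType) (j : {rmorphism F -> L}) (x y : L) (f : {poly F}).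

Definition hev (p : {poly F}) : L := (map_poly j p).[x].

Fact hev_zmod_morphism : zmod_morphism hev.
Proof. by move=> p q; rewrite /hev rmorphB !hornerE. Qed.
Fact hev_monoid_morphism : monoid_morphism hev.
Proof. by split=> [|p q]; rewrite /hev ?rmorph1 ?hornerC // rmorphM hornerM. Qed.
HB.instance Definition _ := GRing.isZmodMorphism.Build {poly F} L hev hev_zmod_morphism.
HB.instance Definition _ := GRing.isMonoidMorphism.Build {poly F} L hev hev_monoid_morphism.

Lemma hevC c : hev c%:P = j c.
Proof. by rewrite /hev map_polyC hornerC. Qed.
Lemma hevX : hev 'X = x.
Proof. by rewrite /hev map_polyX hornerX. Qed.

(** The subfield F(x, y) of L, once y is quadratic over F(x). *)
Definition quad_set : set L :=
  [set z | exists p q r : {poly F}, r != 0 /\ z = (hev p + hev q * y) / hev r]%classic.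

Hypotheses (transc : forall p, hev p = 0 -> p = 0)
  (indep : forall p q, hev p + hev q * y = 0 -> q = 0) (sq : y ^+ 2 = hev f).

Lemma hev_neq0 p : p != 0 -> hev p != 0.
Proof. by apply: contraNneq => /transc->. Qed.

Lemma indep2 p q : hev p + hev q * y = 0 -> p = 0 /\ q = 0.
Proof.
move=> e; have q0 := indep e; split=> //; apply: transc.
by move: e; rewrite q0 rmorph0 mul0r addr0.
Qed.

Lemma quad_set_poly p q : quad_set (hev p + hev q * y).
Proof. by exists p, q, 1; rewrite oner_neq0 rmorph1 divr1. Qed.

Lemma quad_set_divring : [/\ quad_set 1, forall a b, quad_set a -> quad_set b -> quad_set (a - b)
  & forall a b, quad_set a -> quad_set b -> quad_set (a / b)].
Proof.
have qM a b : quad_set a -> quad_set b -> quad_set (a * b).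
  move=> [p [q [r [r0 ->]]]] [p' [q' [r' [r'0 ->]]]].
  exists (p * p' + q * q' * f), (p * q' + q * p'), (r * r'); rewrite mulf_neq0 //; split=> //.
  rewrite mulf_div -rmorphM; congr (_ / _).
  rewrite !rmorphD !rmorphM /= -sq.
  by move: (hev p) (hev q) (hev p') (hev q') => *; ring.
split=> //.
- by have := quad_set_poly 1 0; rewrite rmorph1 rmorph0 mul0r addr0.
- move=> _ _ [p [q [r [r0 ->]]]] [p' [q' [r' [r'0 ->]]]].
  exists (p * r' - p' * r), (q * r' - q' * r), (r * r'); rewrite mulf_neq0 //; split=> //.
  rewrite -mulNr addf_div ?hev_neq0 // -rmorphM; congr (_ / _).
  rewrite !rmorphB !rmorphM /=.
  by move: (hev p) (hev q) (hev p') (hev q') (hev r) (hev r') => *; ring.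
move=> a b qa; have [-> _|b0 [p [q [r [r0 eb]]]]] := eqVneq b 0.
  by rewrite invr0 mulr0; have := quad_set_poly 0 0; rewrite rmorph0 mul0r addr0.
apply: qM => //; have n0 : hev p + hev q * y != 0.
  by apply: contraNneq b0 => e; rewrite eb e mul0r.
have nE : hev (p ^+ 2 - q ^+ 2 * f) = (hev p + hev q * y) * (hev p - hev q * y).
  by rewrite rmorphB !expr2 !rmorphM /= -sq; move: (hev p) (hev q) => *; ring.
have d0 : p ^+ 2 - q ^+ 2 * f != 0.
  apply: contraNneq n0 => e; move/eqP: nE; rewrite e rmorph0 eq_sym mulf_eq0.
  case/orP=> [//|/eqP e2]; have [] := @indep2 p (- q); first by rewrite rmorphN mulNr.
  by move=> -> /eqP; rewrite oppr_eq0 => /eqP->; rewrite rmorph0 mul0r addr0.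
exists (r * p), (- (r * q)), (p ^+ 2 - q ^+ 2 * f); split=> //.
have m0 : hev p - hev q * y != 0.
  by apply: contraNneq (hev_neq0 d0) => e; rewrite nE e mulr0.
rewrite nE eb invf_div rmorphN !rmorphM /=.
have -> : hev r * hev p + - (hev r * hev q) * y = hev r * (hev p - hev q * y).
  by rewrite mulNr -mulrA -mulrBr.
by rewrite -mulf_div divff // mulr1.
Qed.

(** F(x, y) has the basis 1, y over F(x), which makes it the function field of a curve over F. *)
Lemma quadratic_curve : exists (C0 : curve F) (v : {rmorphism funfield C0 -> L}),
  (forall a, v (constf C0 a) = j a) /\ (forall z, quad_set z <-> exists w, z = v w).
Proof.
have [S SE] := divringClosed_of_set quad_set_divring.
have hS p : hev p \in S.
  by rewrite SE; apply/asboolP; have := quad_set_poly p 0; rewrite rmorph0 mul0r addr0.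
have yS : y \in S.
  by rewrite SE; apply/asboolP; have := quad_set_poly 0 1; rewrite rmorph0 rmorph1 mul1r add0r.
have [e eE] := frac_lift transc.
have eQ p q : e (FracField.tofrac p / FracField.tofrac q) = hev p / hev q by rewrite fmorph_div /= !eE.
have eS r : e r \in S by have [p [q [_ ->]]] := frac_quotient r; rewrite eQ rpred_div.
have jS c : j c \in S by rewrite -hevC.
have [e' e'E] := sub_field_rmorphism eS; have [j' j'E] := sub_field_rmorphism jS.
pose Y := SubField yS; pose b (i : 'I_2) := if i == ord0 then 1 else Y.
have cP : exists (e : {rmorphism {fraction {poly F}} -> sub_field S}) (n : nat),
    const_compat j' e /\ has_ext_degree e n.
  exists e', 2; split; first by move=> c; apply: val_inj; rewrite e'E j'E eE /= hevC.
  exists b; split=> // [c|z _].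
    rewrite !big_ord_recl big_ord0 addr0 /b /= mulr1 => /(congr1 val).
    rewrite rmorphD rmorphM rmorph0 /= !e'E.
    have [p [q [q0 e0]]] := frac_quotient (c ord0).
    have [p' [q' [q'0 e1]]] := frac_quotient (c (fintype.lift ord0 ord0)).
    rewrite e0 e1 !eQ => /(congr1 (fun z => z * (hev q * hev q'))).
    rewrite mul0r => h; have [|pq0 p'q0] := @indep2 (p * q') (p' * q).
      rewrite !rmorphM /= -[RHS]h; have := hev_neq0 q0; have := hev_neq0 q'0.
      by move: (hev p) (hev q) (hev p') (hev q') => * ; field; apply/andP.
    have p0 : p = 0 by apply: (mulIf q'0); rewrite pq0 mul0r.
    have p'0 : p' = 0 by apply: (mulIf q0); rewrite p'q0 mul0r.
    move=> i; case: (unliftP ord0 i) => [i1 ->|->]; last by rewrite e0 p0 tofrac0 mul0r.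
    by rewrite ord1 e1 p'0 tofrac0 mul0r.
  have := sub_fieldP z; rewrite SE => /asboolP[p [q [r [r0 ez]]]].
  pose c (i : 'I_2) := FracField.tofrac (if i == ord0 then p else q) / FracField.tofrac r.
  exists c; apply: val_inj; rewrite !big_ord_recl big_ord0 addr0 /b /c /= mulr1.
  have e'Q a a' : sub_field_val (e' (FracField.tofrac a / FracField.tofrac a')) = hev a / hev a'.
    by rewrite -eQ -e'E.
  by rewrite !e'Q ez mulrDl mulrAC.
exists (@Curve F (sub_field S) j' cP), (\val : {rmorphism sub_field S -> L}).
split=> [a|z]; first exact: j'E.
split=> [zq|[w ->]]; last by have := sub_fieldP w; rewrite SE => /asboolP.
have zS : z \in S by rewrite SE; apply/asboolP.
by exists (SubField zS).
Qed.

End QuadraticCurve.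

(** Turns linear relations between polynomials into kernels of matrices, whose formation commutes
    with field extension. *)
Lemma mulmx_coef_eq0 (R : comNzRingType) n N (c : 'rV[R]_n) (P : 'I_n -> {poly R}) :
    (forall l, (size (P l) <= N)%N) ->
  (c *m \matrix_(l < n, m < N) (P l)`_m = 0) <-> (\sum_l c 0 l *: P l = 0).
Proof.
move=> sP; split=> [/matrixP h|h]; last first.
  apply/rowP => m; rewrite !mxE; have /polyP/(_ m) := h; rewrite coef0 => e; rewrite -[RHS]e.
  by rewrite coef_sum; apply: eq_bigr => l _; rewrite coefZ mxE.
apply/polyP => m; rewrite coef0 coef_sum; have [lt|le] := ltnP m N; last first.
  by rewrite big1 // => l _; rewrite coefZ nth_default ?mulr0 // (leq_trans (sP l)).
have := h 0 (Ordinal lt); rewrite !mxE => e; rewrite -[RHS]e.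
by apply: eq_bigr => l _; rewrite coefZ mxE.
Qed.

Section BaseChange.
Variables (F K : fieldType) (i : {rmorphism F -> K}) (C : curve K).
Variables (x y : funfield C) (f : {poly F}).
Local Notation L := (funfield C).
Local Notation j := (constf C).
Local Notation jF := (constf C \o i).

Hypotheses (transc : forall p, hev j x p = 0 -> p = 0)
  (indep : forall p q, hev j x p + hev j x q * y = 0 -> q = 0)
  (sq : y ^+ 2 = hev j x (map_poly i f))
  (gen : forall z, quad_set j x y z).

Lemma hev_comp p : hev jF x p = hev j x (map_poly i p).
Proof. by rewrite /hev -map_poly_comp. Qed.

Lemma hevZ c p : hev j x (c *: p) = j c * hev j x p.
Proof. by rewrite -mul_polyC rmorphM /= hevC. Qed.

(** Linear disjointness: after multiplication by a common denominator, the F-relations between the b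
    l form the kernel of a matrix of coefficients over F. This kernel is zero, and it stays zero
    over K. *)
Lemma descends : defined_over i C.
Proof.
have mi0 p : map_poly i p = 0 -> p = 0 by move/eqP; rewrite map_poly_eq0 => /eqP.
have transcF p : hev jF x p = 0 -> p = 0 by rewrite hev_comp => /transc/mi0.
have indepF p q : hev jF x p + hev jF x q * y = 0 -> q = 0.
  by rewrite !hev_comp => /indep/mi0.
have sqF : y ^+ 2 = hev jF x f by rewrite hev_comp.
have [C0 [v [vj vq]]] := quadratic_curve transcF indepF sqF.
exists C0, v; split=> [//|n b bind|z]; last first.
  have [p [q [r [r0 ->]]]] := gen z.
  pose N := maxn (size p) (maxn (size q) (size r)).
  have [X eX] : exists X, x = v X.
    apply/vq; have := quad_set_poly jF x y 'X 0.
    by rewrite hevX rmorph0 mul0r addr0.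
  have [Y eY] : exists Y, y = v Y.
    apply/vq; have := quad_set_poly jF x y 0 1.
    by rewrite rmorph0 rmorph1 mul1r add0r.
  pose b (l : 'I_(N + N)) := match fintype.split l with inl m => X ^+ m | inr m => X ^+ m * Y end.
  pose cf (a a' : {poly K}) (l : 'I_(N + N)) :=
    match fintype.split l with inl m => a`_m | inr m => a'`_m end.
  have sumE (a a' : {poly K}) : (size a <= N)%N -> (size a' <= N)%N ->
      \sum_l j (cf a a' l) * v (b l) = hev j x a + hev j x a' * y.
    move=> sa sa'; rewrite big_split_ord /=; congr (_ + _).
      rewrite /hev (horner_coef_wide _ (leq_trans (size_poly _ _) sa)).
      apply: eq_bigr => m _; have e := unsplitK (inl m : 'I_N + 'I_N).
      by rewrite /cf /b e coef_map rmorphXn /= eX.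
    rewrite /hev (horner_coef_wide _ (leq_trans (size_poly _ _) sa')) mulr_suml.
    apply: eq_bigr => m _; have e := unsplitK (inr m : 'I_N + 'I_N).
    by rewrite /cf /b e coef_map rmorphM rmorphXn /= eX eY mulrA.
  exists (N + N)%N, b, b, (cf p q), (cf r 0).
  rewrite !sumE ?size_poly0 ?leq_max ?leqnn ?orbT // rmorph0 mul0r addr0; split=> //.
  by apply: contraNneq r0 => /transc ->.
move=> c /= crel.
have vbP l : quad_set jF x y (v (b l)) by apply/vq; exists (b l).
have [P PP] := choice vbP; have [Q QP] := choice PP; have [R RP] := choice QP.
pose D := \prod_l R l; pose D' l := \prod_(m | m != l) R m.
have DE l : D = R l * D' l by rewrite /D (bigD1 l).
have n0 p : p != 0 -> hev jF x p != 0 by apply: contraNneq => /transcF ->.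
have D0 : hev jF x D != 0.
  by apply/n0/prodf_neq0 => l _; case: (RP l).
have bE l : v (b l) * hev jF x D = hev jF x (P l * D' l) + hev jF x (Q l * D' l) * y.
  have [r0 ->] := RP l; rewrite (DE l) !rmorphM /=; have := n0 _ r0.
  by move: (hev _ _ _) (hev _ _ _) (hev _ _ _) (hev _ _ _) => ? ? ? ? ?; field.
pose P' l := P l * D' l; pose Q' l := Q l * D' l.
pose N := (\max_l size (P' l) + \max_l size (Q' l))%N.
have sP l : (size (P' l) <= N)%N by apply: leq_trans (leq_addr _ _); exact: (leq_bigmax (F := fun l => size (P' l))).
have sQ l : (size (Q' l) <= N)%N by apply: leq_trans (leq_addl _ _); exact: (leq_bigmax (F := fun l => size (Q' l))).
pose A : 'M[F]_(n, N + N) :=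
  row_mx (\matrix_(l, m) (P' l)`_m) (\matrix_(l, m) (Q' l)`_m).
have relF (u : 'rV[F]_n) : u *m A = 0 -> u = 0.
  rewrite mul_mx_row -row_mx0 => /eq_row_mx[/(mulmx_coef_eq0 _ sP) hP /(mulmx_coef_eq0 _ sQ) hQ].
  apply/rowP => l; rewrite mxE; apply: (bind (fun l => u 0 l)).
  apply: (fmorph_inj v); rewrite rmorph0; apply: (mulIf D0); rewrite mul0r rmorph_sum mulr_suml.
  transitivity (hev jF x (\sum_l u 0 l *: P' l) + hev jF x (\sum_l u 0 l *: Q' l) * y); last first.
    by rewrite hP hQ !rmorph0 mul0r addr0.
  rewrite !rmorph_sum mulr_suml -big_split; apply: eq_bigr => m _ /=.
  rewrite rmorphM vj -mulrA bE !hev_comp !map_polyZ !hevZ.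
  by rewrite mulrDr mulrA.
have kA : kermx A = 0.
  by apply/row_matrixP => l; rewrite row0; apply: relF; apply: sub_kermxP; apply: row_sub.
pose u := \row_l c l.
suff : u *m map_mx i A = 0.
  move=> /sub_kermxP; rewrite -map_kermx kA map_mx0 submx0 => /eqP/rowP h l.
  by have := h l; rewrite !mxE.
have mE (G : 'I_n -> {poly F}) :
    map_mx i (\matrix_(l < n, m < N) (G l)`_m) = \matrix_(l < n, m < N) (map_poly i (G l))`_m.
  by apply/matrixP => l m; rewrite !mxE coef_map.
have s' (G : 'I_n -> {poly F}) l : (size (G l) <= N -> size (map_poly i (G l)) <= N)%N.
  by rewrite size_map_poly.
have rel : hev j x (\sum_l u 0 l *: map_poly i (P' l)) +
           hev j x (\sum_l u 0 l *: map_poly i (Q' l)) * y = 0.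
  transitivity ((\sum_l j (c l) * v (b l)) * hev jF x D); last by rewrite crel mul0r.
  rewrite !rmorph_sum !mulr_suml -big_split; apply: eq_bigr => m _ /=.
  by rewrite -[RHS]mulrA bE !hev_comp !hevZ mxE mulrDr mulrA.
have [hP hQ] := indep2 transc indep rel.
rewrite map_row_mx mul_mx_row -row_mx0 !mE; congr row_mx.
  by apply/(mulmx_coef_eq0 _ (fun l => s' _ l (sP l))).
by apply/(mulmx_coef_eq0 _ (fun l => s' _ l (sQ l))).
Qed.

End BaseChange.

(** * Finite extensions generated by algebraic elements *)

Lemma adjoin_algebraic (k K : fieldType) (F : fieldExtType k) (i : {rmorphism F -> K}) z :
    algebraicOver i z ->
  exists (E : fieldExtType k) (i' : {rmorphism E -> K}),
    [/\ forall c : k, i' c%:A = i c%:A, forall u, exists w, i u = i' w & exists w, z = i' w].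
Proof.
move=> [p p0 pz].
have exn : exists n, `[< exists q, [/\ q != 0, root (map_poly i q) z & size q = n] >].
  by exists (size p); apply/asboolP; exists p.
have [n /asboolP[r [r0 rz sr]] min] := ex_minnP exn.
have irr : irreducible_poly r.
  apply/(subfx_irreducibleP rz r0) => q qz q0; rewrite sr; apply: min.
  by apply/asboolP; exists q.
exists (baseFieldType (SubFieldExtType rz irr)), (@subfx_inj _ _ i z r); split.
- by move=> c; rewrite baseField_scaleE; apply: (subfx_inj_base rz r0).
- by move=> u; have := subfx_inj_base rz r0 u => <-; eexists.
by exists (subfx_root i z r); apply/esym/(subfx_inj_root rz r0).
Qed.

Lemma finite_extension_seq (k K : fieldType) (iota : {rmorphism k -> K}) (s : seq K) :
    (forall z, z \in s -> algebraicOver iota z) ->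
  exists (F : fieldExtType k) (i : {rmorphism F -> K}),
    (forall c, i c%:A = iota c) /\ (forall z, z \in s -> exists w, z = i w).
Proof.
elim: s => [|z s IH] alg.
  exists k^o, iota; split=> // c; congr (iota _); exact: mulr1.
have [|F [i [ic is_]]] := IH; first by move=> w ws; apply: alg; rewrite inE ws orbT.
have [|E [i' [i'c ii' [w ew]]]] := @adjoin_algebraic k K F i z.
  have [p p0 pz] := alg z (mem_head _ _).
  exists (map_poly (in_alg F) p); first by rewrite map_poly_eq0.
  by rewrite -map_poly_comp (eq_map_poly (g := iota)).
exists E, i'; split=> [c|u]; first by rewrite i'c.
by rewrite inE => /orP[/eqP->|/is_[u' ->]]; [exists w | apply: ii'].
Qed.

Lemma lift_poly (F K : fieldType) (i : {rmorphism F -> K}) (p : {poly K}) :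
  (forall m, exists w, p`_m = i w) -> exists q, p = map_poly i q.
Proof.
move=> /choice[w ew]; exists (\poly_(m < size p) w m); apply/polyP => m.
rewrite coef_map coef_poly; case: ltnP => [_|le]; first exact: ew.
by rewrite nth_default //; apply/esym/(rmorph0 i).
Qed.

Lemma finite_extension_poly (k K : fieldType) (iota : {rmorphism k -> K}) (p : {poly K}) :
    (forall m, algebraicOver iota p`_m) ->
  exists (F : fieldExtType k) (i : {rmorphism F -> K}) q, p = map_poly i q.
Proof.
move=> alg; have [|F [i [_ ip]]] := @finite_extension_seq k K iota p.
  by move=> z /(nthP 0)[m _ <-].
exists F, i; apply: lift_poly => m; have [lt|le] := ltnP m (size p).
  exact/ip/mem_nth.
by exists 0; rewrite nth_default ?rmorph0.
Qed.

(** p has order 2 g modulo q = 2 g + 1, so p^g is a square root of 1 other than 1, hence -1, and m =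
    p^g works. Moreover p != q, as p is invertible modulo q. *)
Lemma primitive_root_unity_conj (K : closedFieldType) g p : prime p -> p \in [pchar K] ->
    prime (2 * g + 1) -> primitive_root_mod p (2 * g + 1) ->
  has_unity_conj K (2 * g + 1) /\ (2 * g + 1)%:R != 0 :> K.
Proof.
set q := (2 * g + 1)%N => pp pK pq pr; have qE : q.-1 = (2 * g)%N by rewrite /q; lia.
rewrite /primitive_root_mod qE in pr.
have g0 : (0 < g)%N by have := prime_gt1 pq; rewrite /q; lia.
have pX : (p%:R : 'F_q) ^+ g = -1.
  have e1 := prim_expr_order pr; rewrite mulnC exprM in e1.
  move/eqP: e1; rewrite sqrf_eq1 => /orP[/eqP e|/eqP //].
  have := dvdn_leq g0 (m := g) (d := 2 * g); rewrite (prim_order_dvd pr) e eqxx => /(_ isT).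
  by lia.
split.
  right; exists (p ^ g)%N; split; first by rewrite (pnatX) (pnatE _ pp) pK.
  by rewrite (dvdn_pcharf (pchar_Fp pq)) -natr1 natrX pX addNr.
rewrite -(dvdn_pcharf pK) dvdn_prime2 //; apply/negP => /eqP pqE.
have := prim_expr_order pr; rewrite pqE pchar_Fp_0 // expr0n.
by rewrite muln_eq0 (gtn_eqF g0) /= => /esym/eqP; rewrite oner_eq0.
Qed.

Section ModelDescent.
Variables (F : fieldType) (K : closedFieldType) (i : {rmorphism F -> K}) (C : curve K).
Variables (M : hyper_model C).
Hypothesis two0 : 2%:R != 0 :> K.
Local Notation L := (funfield C).
Local Notation j := (constf C).

(** x' = (x - a) / b and y' = y / d, with d^2 = b^n, satisfy y'^2 = q(x') and generate the same
    field. *)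
Lemma model_descends (a b : K) n (q : {poly F}) : b != 0 ->
  b ^- n *: (hf M \Po (b *: 'X + a%:P)) = map_poly i q -> defined_over i C.
Proof.
move=> b0 eq_q.
have [d d2] := sqrt_closed (b ^+ n).
have d0 : d != 0 by rewrite -sqrf_eq0 d2 expf_neq0.
have jd0 : j d != 0 by rewrite fmorph_eq0.
pose l : {poly K} := b^-1 *: ('X - a%:P); pose m : {poly K} := b *: 'X + a%:P.
have lm : m \Po l = 'X.
  by rewrite /m comp_polyD comp_polyZ comp_polyX comp_polyC /l scalerA divff // scale1r subrK.
have ml : l \Po m = 'X.
  by rewrite /l comp_polyZ comp_polyB comp_polyX comp_polyC /m addrK scalerA mulVf // scale1r.
pose x' := hev j (hx M) l; pose y' := hy M / j d.
have hx' p : hev j x' p = ev M (p \Po l).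
  by rewrite /hev /x' /hev /ev map_comp_poly horner_comp.
have hxm p : hev j x' (p \Po m) = ev M p by rewrite hx' -comp_polyA lm comp_polyXr.
have co p : p \Po l = 0 -> p = 0.
  by move=> e; rewrite -[p]comp_polyXr -ml comp_polyA e comp_poly0.
have hy' q1 : hev j x' q1 * y' = ev M (d^-1 *: (q1 \Po l)) * hy M.
  by rewrite hx' /y' -mul_polyC rmorphM /= evC fmorphV [hy M / _]mulrC mulrA [ev M _ * _^-1]mulrC.
apply: (@descends F K i C x' y' q).
- by move=> p /eqP; rewrite hx' ev_eq0 // => /eqP/co.
- move=> p q1; rewrite hy' hx' => e; apply: co; apply/eqP.
  have [_ /eqP] := lin_eq0 two0 e.
  by rewrite scaler_eq0 invr_eq0 (negPf d0).
- rewrite -eq_q -mul_polyC rmorphM /= hevC hxm /y' expr_div_n hy_sqr -evE.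
  by rewrite -rmorphXn /= d2 fmorphV mulrC.
move=> z; have [p [q1 [r [r0 ->]]]] := h_gen M z.
exists (p \Po m), (d *: (q1 \Po m)), (r \Po m); split.
  by apply: contraNneq r0 => e; rewrite -(ev_eq0 M) -hxm e rmorph0.
rewrite !hxm hevZ hxm -mulrA /y'; congr ((_ + _) / _).
by rewrite mulrCA; congr (_ * _); rewrite mulrC divfK.
Qed.

End ModelDescent.

Theorem theorem2 (g : nat) (hg : (1 < g)%N) (K : closedFieldType)
  (hK : [pchar K] =i pred0 \/
        (prime (2 * g + 1) /\
         exists p : nat, [/\ prime p, odd p, p \in [pchar K] &
                             primitive_root_mod p (2 * g + 1)]))
  (C : curve K) (O : curve_point C) (hC : marked_odd_hyperelliptic g O)
  (hcard : (`I_5 #<= torsion_points O (2 * g + 1))%card) :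
  ([pchar K] =i pred0 -> defined_over_number_field C) /\
  (forall p : nat, p \in [pchar K] -> defined_over_finite_field C).
Proof.
have natr0 (m : nat) : [pchar K] =i pred0 -> (0 < m)%N -> m%:R != 0 :> K.
  by move=> c0 m0; rewrite natf_neq0_pchar /pnat m0; apply/allP => p _; rewrite inE /= c0.
have [two0 n0 conj] : [/\ 2%:R != 0 :> K, (2 * g + 1)%:R != 0 :> K & has_unity_conj K (2 * g + 1)].
  case: hK => [c0|[pq [p [pp podd pK pr]]]].
    by split; [exact: natr0 | apply: natr0 => //; rewrite addn1 | left].
  have [conj n0] := primitive_root_unity_conj pp pK pq pr; split=> //.
  rewrite -(dvdn_pcharf pK) dvdn_prime2 //; apply/negP => /eqP p2.
  by rewrite p2 in podd.
have [gC [M [Ox Os]]] := marked_model two0 hC.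
have hgM := genus_unique two0 Ox Os gC.
have := @three_relations K C M two0 O Ox Os; rewrite hgM.
case=> [|//|a1 [a2 [a3 [v1 [v2 [v3 [[a12 a13 a23] [f1 f2 f3] [s1 s2 s3]]]]]]]].
  exact: ltnW.
(* One argument serves both parts, k being the field of rationals or F_p. *)
have main (k : fieldType) (iota : {rmorphism k -> K}) :
    exists (F : fieldExtType k) (i : {rmorphism F -> K}), defined_over i C.
  have [b b0 alg] :=
    three_points_algebraic iota hg n0 two0 conj f1 f2 f3 a12 a13 a23 s1 s2 s3.
  have [F [i [q eq_q]]] := finite_extension_poly alg.
  by exists F, i; exact: (model_descends two0 (i := i) b0 eq_q).
split=> [c0|p pK].
  by have [iota _] := rat_rmorphism c0; apply: main iota.
(* A finite extension of F_p is a finite field. *)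
have [iota _] := Fp_rmorphism pK; have [F [i iC]] := main _ iota.
by exists (FinFieldExtType F), i.
Qed.
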